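(* Let $G$ be a connected noncompact semisimple real Lie group with finite center, with notation $K,H,A,A^+,\Delta_\sigma,\Sigma_\sigma^+,\mathcal W$ as in the context, fix a Riemannian metric on $G$ and let $\mathcal O_\varepsilon$ be the open $\varepsilon$-ball about $e$. Given $c>0$, there exist $\ell>1$ and $\varepsilon_0>0$ such that for any $I\subset\Delta_\sigma$, $J=\Delta_\sigma\setminus I$, every $k\in K$, $a\in A^+$, $w\in\mathcal W$, $h\in H$ with $\alpha(\log a)\ge c$ for all $\alpha\in J$, setting $g=kawh$, and every $0<\varepsilon<\varepsilon_0$, $$\mathcal O_\varepsilon\cdot g\subset (K\cap\mathcal O_{\ell\varepsilon})k\cdot(M_I\cap\mathcal O_{\ell\varepsilon})\cdot(A_I\cap\mathcal O_{\ell\varepsilon})a\cdot w\,(H\cap\mathcal O_{\ell\varepsilon})h.$$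
   Context: Let $\sigma$ be an involution of $G$ and $H$ a closed subgroup whose identity component equals the identity component of the fixed points of $\sigma$. Let $\theta$ be a Cartan involution commuting with $\sigma$, $K$ its fixed points; $\mathfrak g=\mathfrak k\oplus\mathfrak p=\mathfrak h\oplus\mathfrak q$ with $\mathfrak p,\mathfrak q$ the $(-1)$-eigenspaces of $\theta,\sigma$. Let $\mathfrak a$ be a maximal abelian subspace of $\mathfrak p\cap\mathfrak q$ contained in a maximal abelian subspace $\mathfrak b$ of $\mathfrak p$, $A=\exp\mathfrak a$, $\mathfrak g^\alpha$ the joint $\operatorname{ad}\mathfrak a$-eigenspaces, $\Sigma_\sigma=\{\alpha\ne0:\mathfrak g^\alpha\neq0\}$, $A^+$ a closed positive Weyl chamber with positive roots $\Sigma_\sigma^+$ and simple roots $\Delta_\sigma$, and $\mathcal W\subset N_K(\mathfrak a)\cap N_K(\mathfrak b)$ a set of representatives of $N_K(\mathfrak a)/N_{K\cap H}(\mathfrak a)Z_K(\mathfrak a)$. For $I\subset\Delta_\sigma$: $A_I=\exp\{X\in\mathfrak a:\alpha(X)=0\ \forall\alpha\in I\}$, and $M_I$ is the analytic semisimple subgroup whose Lie algebra is generated by $\mathfrak g^{\pm\beta}$, $\beta\in\Sigma_\sigma^+\cap\langle I\rangle$ ($\langle I\rangle$ the span of $I$). *)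

(* Defs.v *)
From HB Require Import structures.
From mathcomp Require Import all_boot all_order all_algebra.
From mathcomp Require Import all_classical all_reals all_analysis.

Set Implicit Arguments.
Unset Strict Implicit.
Unset Printing Implicit Defensive.

Import Order.TTheory GRing.Theory Num.Theory.
Import numFieldTopology.Exports numFieldNormedType.Exports.

Local Open Scope classical_set_scope.
Local Open Scope ring_scope.

(* [Ck k f U]: f is C^k on the open set U.  In finite dimension, "all
   directional derivatives are C^k" says that the total derivative is C^k. *)
Fixpoint Ck (R : realType) (V W : normedModType R) (k : nat)
    (f : V -> W) (U : set V) : Prop :=
  match k with
  | 0 => forall x, U x -> {for x, continuous f}
  | k'.+1 => (forall x, U x -> differentiable f x) /\
             forall v, Ck k' (fun x => 'D_v f x) U
  end.

Definition Cinfty (R : realType) (V W : normedModType R)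
  (f : V -> W) (U : set V) : Prop := forall k, Ck k f U.

(* A chart is a homeomorphism [cmap] from the open set [cdom] of T onto an open
   subset of R^(n+1).  [cinv] is its inverse, used only on [cimg]; its
   continuity there is part of [smooth_into]. *)
Record chart (R : realType) (n : nat) (T : topologicalType) := Chart {
  cdom : set T;
  cmap : T -> 'rV[R]_n.+1;
  cinv : 'rV[R]_n.+1 -> T;
  cdom_open : open cdom;
  cimg_open : open (cmap @` cdom);
  cmap_continuous : forall x, cdom x -> {for x, continuous cmap};
  cmapK : forall x, cdom x -> cinv (cmap x) = x }.

Definition cimg (R : realType) (n : nat) (T : topologicalType)
  (c : chart R n T) : set 'rV[R]_n.+1 := cmap c @` cdom c.

(* F : U -> T is smooth, where U is open in a normed space and T carries the
   given atlas. *)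
Definition smooth_into (R : realType) (n : nat) (T : topologicalType)
    (atlas : set (chart R n T)) (V : normedModType R)
    (F : V -> T) (U : set V) : Prop :=
  (forall x, U x -> {for x, continuous F}) /\
  forall c, atlas c ->
    Cinfty (fun x => cmap c (F x)) (U `&` F @^-1` cdom c).

(* Real Lie groups of dimension n+1 (dimension 0, a discrete group, is left
   out).  [cinv_smooth] says that the charts are smoothly compatible. *)
HB.mixin Record isLieGroup (R : realType) (n : nat) G
    of Group G & Topological G := {
  atlas : set (chart R n G);
  lie_hausdorff : hausdorff_space G;
  lie_second_countable : @second_countable G;
  atlas_cover : forall x : G, exists2 c, atlas c & cdom c x;
  cinv_smooth : forall c, atlas c -> smooth_into atlas (cinv c) (cimg c);
  mul_smooth : forall c1 c2, atlas c1 -> atlas c2 ->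
    smooth_into atlas
      (fun p : 'rV[R]_n.+1 * 'rV[R]_n.+1 => (cinv c1 p.1 * cinv c2 p.2)%g)
      (cimg c1 `*` cimg c2);
  inv_smooth : forall c, atlas c ->
    smooth_into atlas (fun u => (cinv c u)^-1%g) (cimg c) }.

#[short(type="lieGroupType")]
HB.structure Definition LieGroup (R : realType) (n : nat) :=
  {G of isLieGroup R n G & Group G & Topological G}.

Section GroupSets.
Context {G : groupType}.
Implicit Types (A B S : set G) (g x y : G).

Definition subgroup S : Prop :=
  [/\ S 1%g, forall x y, S x -> S y -> S (x * y)%g & forall x, S x -> S x^-1%g].

Definition mulset A B : set G := [set (x * y)%g | x in A & y in B].

Definition group_center : set G := [set x | forall y, (x * y = y * x)%g].

Definition fixed_points (phi : G -> G) : set G := [set x | phi x = x].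

Definition conj g x : G := (g * x * g^-1)%g.

End GroupSets.

Infix "*s" := mulset (at level 40, left associativity) : classical_set_scope.

Section LinearSets.
Context {R : realType} {V : lmodType R}.
Implicit Types (S A : set V).

Definition subspace S : Prop :=
  S 0 /\ forall (r : R) x y, S x -> S y -> S (r *: x + y).

Definition span A : set V := smallest subspace A.

Definition basis_of S (m : nat) (e : 'I_m -> V) : Prop :=
  (forall i, S (e i)) /\
  forall x, S x -> exists! r : 'rV[R]_m, x = \sum_(i < m) r 0 i *: e i.

(* Trace of the restriction of T to the finite-dimensional T-stable S. *)
Definition trace_on S (T : V -> V) : R :=
  xget 0 [set t | exists (m : nat) (e : 'I_m -> V) (M : 'M[R]_m),
    [/\ basis_of S e,
        forall j, T (e j) = \sum_(i < m) M i j *: e i & t = \tr M]].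

(* Elements of the dual of S, extended by 0 outside S so that two functionals
   are equal exactly when they agree on S. *)
Definition dual S : set (V -> R) :=
  [set alpha | (forall x, ~ S x -> alpha x = 0) /\
    forall (r : R) x y, S x -> S y ->
      alpha (r *: x + y) = r * alpha x + alpha y].

End LinearSets.

Definition vfield (R : realType) (n : nat) (G : lieGroupType R n) : Type :=
  (G -> R) -> (G -> R).

Section LieAlgebra.
Context {R : realType} {n : nat} {G : lieGroupType R n}.
Implicit Types (X Y Z : vfield G) (f : G -> R) (phi : G -> G)
  (S I : set (vfield G)) (gam : R -> G).

Definition smooth_fun f : Prop :=
  forall c : chart R n G, atlas c -> Cinfty (fun u => f (cinv c u)) (cimg c).

Definition smooth_endo phi : Prop :=
  forall c : chart R n G, atlas c ->
    smooth_into atlas (fun u => phi (cinv c u)) (cimg c).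

Definition smooth_curve gam : Prop := smooth_into (@atlas R n G) gam setT.

(* Left-invariant vector fields, as derivations of C^oo(G), extended by 0 to
   non-smooth functions so that equality of fields is equality of maps. *)
Definition lie_algebra : set (vfield G) :=
  [set X | [/\ forall f, ~ smooth_fun f -> X f = (fun=> 0),
     forall f, smooth_fun f -> smooth_fun (X f),
     forall (r : R) f1 f2, smooth_fun f1 -> smooth_fun f2 ->
       X (fun x => r * f1 x + f2 x) = (fun x => r * X f1 x + X f2 x),
     forall f1 f2, smooth_fun f1 -> smooth_fun f2 ->
       X (fun x => f1 x * f2 x) = (fun x => f1 x * X f2 x + X f1 x * f2 x) &
     forall g f, smooth_fun f ->
       X (fun x => f (g * x)%g) = (fun x => X f (g * x)%g)]].

Definition bracket X Y : vfield G := fun f x => X (Y f) x - Y (X f) x.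

(* Differential of the automorphism phi of G, with inverse psi. *)
Definition pushforward phi (psi : G -> G) X : vfield G :=
  fun f x => X (f \o phi) (psi x).

Definition Ad (g : G) : vfield G -> vfield G :=
  pushforward (conj g) (conj g^-1%g).

(* gam'(t), left-translated to the Lie algebra, is X *)
Definition has_velocity gam (t : R) X : Prop :=
  lie_algebra X /\
  forall f, smooth_fun f -> is_derive t 1 (f \o gam) (X f (gam t)).

Definition lie_exp X : G :=
  xget 1%g [set g | exists gam : R -> G,
    [/\ smooth_curve gam, forall s t, gam (s + t) = (gam s * gam t)%g,
        has_velocity gam 0 X & g = gam 1]].

Definition lie_log (a : set (vfield G)) (g : G) : vfield G :=
  xget 0 [set X | a X /\ lie_exp X = g].

Definition killing X Y : R :=
  trace_on lie_algebra (fun Z => bracket X (bracket Y Z)).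

Definition lie_ideal I : Prop :=
  [/\ subspace I, I `<=` lie_algebra &
      forall X Y, lie_algebra X -> I Y -> I (bracket X Y)].

Definition derived S : set (vfield G) :=
  span [set bracket X Y | X in S & Y in S].

Definition solvable_alg S : Prop := exists k, iter k derived S = [set 0].

Definition lie_subalgebra S : Prop :=
  [/\ subspace S, S `<=` lie_algebra &
      forall X Y, S X -> S Y -> S (bracket X Y)].

Definition generated_alg S : set (vfield G) := smallest lie_subalgebra S.

(* The connected Lie subgroup with Lie algebra S: it is generated by exp S. *)
Definition analytic_subgroup S : set G := smallest subgroup (lie_exp @` S).

Definition lie_involution phi : Prop :=
  [/\ smooth_endo phi, forall x y, phi (x * y)%g = (phi x * phi y)%g &
      forall x, phi (phi x) = x].

Definition d_invol phi : vfield G -> vfield G := pushforward phi phi.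

Definition minus_eigenspace phi : set (vfield G) :=
  [set X | lie_algebra X /\ d_invol phi X = - X].

Definition cartan_involution phi : Prop :=
  lie_involution phi /\
  forall X, lie_algebra X -> X != 0 -> 0 < - killing X (d_invol phi X).

Definition abelian_subspace S : Prop :=
  subspace S /\ forall X Y, S X -> S Y -> bracket X Y = 0.

Definition maximal_abelian_in (p a : set (vfield G)) : Prop :=
  [/\ abelian_subspace a, a `<=` p &
      forall a', abelian_subspace a' -> a' `<=` p -> a `<=` a' -> a' = a].

Definition root_space (a : set (vfield G)) (alpha : vfield G -> R) :
    set (vfield G) :=
  [set X | lie_algebra X /\ forall Y, a Y -> bracket Y X = alpha Y *: X].

Definition roots (a : set (vfield G)) : set (vfield G -> R) :=
  [set alpha | [/\ dual a alpha, alpha != 0 &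
                   exists2 X, root_space a alpha X & X != 0]].

(* Sp is the set of roots that are positive on some open Weyl chamber of a. *)
Definition positive_system (a : set (vfield G)) (Sp : set (vfield G -> R)) :
    Prop :=
  exists X0, [/\ a X0, forall alpha, roots a alpha -> alpha X0 != 0 &
                 Sp = [set alpha | roots a alpha /\ 0 < alpha X0]].

Definition simple_roots (Sp : set (vfield G -> R)) : set (vfield G -> R) :=
  [set alpha | Sp alpha /\
     ~ exists beta gamma, [/\ Sp beta, Sp gamma & alpha = beta + gamma]].

Definition closed_chamber (a : set (vfield G)) (Sp : set (vfield G -> R)) :
    set G :=
  lie_exp @` [set X | a X /\ forall alpha, Sp alpha -> 0 <= alpha X].

Definition A_sub (a : set (vfield G)) (I : set (vfield G -> R)) : set G :=
  lie_exp @` [set X | a X /\ forall alpha, I alpha -> alpha X = 0].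

Definition M_sub (a : set (vfield G)) (Sp I : set (vfield G -> R)) : set G :=
  analytic_subgroup (generated_alg
    (\bigcup_(beta in Sp `&` span (I : set (vfield G -> R^o)))
       (root_space a beta `|` root_space a (- beta)))).

Definition normalizer (L : set G) (a : set (vfield G)) : set G :=
  [set g | L g /\ Ad g @` a = a].

Definition centralizer (L : set G) (a : set (vfield G)) : set G :=
  [set g | L g /\ forall X, a X -> Ad g X = X].

(* W contains exactly one element of each left coset g L contained in N. *)
Definition coset_representatives (N L W : set G) : Prop :=
  W `<=` N /\ forall g, N g -> exists! w, W w /\ L (w^-1 * g)%g.

(* A Riemannian metric on G, in the global frame of left-invariant fields:
   [rho x X Y] is the inner product at x of the values at x of the left-invariant
   fields X and Y. *)
Definition riemannian_metric (rho : G -> vfield G -> vfield G -> R) : Prop :=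
  [/\ forall x X Y, lie_algebra X -> lie_algebra Y -> rho x X Y = rho x Y X,
      forall x (r : R) X Y Z, lie_algebra X -> lie_algebra Y ->
        lie_algebra Z -> rho x (r *: X + Y) Z = r * rho x X Z + rho x Y Z,
      forall x X, lie_algebra X -> X != 0 -> 0 < rho x X X &
      forall X Y, lie_algebra X -> lie_algebra Y ->
        smooth_fun (fun x => rho x X Y)].

Definition curve_length (rho : G -> vfield G -> vfield G -> R) gam : R :=
  \int[lebesgue_measure]_(t in `[0, 1])
     (let v := xget 0 [set X | has_velocity gam t X] in
      Num.sqrt (rho (gam t) v v)).

(* [pw_smooth_length rho x y L]: some piecewise smooth curve from x to y,
   i.e. a finite concatenation of smooth curves over [0, 1], has length L. *)
Inductive pw_smooth_length (rho : G -> vfield G -> vfield G -> R) :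
    G -> G -> R -> Prop :=
| pw_nil x : pw_smooth_length rho x x 0
| pw_cons gam y L : smooth_curve gam -> pw_smooth_length rho (gam 1) y L ->
    pw_smooth_length rho (gam 0) y (curve_length rho gam + L).

Definition riemannian_dist (rho : G -> vfield G -> vfield G -> R) (x y : G) :
  R := inf [set L | pw_smooth_length rho x y L].

Definition ball_e (rho : G -> vfield G -> vfield G -> R) (eps : R) : set G :=
  [set x | riemannian_dist rho 1%g x < eps].

End LieAlgebra.

Arguments lie_algebra {R n} G.

Definition semisimple (R : realType) (n : nat) (G : lieGroupType R n) : Prop :=
  forall I : set (vfield G), lie_ideal I -> solvable_alg I -> I = [set 0].

(* Main.v *)
Require Import Defs.
From HB Require Import structures.
From mathcomp Require Import all_boot all_order all_algebra.
From mathcomp Require Import all_classical all_reals all_analysis.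
From mathcomp Require Import ring lra.
Set Implicit Arguments.
Unset Strict Implicit.
Unset Printing Implicit Defensive.
Import Order.TTheory GRing.Theory Num.Theory.
Import numFieldTopology.Exports numFieldNormedType.Exports.
Local Open Scope classical_set_scope.
Local Open Scope ring_scope.

(* Write y = k^-1 x k for x close to e. The Lie algebra is the sum of k, m_I, a_I
   and Ad (a w) h, and everything rests on a quantitative form of this: Z is
   Z1 + Z2 + Z3 + Z4, linearly in Z, with all Zi and Ad (a w)^-1 Z4 bounded by a
   multiple of |Z| that depends on c only. By linearity Z may be a joint
   eigenvector e of ad a, and these span because ad X is symmetric for
   - B(X, theta Y) when X is in p. If the root alpha is in the span of I, then e
   lies in m_I. If e has root - alpha with t = alpha (log a) >= c, put
   sigma' = Ad w sigma Ad w^-1 and tau = theta sigma'; modulo k, the vector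
   Ad a (Y + sigma' Y) = e^-t Y + e^t sigma' Y is e^-t Y - e^t tau Y, and this map
   is invertible on the eigenspaces of tau with factors e^-t -+ e^t that stay away
   from 0 because t >= c. Positive roots reduce to negative ones modulo k, and the
   centralizer of a splits by maximality of a.

   Since exp Z1 exp Z2 exp Z3 exp Z4 is strictly differentiable at 0 with
   derivative Z1 + Z2 + Z3 + Z4, a contraction argument that is uniform in the
   decomposition writes y as such a product, and g is rearranged by moving
   exp Z1 through k and exp Z4 through a w. The distance to e is comparable to the
   norm in a chart: compactly supported smooth functions are Lipschitz, and
   t |-> exp (t X) has bounded speed. *)

(** * Maps of class C^k *)

(** The obstacle is uniformity: the radius and the constants must not depend on k, a, w, h or I,
    although a ranges over a noncompact chamber on which Ad (a w) is unbounded. The bound on Ad (a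
    w)^-1 Z4, and not only on Z4, is asked for because this factor has to be carried to the right of
    a w and must still be small there. The map exp Z1 exp Z2 exp Z3 exp Z4 is the same for all data:
    a decomposition enters only as a linear right inverse of the sum, with bounded norm, so one
    strict differentiability estimate at 0 yields one radius. The elements k and w cost a constant
    factor only, since Ad of a fixed point of theta is an isometry of - B(X, theta Y), and this
    inner product is compared once and for all with the coordinate norm. Finally the hypothesis
    concerns simple roots outside I, whereas the estimate needs alpha (log a) >= c for every
    positive root outside the span of I; such a root is decomposed into positive roots, which are
    all nonnegative at log a. *)

Lemma open_near (T : topologicalType) (U : set T) (x : T) :
  open U -> U x -> \forall y \near x, U y.
Proof. by move=> oU Ux; apply: open_nbhs_nbhs. Qed.

Section Differentiability.
Context {R : realType} {V W : normedModType R}.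

Lemma differentiable_eps (f : V -> W) x (L : {linear V -> W}) :
  continuous L ->
  (forall e, 0 < e -> \forall y \near x,
     `|f y - f x - L (y - x)| <= e * `|y - x|) ->
  differentiable f x /\ 'd f x = L :> (V -> W).
Proof.
move=> Lc Lf.
have E : f \o shift x = cst (f x) + L +o_ 0 id.
  apply/eqaddoP => e e0; have := Lf e e0.
  rewrite (near_shift 0 x); apply: filterS => y /=.
  by rewrite subr0 /= !fctE /= opprD addrA addrK.
have D := diff_unique Lc E; split=> //.
by apply/diff_locallyP; rewrite D.
Qed.

Lemma differentiable_near (f : V -> W) x : differentiable f x ->
  forall e, 0 < e -> \forall y \near x,
     `|f y - f x - 'd f x (y - x)| <= e * `|y - x|.
Proof.
move=> /diff_locally/eqaddoP Lf e e0; rewrite (near_shift 0 x).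
have := Lf e e0; apply: filterS => y /=.
by rewrite subr0 /= !fctE /= opprD addrA addrK.
Qed.

Lemma near_eq_differentiable (f g : V -> W) x :
  (\near x, f x = g x) -> differentiable f x -> differentiable g x.
Proof.
move=> fg df.
have [|//] := @differentiable_eps g x ('d f x) (diff_continuous df) _.
move=> e e0; have := differentiable_near df e0.
by apply: filterS2 (fg) => y <-; rewrite (nbhs_singleton fg).
Qed.

Lemma derive_lin (f : V -> W) x v w (r : R) : differentiable f x ->
  'D_(r *: v + w) f x = r *: 'D_v f x + 'D_w f x.
Proof. by move=> df; rewrite !deriveE// linearP. Qed.

Lemma derive_dirZ (f : V -> W) x v (r : R) : differentiable f x ->
  'D_(r *: v) f x = r *: 'D_v f x.
Proof. by move=> df; rewrite !deriveE// linearZ. Qed.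

End Differentiability.

Lemma derive_dirM {R : realType} {V : normedModType R} (f : V -> R) x v (r : R) :
  differentiable f x -> 'D_(r *: v) f x = r * 'D_v f x.
Proof. exact: derive_dirZ. Qed.

Section CkBasic.
Context {R : realType} {V W : normedModType R}.
Implicit Types (f g : V -> W) (U : set V) (k : nat).

(** [Ck] imposes conditions at the points of [U] only, although a derivative at a point sees nearby
    values of f. Locality and invariance under local equality therefore reduce to singletons. *)
Lemma Ck_pt k f U : Ck k f U <-> forall x, U x -> Ck k f [set x].
Proof.
elim: k f => [|k IH] f /=.
  split=> [H x Ux y -> |H x Ux]; first exact: H.
  by apply: (H x Ux).
split=> [[H1 H2] x Ux|H].
  split=> [y ->|v]; first exact: H1.
  by apply: (proj1 (IH _)) => //.
split=> [x Ux|v]; first by apply: (proj1 (H x Ux)).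
by apply/IH => x Ux; apply: (proj2 (H x Ux)).
Qed.

Lemma Ck_sub k f U U' : U' `<=` U -> Ck k f U -> Ck k f U'.
Proof. by move=> UU /Ck_pt H; apply/Ck_pt => x /UU; apply: H. Qed.

Lemma CkW k f U : Ck k.+1 f U -> Ck k f U.
Proof.
elim: k f => [|k IH] f /=.
  by move=> [H _] x Ux; apply: differentiable_continuous; apply: H.
by move=> [H1 H2]; split=> // v; apply: IH; apply: H2.
Qed.

Lemma Ck_near k f g x : (\near x, f x = g x) -> Ck k f [set x] ->
  Ck k g [set x].
Proof.
elim: k f g => [|k IH] f g fg /=.
  move=> H y ->; have := H _ erefl.
  rewrite /prop_for /continuous_at (nbhs_singleton fg).
  by apply: cvg_trans; apply: near_eq_cvg.
move=> [H1 H2]; split=> [y ->|v].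
  by apply: near_eq_differentiable fg _; apply: H1.
apply: IH (H2 v); have := near_join fg.
by apply: filterS => y; apply: near_eq_derive.
Qed.

Lemma Ck_eq k f g U : open U -> (forall x, U x -> f x = g x) -> Ck k f U ->
  Ck k g U.
Proof.
move=> oU fg /Ck_pt H; apply/Ck_pt => x Ux; apply: Ck_near (H x Ux).
by have := open_nbhs_nbhs (Logic.conj oU Ux); apply: filterS => y /fg.
Qed.

Lemma Ck_loc k f U : (forall x, U x -> exists U', U' x /\ Ck k f U') ->
  Ck k f U.
Proof.
move=> H; apply/Ck_pt => x Ux; have [U' [U'x fU']] := H x Ux.
by apply: Ck_sub fU' => y ->.
Qed.

Lemma Ck_cst k (c : W) U : Ck k (fun=> c) U.
Proof.
elim: k c => [|k IH] c /=; first by move=> x _; apply: cst_continuous.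
split=> [x _|v]; first exact: differentiable_cst.
rewrite (_ : (fun x : V => 'D_v (fun=> c) x) = fun=> 0); first exact: IH.
by apply/funext => x; rewrite derive_cst.
Qed.

Lemma CkD k f g U : open U -> Ck k f U -> Ck k g U ->
  Ck k (fun x => f x + g x) U.
Proof.
move=> oU; elim: k f g => [|k IH] f g /=.
  by move=> H1 H2 x Ux; apply: continuousD; [apply: H1|apply: H2].
move=> [f1 f2] [g1 g2]; split=> [x Ux|v].
  by apply: differentiableD; [apply: f1|apply: g1].
apply: Ck_eq (IH _ _ (f2 v) (g2 v)) => // x Ux.
by rewrite [RHS]deriveD//; apply: diff_derivable; [apply: f1|apply: g1].
Qed.

Lemma Ck_sum k (I : Type) (s : seq I) (f : I -> V -> W) U : open U ->
  (forall i, Ck k (f i) U) -> Ck k (fun x => \sum_(i <- s) f i x) U.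
Proof.
move=> oU H; elim: s => [|i s IH].
  by apply: Ck_eq (Ck_cst k 0 U) => // x _; rewrite big_nil.
by apply: Ck_eq (CkD oU (H i) IH) => // x _; rewrite big_cons.
Qed.

Lemma Cinfty_differentiable f U x : Cinfty f U -> U x -> differentiable f x.
Proof. by move=> /(_ 1%N)[H _]; apply: H. Qed.

Lemma Cinfty_derive f U v : Cinfty f U -> Cinfty (fun x => 'D_v f x) U.
Proof. by move=> H k; have [_] := H k.+1; apply. Qed.

Lemma Cinfty_continuous f U x : Cinfty f U -> U x -> {for x, continuous f}.
Proof. by move=> /(_ 0%N) H Ux; apply: H. Qed.

End CkBasic.

Section CkLin.
Context {R : realType} {V W X : normedModType R}.

Lemma derive_post (L : {linear W -> X}) (f : V -> W) x v : continuous L ->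
  differentiable f x -> 'D_v (fun y => L (f y)) x = L ('D_v f x).
Proof.
move=> Lc df; have dL := @linear_differentiable _ _ _ L (f x) Lc.
rewrite deriveE; last exact: (differentiable_comp df).
by rewrite (diff_comp df dL) /= diff_lin// deriveE.
Qed.

Lemma Ck_post k (L : {linear W -> X}) (f : V -> W) U : open U -> continuous L ->
  Ck k f U -> Ck k (fun y => L (f y)) U.
Proof.
move=> oU Lc; elim: k f => [|k IH] f /=.
  by move=> H x Ux; apply: continuous_comp; [apply: H|apply: Lc].
move=> [f1 f2]; split=> [x Ux|v].
  by apply: differentiable_comp; [apply: f1|apply: linear_differentiable].
by apply: Ck_eq (IH _ (f2 v)) => // x Ux; rewrite derive_post//; apply: f1.
Qed.

Lemma Ck_lin k (L : {linear V -> W}) U : open U -> continuous L -> Ck k L U.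
Proof.
case: k => [|k] oU Lc; first by move=> x _; apply: Lc.
split=> [x _|v]; first exact: linear_differentiable.
apply: Ck_eq (Ck_cst k (L v) U) => // x _.
by rewrite deriveE ?diff_lin//; apply: linear_differentiable.
Qed.

End CkLin.

Section CkScalar.
Context {R : realType} {V : normedModType R}.

Lemma CkM k (f g : V -> R) U : open U -> Ck k f U -> Ck k g U ->
  Ck k (fun x => f x * g x) U.
Proof.
move=> oU; elim: k f g => [|k IH] f g.
  by move=> H1 H2 x Ux; apply: continuousM; [apply: H1|apply: H2].
move=> fk gk; split=> [x Ux|v].
  by apply: differentiableM; [apply: (proj1 fk)|apply: (proj1 gk)].
apply: Ck_eq (CkD oU (IH _ _ (CkW fk) (proj2 gk v))
  (IH _ _ (CkW gk) (proj2 fk v))) => // x Ux.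
by rewrite [RHS]deriveM//; apply: diff_derivable;
  [apply: (proj1 fk)|apply: (proj1 gk)].
Qed.

Lemma CkN k (W : normedModType R) (f : V -> W) U : open U -> Ck k f U ->
  Ck k (fun x => - f x) U.
Proof.
move=> oU; elim: k f => [|k IH] f /=.
  by move=> H x Ux; apply: continuousN; apply: H.
move=> [f1 f2]; split=> [x Ux|v].
  by apply: differentiableN; apply: f1.
apply: Ck_eq (IH _ (f2 v)) => // x Ux.
by rewrite [RHS]deriveN//; apply: diff_derivable; apply: f1.
Qed.

Lemma CkB k (W : normedModType R) (f g : V -> W) U : open U -> Ck k f U ->
  Ck k g U -> Ck k (fun x => f x - g x) U.
Proof. by move=> oU fk gk; apply: CkD => //; apply: CkN. Qed.

Lemma Ck_scalel k (W : normedModType R) (f : V -> R) (w : W) U : open U ->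
  Ck k f U -> Ck k (fun x => f x *: w) U.
Proof.
move=> oU; elim: k f => [|k IH] f /=.
  by move=> H x Ux; apply: continuousZl; apply: H.
move=> [f1 f2]; split=> [x Ux|v].
  by apply: differentiableZl; apply: f1.
apply: Ck_eq (IH _ (f2 v)) => // x Ux.
rewrite [RHS]deriveE; last by apply: differentiableZl; apply: f1.
by rewrite diffZl ?deriveE//; apply: f1.
Qed.

End CkScalar.

(** * Finite-dimensional frames and the chain rule for C^k maps *)

Section FiniteDim.
Context {R : realType}.

(** A resolution of the identity by finitely many continuous coordinate forms. It turns a derivative
    in a direction that depends on the point, as in the chain rule, into a finite sum of derivatives
    in fixed directions, to which the recursive definition of [Ck] applies. *)
Definition is_frame (M : normedModType R) m (e : 'I_m -> M)
    (l : 'I_m -> {linear M -> R^o}) :=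
  (forall i, continuous (l i)) /\ forall x, x = \sum_i l i x *: e i.

Definition findim (M : normedModType R) := exists m e l, @is_frame M m e l.

Lemma derive_frame (M W : normedModType R) m (e : 'I_m -> M) l
  (f : M -> W) x v : @is_frame M m e l -> differentiable f x ->
  'D_v f x = \sum_i l i v *: 'D_(e i) f x.
Proof.
move=> [_ le] df; rewrite deriveE// [in LHS](le v) linear_sum.
by apply: eq_bigr => i _; rewrite linearZ deriveE.
Qed.

Lemma derive_comp (V M W : normedModType R) (f : M -> W) (g : V -> M) x v :
  differentiable g x -> differentiable f (g x) ->
  'D_v (fun y => f (g y)) x = 'D_('D_v g x) f (g x).
Proof.
move=> dg df; rewrite deriveE; last exact: (differentiable_comp dg df).
by rewrite (diff_comp dg df) /= !deriveE.
Qed.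

Lemma Ck_frame (V W : normedModType R) m (e : 'I_m -> W) l k (f : V -> W) U :
  @is_frame W m e l -> open U ->
  (forall i, Ck k (fun x => l i (f x) : R) U) -> Ck k f U.
Proof.
move=> [lc le] oU H.
by apply: Ck_eq (Ck_sum (index_enum _) oU (fun i => Ck_scalel (e i) oU (H i))) => //.
Qed.

Lemma Ck_comp1 (V M : normedModType R) k (f : M -> R) (g : V -> M) U U' :
  findim M -> open U -> open U' -> (forall x, U x -> U' (g x)) ->
  Ck k f U' -> Ck k g U -> Ck k (fun x => f (g x)) U.
Proof.
move=> [m [e [l [lc le]]]] oU oU' UU'; elim: k f g UU' => [|k IH] f g UU'.
  move=> H1 H2 x Ux.
  by apply: continuous_comp; [apply: H2|apply: H1; apply: UU'].
move=> fk gk; split=> [x Ux|v].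
  apply: differentiable_comp; [apply: (proj1 gk)=> //|apply: (proj1 fk); exact: UU'].
(* The terms of the chain rule in the frame are products of scalar functions; this is why the target
   is [R] here, and [Ck_comp] recovers a general target coordinate by coordinate. *)
have H i : Ck k (fun x => l i ('D_v g x) * 'D_(e i) f (g x)) U.
  apply: CkM => //; last exact: IH UU' (proj2 fk _) (CkW gk).
  by apply: Ck_post => //; apply: (proj2 gk).
apply: Ck_eq (Ck_sum (index_enum _) oU H) => // x Ux.
have dg : differentiable g x by apply: (proj1 gk).
have df : differentiable f (g x) by apply: (proj1 fk); exact: UU'.
by rewrite (derive_comp v dg df) (derive_frame _ (Logic.conj lc le) df).
Qed.

Lemma Ck_comp (V M W : normedModType R) k (f : M -> W) (g : V -> M) U U' :
  findim M -> findim W -> open U -> open U' -> (forall x, U x -> U' (g x)) ->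
  Ck k f U' -> Ck k g U -> Ck k (fun x => f (g x)) U.
Proof.
move=> fM [m [e [l le]]] oU oU' UU' fk gk.
apply: (Ck_frame le) => // i.
apply: (@Ck_comp1 V M k (fun y => l i (f y)) g U U') => //.
by apply: Ck_post => //; case: le.
Qed.

Lemma rV_frame n : exists l : 'I_n -> {linear 'rV[R]_n -> R^o},
  is_frame (fun j => delta_mx 0 j) l /\ forall j x, l j x = x 0 j.
Proof.
have add (j : 'I_n) : linear (fun x : 'rV[R]_n => x 0 j : R^o).
  by move=> r x y; rewrite !mxE.
pose l j := HB.pack_for {linear 'rV[R]_n -> R^o} (fun x : 'rV[R]_n => x 0 j : R^o)
  (GRing.isLinear.Build _ _ _ _ _ (add j)).
exists l; split=> //; split=> [i|x]; first exact: coord_continuous.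
by rewrite {1}(row_sum_delta x).
Qed.

Lemma findim_rV n : findim 'rV[R]_n.
Proof. by have [l [le _]] := rV_frame n; exists n, (fun j => delta_mx 0 j), l. Qed.

Lemma Ck_coord k n (j : 'I_n) (U : set 'rV[R]_n) : open U ->
  Ck k (fun x : 'rV[R]_n => x 0 j : R) U.
Proof.
move=> oU.
have add : linear (fun x : 'rV[R]_n => x 0 j : R^o).
  by move=> r x y; rewrite !mxE.
pose l := HB.pack_for {linear 'rV[R]_n -> R^o} (fun x : 'rV[R]_n => x 0 j : R^o)
  (GRing.isLinear.Build _ _ _ _ _ add).
by apply: (@Ck_lin R _ _ k l) => //; exact: coord_continuous.
Qed.

Lemma findim_R : findim R^o.
Proof.
exists 1%N, (fun _ => (1 : R^o)), (fun _ => idfun); split=> [i|x].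
  by move=> x; apply: cvg_id.
by rewrite big_ord_recl big_ord0 addr0 /= -[RHS]/(x * 1) mulr1.
Qed.

Lemma findim_prod (M N : normedModType R) : findim M -> findim N ->
  findim (M * N)%type.
Proof.
move=> [m [e [l [lc le]]]] [m' [e' [l' [lc' le']]]].
have add1 i : linear (fun x : M * N => l i x.1).
  by move=> r x y /=; rewrite linearP.
have add2 i : linear (fun x : M * N => l' i x.2).
  by move=> r x y /=; rewrite linearP.
pose L1 i := HB.pack_for {linear (M * N)%type -> R^o} (fun x : M * N => l i x.1)
  (GRing.isLinear.Build _ _ _ _ _ (add1 i)).
pose L2 i := HB.pack_for {linear (M * N)%type -> R^o} (fun x : M * N => l' i x.2)
  (GRing.isLinear.Build _ _ _ _ _ (add2 i)).
exists (m + m')%N, (fun i => match fintype.split i with inl j => (e j, 0)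
   | inr j => (0, e' j) end),
  (fun i => match fintype.split i with inl j => L1 j | inr j => L2 j end).
split=> [i|[x y]].
  case: (fintype.split i) => j /= z.
    by apply: continuous_comp; [apply: cvg_fst|apply: lc].
  by apply: continuous_comp; [apply: cvg_snd|apply: lc'].
rewrite big_split_ord /=.
under eq_bigr => i _ do rewrite (unsplitK (inl _ i)) /=.
under [X in _ + X]eq_bigr => i _ do rewrite (unsplitK (inr _ i)) /=.
have E1 : \sum_i l i x *: (e i, 0 : N) = (x, 0).
  rewrite [x in RHS]le; elim/big_ind2 : _ => //.
    by move=> a b c d -> ->; congr pair; rewrite /= addr0.
  by move=> i _; congr pair; rewrite /= scaler0.
have E2 : \sum_i l' i y *: (0 : M, e' i) = (0, y).
  rewrite [y in RHS]le'; elim/big_ind2 : _ => //.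
    by move=> a b c d -> ->; congr pair; rewrite /= addr0.
  by move=> i _; congr pair; rewrite /= scaler0.
by rewrite E1 E2; congr pair; rewrite /= ?addr0 ?add0r.
Qed.

End FiniteDim.

(** * Mean value theorem, strict differentiability, symmetry of second derivatives *)

Section MeanValue.
Context {R : realType}.

Lemma rV_norm_le n (x : 'rV[R]_n) (M : R) : 0 <= M ->
  (forall j, `|x 0 j| <= M) -> `|x| <= M.
Proof.
move=> M0 H; have -> : `|x| = mx_norm x by []; rewrite mx_normrE; apply: bigmax_le => // -[i j] _ /=.
by rewrite ord1.
Qed.

Lemma rV_coord_le n (x : 'rV[R]_n) j : `|x 0 j| <= `|x|.
Proof. by have -> : `|x| = mx_norm x by []; rewrite mx_normrE; apply: (le_bigmax _ _ (0, j)). Qed.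

Lemma segment_is_derive (V : normedModType R) (f : V -> R) (x v : V) (t : R) :
  differentiable f (x + t *: v) ->
  is_derive t 1 (fun s : R => f (x + s *: v)) ('D_v f (x + t *: v)).
Proof.
move=> df.
have dg : differentiable (fun s : R^o => x + s *: v) (t : R^o).
  by apply: differentiableD => //; apply: differentiableZl.
have := derive_comp (1 : R^o) dg df.
set D := 'D_(1 : R^o) (fun s : R^o => x + _) _; have -> : D = v.
  have E : is_diff (t : R^o) (cst x + (fun s : R^o => s *: v)) (0 + *:%R^~ v).
    by apply: is_diffD; exact: is_diff_scalel.
  by rewrite /D deriveE// (@diff_val _ _ _ _ _ _ _ E) fctE /= add0r scale1r.
move=> <-; apply: derivableP; apply: diff_derivable.
exact: differentiable_comp dg df.
Qed.

Lemma mvt_segment (V : normedModType R) (f : V -> R) (x v : V) :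
  (forall t : R, 0 <= t <= 1 -> differentiable f (x + t *: v)) ->
  exists2 t : R, 0 < t < 1 & f (x + v) - f x = 'D_v f (x + t *: v).
Proof.
move=> df.
have [||t t01 E] := @MVT R (fun s => f (x + s *: v))
    (fun t => 'D_v f (x + t *: v)) 0 1 ltr01.
- move=> t /[!in_itv]/= /andP[t0 t1]; apply: segment_is_derive.
  by apply: df; rewrite !ltW.
- apply: derivable_within_continuous => t /[!in_itv]/= t01.
  have [//] := segment_is_derive (df t t01).
exists t; first by rewrite in_itv in t01.
by move: E; rewrite scale1r scale0r addr0 subr0 mulr1.
Qed.

Lemma ball_segment (V : normedModType R) (c x y : V) (d t : R) :
  ball c d x -> ball c d y -> 0 <= t <= 1 -> ball c d (x + t *: (y - x)).
Proof.
rewrite -!ball_normE /= => cx cy /andP[t0 t1].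
have -> : c - (x + t *: (y - x)) = (1 - t) *: (c - x) + t *: (c - y).
  rewrite scalerBl scale1r -addrA [_ + t *: (c - y)]addrC -scalerBr.
  have -> : c - y - (c - x) = - (y - x).
    by rewrite opprB addrC addrA subrK opprB.
  by rewrite scalerN opprD addrA.
apply: le_lt_trans (ler_normD _ _) _; rewrite !normrZ.
rewrite [`|1 - t|]ger0_norm ?subr_ge0// [`|t|]ger0_norm//.
have [->|tn] := eqVneq t 0; first by rewrite subr0 mul1r mul0r addr0.
rewrite (_ : d = (1 - t) * d + t * d); last by ring.
apply: ler_ltD; first by rewrite ler_wpM2l ?subr_ge0// ltW.
by rewrite ltr_pM2l// lt_neqAle eq_sym tn.
Qed.

(** The norm on row vectors is the maximum of the coordinates, so the scalar mean value theorem
    suffices, with an intermediate point for each coordinate. Subtracting w allows the comparison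
    with a linear approximation. *)
Lemma mvt_bound n (V : normedModType R) (f : V -> 'rV[R]_n) (x y c : V)
    (w : 'rV[R]_n) (d M : R) :
  ball c d x -> ball c d y -> 0 <= M ->
  (forall z, ball c d z -> differentiable f z /\ `|'D_(y - x) f z - w| <= M) ->
  `|f y - f x - w| <= M.
Proof.
move=> cx cy M0 H; apply: rV_norm_le => // j; rewrite !mxE.
have Hd z : ball c d z -> differentiable (fun z => f z 0 j) z.
  move=> cz; apply: (@differentiable_comp _ _ _ _ f (fun u : 'rV[R]_n => u 0 j)).
    by case: (H z cz).
  exact: differentiable_coord.
have [t t01|t /andP[/ltW t0 /ltW t1] E] :=
    @mvt_segment V (fun z => f z 0 j) x (y - x).
  by apply: Hd; apply: ball_segment.
have cz : ball c d (x + t *: (y - x)) by apply: ball_segment => //; rewrite t0.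
move: E; rewrite [x + (y - x)]addrC subrK => ->.
have [df] := H _ cz; apply: le_trans.
rewrite derive_mx; last exact: diff_derivable.
by set A := (X in _ <= `|X|); have := rV_coord_le A j; rewrite !mxE.
Qed.

(** Only the continuity of derivatives in fixed directions is given; the frame makes it uniform over
    all directions. *)
Lemma derive_unif (V W : normedModType R) (f : V -> W) (x : V) (U : set V) :
  findim V -> open U -> U x -> Ck 1 f U ->
  forall eta : R, 0 < eta ->
    \forall y \near x, forall v, `|'D_v f y - 'D_v f x| <= eta * `|v|.
Proof.
move=> [m [e [l [lc le]]]] oU Ux [f1 f2] eta eta0.
have [C [C0 HC]] : exists C : R, 0 < C /\ forall i v, `|l i v| <= C * `|v|.
  have H i : exists C : R, 0 < C /\ forall v, `|l i v| <= C * `|v|.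
    by have [k k0 Hk] := linear_lipschitz (lc i); exists k.
  have [c Hc] := choice H; exists (1 + \sum_i c i); split.
    by apply: ltr_pwDl => //; apply: sumr_ge0 => i _; apply/ltW; case: (Hc i).
  move=> i v; apply: le_trans (proj2 (Hc i) v) _.
  apply: ler_wpM2r => //; rewrite (bigD1 i)//= addrCA lerDl.
  by apply: addr_ge0 => //; apply: sumr_ge0 => j _; apply/ltW; case: (Hc j).
(* Each of the m frame directions contributes at most [eps] times C |v|; dividing by m+1 rather than
   m covers m = 0. *)
pose eps := eta / (C * m.+1%:R).
have eps0 : 0 < eps by rewrite divr_gt0// mulr_gt0.
have H : \forall y \near x, forall i : 'I_m, `|'D_(e i) f y - 'D_(e i) f x| <= eps.
  apply: filter_forall => i; have := f2 (e i) x Ux => /cvgrPdist_le /(_ _ eps0).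
  by apply: filterS => y; rewrite distrC.
have HU : \forall y \near x, U y by have := open_nbhs_nbhs (Logic.conj oU Ux).
apply: filterS2 H HU => y Hy Uy v.
rewrite !(derive_frame _ (Logic.conj lc le))//; [|exact: f1|exact: f1].
rewrite -sumrB; apply: le_trans (ler_norm_sum _ _ _) _.
apply: (@le_trans _ _ (\sum_(i < m) C * `|v| * eps)).
  apply: ler_sum => i _; rewrite -scalerBr normrZ.
  by apply: ler_pM => //; apply: HC.
rewrite sumr_const card_ord -mulr_natr /eps.
rewrite (_ : _ * _ = eta * `|v| * (m%:R / m.+1%:R)); last first.
  by field; rewrite gt_eqF// gt_eqF.
apply: ler_piMr; first by rewrite mulr_ge0// ltW.
by rewrite ler_pdivrMr// mul1r ler_nat.
Qed.

Lemma strict_diff n (V : normedModType R) (f : V -> 'rV[R]_n) (x : V)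
    (U : set V) : findim V -> open U -> U x -> Ck 1 f U ->
  forall eta : R, 0 < eta -> exists2 d : R, 0 < d & forall y z,
    ball x d y -> ball x d z ->
    `|f y - f z - 'D_(y - z) f x| <= eta * `|y - z|.
Proof.
move=> fV oU Ux f1 eta eta0.
have := derive_unif fV oU Ux f1 eta0.
have := open_nbhs_nbhs (Logic.conj oU Ux) => /filterI H /H.
move=> /nbhs_ballP[d d0 Hd]; exists d => // y z yd zd.
apply: (mvt_bound zd yd); first by rewrite mulr_ge0// ltW.
move=> u ud; have [Uu Hu] := Hd u ud; split; last exact: Hu.
by apply: (proj1 f1).
Qed.

(** Two applications of the mean value theorem: along v to [g y = f (y + h *: w) - f y], then along
    w to the derivative of f along v. *)
Lemma second_difference (V : normedModType R) (f : V -> R) (x v w : V) (d h : R) :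
  Ck 2 f (ball x d) -> 0 < h -> h * (`|v| + `|w|) < d ->
  exists2 p, ball x d p &
    f (x + h *: v + h *: w) - f (x + h *: v) - f (x + h *: w) + f x =
    h * (h * 'D_w (fun y => 'D_v f y) p).
Proof.
move=> [f1 f2] h0 hd.
have inb s t : 0 <= s <= 1 -> 0 <= t <= 1 -> ball x d (x + s *: (h *: v) + t *: (h *: w)).
  move=> /andP[s0 s1] /andP[t0 t1]; rewrite -ball_normE /=.
  rewrite opprD opprD !addrA subrr sub0r -opprD normrN.
  apply: le_lt_trans hd; apply: le_trans (ler_normD _ _) _.
  rewrite !scalerA !normrZ mulrDr; apply: lerD; apply: ler_wpM2r => //.
    by rewrite !ger0_norm ?(ltW h0)//; apply: ler_piMl => //; apply: ltW.
  by rewrite !ger0_norm ?(ltW h0)//; apply: ler_piMl => //; apply: ltW.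
have i01 : 0 <= (0 : R) <= 1 by rewrite lexx ler01.
have i11 : 0 <= (1 : R) <= 1 by rewrite lexx ler01.
have inb0 s : 0 <= s <= 1 -> ball x d (x + s *: (h *: v)).
  by move=> s01; have := inb s 0 s01 i01; rewrite scale0r addr0.
pose g y := f (y + h *: w) - f y.
have shift y : differentiable f (y + h *: w) -> differentiable (fun y => f (y + h *: w)) y.
  move=> dfy; apply: (@differentiable_comp _ _ _ _ (fun y => y + h *: w)) => //.
have [t t01|s /andP[/ltW s0 /ltW s1]] := @mvt_segment V g x (h *: v).
  apply: differentiableB; last by apply: f1; apply: inb0.
  by apply: shift; apply: f1; have := inb t 1 t01 i11; rewrite scale1r.
set z := x + s *: _; move=> E1.
have s01 : 0 <= s <= 1 by rewrite s0.
have zd1 : ball x d z by apply: inb0.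
have zd2 : ball x d (z + h *: w) by have := inb s 1 s01 i11; rewrite scale1r.
have [t t01|t /andP[/ltW t0 /ltW t1]] :=
    @mvt_segment V (fun y => 'D_v f y) z (h *: w).
  by apply: (proj1 (f2 v)); apply: inb.
set p := z + t *: _; move=> E2.
have pd : ball x d p by apply: inb => //; rewrite t0.
exists p => //.
have -> : f (x + h *: v + h *: w) - f (x + h *: v) - f (x + h *: w) + f x =
    g (x + h *: v) - g x by rewrite /g; ring.
rewrite E1 /g deriveB; last 2 first.
- by apply: diff_derivable; apply: shift; apply: f1.
- by apply: diff_derivable; apply: f1.
have dsh : differentiable (fun y => y + h *: w) z by apply: differentiableD.
have dfz : differentiable f (z + h *: w) by exact: f1.
rewrite (@derive_comp _ _ _ _ f (fun y => y + h *: w) z (h *: v) dsh dfz).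
rewrite deriveD ?derive_id ?derive_cst ?addr0//.
rewrite !derive_dirM; [|exact: f1|exact: f1].
by rewrite -mulrBr E2 derive_dirM//; exact: (proj1 (f2 v)).
Qed.

Let near_values_neq (A B p q : R) :
  A != B -> `|A - p| < `|A - B| / 2 -> `|B - q| < `|A - B| / 2 -> p <> q.
Proof.
move=> AB Ap Bq pq; have : `|A - B| < `|A - B| / 2 + `|A - B| / 2.
  rewrite {1}(_ : A - B = (A - p) - (B - q)); last by rewrite pq; ring.
  by apply: le_lt_trans (ler_normB _ _) _; apply: ltrD.
by rewrite -splitr ltxx.
Qed.

Let second_difference_comm (h a b c d e D1 D2 : R) : h != 0 -> a = b ->
  a - c - d + e = h * (h * D1) -> b - d - c + e = h * (h * D2) -> D1 = D2.
Proof.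
move=> h0 ab E1 E2; apply: (mulfI h0); apply: (mulfI h0).
by rewrite -E1 -E2 ab; ring.
Qed.

(** The second difference of f is symmetric in v and w, so the two mixed derivatives take a common
    value, at points p and q arbitrarily close to x; if they differed at x, continuity would
    separate these values. *)
Lemma schwarz (V : normedModType R) (f : V -> R) (x v w : V) (U : set V) :
  open U -> U x -> Ck 2 f U ->
  'D_w (fun y => 'D_v f y) x = 'D_v (fun y => 'D_w f y) x.
Proof.
move=> oU Ux fU.
pose F : V -> R := 'D_w (fun y => 'D_v f y).
pose G : V -> R := 'D_v (fun y => 'D_w f y).
have Fc : {for x, continuous F} by apply: (proj2 (proj2 fU v)).
have Gc : {for x, continuous G} by apply: (proj2 (proj2 fU w)).
have FE y : 'D_w (fun y => 'D_v f y) y = F y by [].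
have GE y : 'D_v (fun y => 'D_w f y) y = G y by [].
rewrite FE GE; clearbody F G.
have [//|H] := eqVneq (F x) (G x).
pose e := `|F x - G x| / 2.
have e0 : 0 < e by rewrite divr_gt0// normr_gt0 subr_eq0.
have c1 : \forall y \near x, `|F x - F y| < e by move/cvgrPdist_lt : Fc; apply.
have c2 : \forall y \near x, `|G x - G y| < e by move/cvgrPdist_lt : Gc; apply.
have : \forall y \near x, [/\ U y, `|F x - F y| < e & `|G x - G y| < e].
  by apply: filterS3 (open_near oU Ux) c1 c2 => y.
move=> /nbhs_ballP[d /= d0 Hd].
have fb : Ck 2 f (ball x d) by apply: Ck_sub fU => y /Hd[].
(* The added 1 keeps the denominator positive when v and w both vanish. *)
pose h := d / (`|v| + `|w| + 1).
have p0 : 0 < `|v| + `|w| + 1 by apply: ltr_wpDl.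
have h0 : 0 < h by rewrite divr_gt0.
have hd : h * (`|v| + `|w|) < d.
  by rewrite /h mulrAC ltr_pdivrMr// ltr_pM2l// ltrDl.
have [p pd] := second_difference fb h0 hd; rewrite FE => Ep.
have hd' : h * (`|w| + `|v|) < d by rewrite [`|w| + _]addrC.
have [q qd] := second_difference fb h0 hd'; rewrite GE => Eq.
have ab : f (x + h *: v + h *: w) = f (x + h *: w + h *: v) by rewrite addrAC.
have E := second_difference_comm (lt0r_neq0 h0) ab Ep Eq.
have [_ Hp _] := Hd p pd; have [_ _ Hq] := Hd q qd.
by have := near_values_neq H Hp Hq.
Qed.

End MeanValue.

(** * Hadamard's lemma *)

Section UnitIntegral.
Context {R : realType}.
Implicit Types (h g : R -> R).

Definition cont01 h := forall t : R, 0 <= t <= 1 -> {for t, continuous h}.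

Definition int01 h : R := (\int[lebesgue_measure]_(t in `[0, 1]) h t)%R.

Let mu := @lebesgue_measure R.

Lemma integrable_itv h (a b : R) :
  (forall t : R, a <= t <= b -> {for t, continuous h}) ->
  mu.-integrable `[a, b] (EFin \o h).
Proof.
move=> ch; apply: continuous_compact_integrable; first exact: segment_compact.
apply: continuous_in_subspaceT => t /set_mem /=; rewrite in_itv /=.
exact: ch.
Qed.

Lemma int01B h g : cont01 h -> cont01 g ->
  int01 (fun t => h t - g t) = int01 h - int01 g.
Proof. by move=> ch cg; apply: RintegralB => //; apply: integrable_itv. Qed.

Lemma int01Z h (r : R) : cont01 h -> int01 (fun t => r * h t) = r * int01 h.
Proof. by move=> ch; apply: RintegralZl => //; apply: integrable_itv. Qed.

Lemma eq_int01 h g : (forall t : R, 0 <= t <= 1 -> h t = g t) -> int01 h = int01 g.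
Proof.
by move=> hg; apply: eq_Rintegral => t /set_mem /=; rewrite in_itv; apply: hg.
Qed.

Lemma int01_cst (c : R) : int01 (fun=> c) = c.
Proof.
rewrite /int01 Rintegral_cst//= lebesgue_measure_itv/= lte_fin ltr01.
by rewrite oppr0 adde0 mulr1.
Qed.

Lemma int01_bound h (M : R) : cont01 h -> (forall t : R, 0 <= t <= 1 -> `|h t| <= M) ->
  `|int01 h| <= M.
Proof.
move=> ch hM; apply: le_trans (le_normr_Rintegral _ (integrable_itv ch)) _ => //.
rewrite -[leRHS]int01_cst; apply: le_Rintegral => //.
- apply: (@integrable_itv (fun t => `|h t|)) => t /ch ht.
  by apply: continuous_comp => //; apply: norm_continuous.
- by apply: (@integrable_itv (fun=> M)) => t _; apply: cst_continuous.
Qed.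

Lemma cont01B h g : cont01 h -> cont01 g -> cont01 (fun t => h t - g t).
Proof. by move=> ch cg t t01; apply: continuousB; [apply: ch|apply: cg]. Qed.

Lemma cont01M h g : cont01 h -> cont01 g -> cont01 (fun t => h t * g t).
Proof. by move=> ch cg t t01; apply: continuousM; [apply: ch|apply: cg]. Qed.

Lemma cont01_cst (c : R) : cont01 (fun=> c).
Proof. by move=> t _; apply: cst_continuous. Qed.

Lemma cont01X m : cont01 (fun t => t ^+ m).
Proof. by move=> t _; apply: exprn_continuous. Qed.

Lemma cont01_sum (I : Type) (s : seq I) (h : I -> R -> R) :
  (forall i, cont01 (h i)) -> cont01 (fun t => \sum_(i <- s) h i t).
Proof.
move=> ch t t01; elim: s => [|i s IH].
  rewrite (_ : (fun t => _) = cst 0); first exact: cst_continuous.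
  by apply/funext => u; rewrite big_nil.
rewrite (_ : (fun t => _) = (fun t => h i t + \sum_(i <- s) h i t)).
  by apply: continuousD => //; apply: ch.
by apply/funext => u; rewrite big_cons.
Qed.

Lemma int01_sum (I : Type) (s : seq I) (h : I -> R -> R) :
  (forall i, cont01 (h i)) ->
  int01 (fun t => \sum_(i <- s) h i t) = \sum_(i <- s) int01 (h i).
Proof.
move=> ch; elim: s => [|i s IH].
  rewrite big_nil -[RHS]int01_cst; apply: eq_int01 => t _.
  by rewrite big_nil.
rewrite big_cons -IH.
have -> : int01 (fun t => \sum_(j <- i :: s) h j t) =
    int01 (fun t => h i t - (- 1) * \sum_(j <- s) h j t).
  by apply: eq_int01 => t _; rewrite big_cons; ring.
have cs : cont01 (fun t => \sum_(j <- s) h j t) by apply: cont01_sum.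
rewrite int01B//; last by apply: cont01M => //; apply: cont01_cst.
by rewrite int01Z//; ring.
Qed.

Lemma int01_derive (F f : R -> R) : (forall t : R, 0 <= t <= 1 -> is_derive t 1 F (f t)) ->
  cont01 f -> int01 f = F 1 - F 0.
Proof.
move=> dF cf; rewrite /int01 /Rintegral (@continuous_FTC2 _ f F)//.
- apply: continuous_in_subspaceT => t /set_mem /=; rewrite in_itv /=.
  exact: cf.
- have cF t : 0 <= t <= 1 -> {for t, continuous F}.
    move=> /dF[df _]; apply: differentiable_continuous.
    exact/derivable1_diffP.
  have [c0 c1] : {for 0, continuous F} /\ {for 1, continuous F}.
    by split; apply: cF; rewrite lexx ler01.
  split=> [t|//|//].
  + by rewrite in_itv => /= /andP[t0 t1]; have [] := dF t; rewrite ?ltW.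
  + exact: cvg_at_right_filter.
  + exact: cvg_at_left_filter.
- move=> t; rewrite in_itv => /= /andP[t0 t1]; rewrite derive1E.
  have t01 : 0 <= t <= 1 by rewrite !ltW.
  by have [_ ->] := dF t t01.
Qed.

End UnitIntegral.

Section Hadamard.
Context {R : realType}.
Context (V : normedModType R) (c : V) (d : R).
Context (fV : findim V).
Implicit Types (F : V -> R).

Let seg (u : V) (t : R) := c + t *: (u - c).

Let seg_ball u t : ball c d u -> 0 <= t <= 1 -> ball c d (seg u t).
Proof.
move=> cu t01; have d0 : 0 < d by move: cu; rewrite -ball_normE => /(le_lt_trans _); apply.
by apply: ball_segment => //; apply: ballxx.
Qed.

Let seg_continuous u (t : R) : {for t, continuous (seg u)}.
Proof.
by apply: continuousD; [exact: cst_continuous|apply: continuousZl; exact: cvg_id].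
Qed.

Lemma cont_ray F u : Ck 0 F (ball c d) -> ball c d u ->
  cont01 (fun t => F (c + t *: (u - c))).
Proof.
move=> cF cu t t01; apply: (@continuous_comp _ _ _ (seg u)).
  exact: seg_continuous.
by apply: cF; apply: seg_ball.
Qed.

Let cont_seg F m u : Ck 0 F (ball c d) -> ball c d u ->
  cont01 (fun t => t ^+ m * F (seg u t)).
Proof. by move=> cF cu; apply: cont01M; [exact: cont01X|exact: cont_ray]. Qed.

(** The weight t^m is carried along because differentiating under the integral sign produces a
    factor t: the derivative along v of the m-th integral of F is the (m+1)-st integral of the
    derivative of F. The family is thus closed under differentiation. *)
Definition ray_integral m F (u : V) := int01 (fun t => t ^+ m * F (seg u t)).

Let unif_ray F u : Ck 1 F (ball c d) -> ball c d u -> forall eta : R, 0 < eta ->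
  exists2 r : R, 0 < r & forall w t, ball 0 r w -> 0 <= t <= 1 ->
    forall v, `|'D_v F (seg u t + w) - 'D_v F (seg u t)| <= eta * `|v|.
Proof.
move=> F1 cu eta eta0.
pose P w t := forall v, `|'D_v F (seg u t + w) - 'D_v F (seg u t)| <= eta * `|v|.
suff : \forall w \near (0 : V), `[0, 1] `<=` P w.
  move=> /nbhs_ballP[r /= r0 Hr]; exists r => // w t wr t01.
  by apply: (Hr w) => //=; rewrite in_itv.
(* Continuity of the derivative at each point of the segment becomes uniform in t by compactness of
   [0, 1]. *)
apply: (proj1 (compact_near_coveringP _) (@segment_compact R 0 1)).
move=> t; rewrite /= in_itv /= => t01.
have e20 : 0 < eta / 2 by rewrite divr_gt0.
have := derive_unif fV (ball_open c d) (seg_ball cu t01) F1 e20.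
set Q := (fun y => forall v, _ <= _) => H.
have c1 : \forall p \near (t, 0 : V), Q (seg u p.1 + p.2).
  have : (fun p : R * V => seg u p.1 + p.2) p @[p --> (t, 0 : V)] --> seg u t + 0.
    apply: cvgD; last exact: cvg_snd.
    by apply: cvg_comp; [exact: cvg_fst|exact: seg_continuous].
  by rewrite addr0 => /(_ Q H).
have c2 : \forall p \near (t, 0 : V), Q (seg u p.1).
  have : (fun p : R * V => seg u p.1) p @[p --> (t, 0 : V)] --> seg u t.
    by apply: cvg_comp; [exact: cvg_fst|exact: seg_continuous].
  exact.
apply: filterS2 c1 c2 => -[s w] /= H1 H2 v.
rewrite (splitr eta) mulrDl.
rewrite (_ : _ - _ = ('D_v F (seg u s + w) - 'D_v F (seg u t)) -
   ('D_v F (seg u s) - 'D_v F (seg u t))); last by ring.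
by apply: le_trans (ler_normB _ _) _; apply: lerD.
Qed.

Let ray_derive F m u : Ck 1 F (ball c d) -> ball c d u ->
  differentiable (ray_integral m F) u /\
  forall v, 'D_v (ray_integral m F) u = ray_integral m.+1 (fun y => 'D_v F y) u.
Proof.
move=> F1 cu.
have [n [e [l le]]] := fV; have [lc lE] := le.
pose a i := ray_integral m.+1 (fun y => 'D_(e i) F y) u.
have add : linear (fun v : V => \sum_i l i v * a i : R^o).
  move=> r x y; rewrite scaler_sumr -big_split; apply: eq_bigr => i _ /=.
  by rewrite linearP /= mulrDl scalerAl.
pose L := HB.pack_for {linear V -> R^o} (fun v : V => \sum_i l i v * a i : R^o)
  (GRing.isLinear.Build _ _ _ _ _ add).
have Lc : continuous L.
  move=> x; have H i : Ck 0 (fun v : V => l i v * a i : R^o) setT.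
    by move=> y _; apply: continuousM; [exact: lc|exact: cst_continuous].
  by have := Ck_sum (index_enum _) openT H; apply.
have FS k v : cont01 (fun t => t ^+ k * 'D_v F (seg u t)).
  have D0 : Ck 0 (fun y => 'D_v F y) (ball c d) by exact: (proj2 F1 v).
  exact: cont_seg D0 cu.
have LE v : L v = ray_integral m.+1 (fun y => 'D_v F y) u.
  rewrite /= /a /ray_integral.
  transitivity (\sum_i int01 (fun t => l i v * (t ^+ m.+1 * 'D_(e i) F (seg u t)))).
    by apply: eq_bigr => i _; rewrite int01Z.
  rewrite -int01_sum; last by move=> i; apply: cont01M => //; exact: cont01_cst.
  apply: eq_int01 => t t01; rewrite (derive_frame _ le); last first.
    by apply: (proj1 F1); apply: seg_ball.
  by rewrite mulr_sumr; apply: eq_bigr => i _; rewrite mulrCA.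
have [|D1 D2] := @differentiable_eps R V R^o (ray_integral m F) u L Lc; last first.
  by split=> // v; rewrite deriveE// D2 LE.
move=> eta eta0; have [r r0 Hr] := unif_ray F1 cu eta0.
have : \forall y \near u, ball c d y /\ ball u r y.
  apply: filterI; first exact: (open_near (ball_open c d) cu).
  exact: nbhsx_ballx.
apply: filterS => y [cy uy].
rewrite LE /ray_integral -int01B; [|by apply: cont_seg => //; exact: CkW..].
rewrite -int01B//; last by apply: cont01B; apply: cont_seg => //; exact: CkW.
apply: int01_bound.
  by apply: cont01B => //; apply: cont01B; apply: cont_seg => //; exact: CkW.
move=> t t01; have [t0 t1] := andP t01.
rewrite exprSr -mulrA -!mulrBr normrM normrX ger0_norm//.
have Es : seg u t + t *: (y - u) = seg y t.
  by rewrite /seg -addrA -scalerDr [u - c + _]addrC addrA subrK.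
have t1' x : 0 <= x -> t ^+ m * x <= x.
  by move=> x0; apply: ler_piMl => //; apply: exprn_ile1.
have [s s01|s /andP[/ltW s0 /ltW s1]] := @mvt_segment _ _ F (seg u t) (t *: (y - u)).
  apply: (proj1 F1); rewrite (_ : t *: _ = seg y t - seg u t).
    by apply: ball_segment => //; apply: seg_ball.
  by rewrite -Es addrAC subrr add0r.
rewrite Es => ->.
have cz : ball c d (seg u t + s *: (t *: (y - u))).
  rewrite (_ : t *: _ = seg y t - seg u t); last by rewrite -Es addrAC subrr add0r.
  by apply: ball_segment; rewrite ?s0//; apply: seg_ball.
rewrite derive_dirM; last exact: (proj1 F1).
rewrite -mulrBr normrM ger0_norm//.
rewrite mulrA -exprSr; apply: le_trans (_ : 1 * _ <= _).
  by apply: ler_wpM2r => //; apply: exprn_ile1.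
rewrite mul1r; apply: Hr => //.
rewrite -ball_normE /= sub0r normrN !normrZ ger0_norm// ger0_norm//.
move: uy; rewrite -ball_normE /= distrC; apply: le_lt_trans.
by rewrite mulrA ler_piMl// mulr_ile1.
Qed.

Lemma ray_integral_Ck F m k : Cinfty F (ball c d) ->
  Ck k (ray_integral m F) (ball c d).
Proof.
elim: k m F => [|k IH] m F FC.
  move=> u cu; apply: differentiable_continuous.
  exact: (proj1 (ray_derive m (FC 1%N) cu)).
split=> [u cu|v]; first exact: (proj1 (ray_derive m (FC 1%N) cu)).
apply: Ck_eq (IH m.+1 _ (Cinfty_derive v FC)); first exact: ball_open.
by move=> u cu; rewrite (proj2 (ray_derive m (FC 1%N) cu)).
Qed.

End Hadamard.

(** f u - f c is the integral over [0, 1] of the derivative of f along u - c at c + t (u - c);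
    expanding u - c in the frame gives [g i] as the ray integral of the i-th partial derivative. *)
Lemma hadamard (R : realType) (V : normedModType R) m (e : 'I_m -> V) l
    (c : V) (d : R) (f : V -> R) : is_frame e l ->
  Cinfty f (ball c d) -> exists g : 'I_m -> V -> R,
    (forall i, Cinfty (g i) (ball c d)) /\
    forall u, ball c d u -> f u = f c + \sum_i l i (u - c) * g i u.
Proof.
move=> le fC; have fV : findim V by exists m, e, l.
exists (fun i => ray_integral c 0 (fun y => 'D_(e i) f y)); split=> [i k|u cu].
  by apply: ray_integral_Ck => //; exact: Cinfty_derive.
have d0 : 0 < d by move: cu; rewrite -ball_normE => /(le_lt_trans _); apply.
have cs t : 0 <= t <= 1 -> ball c d (c + t *: (u - c)).
  by move=> t01; apply: ball_segment => //; apply: ballxx.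
have cD v : cont01 (fun t => 'D_v f (c + t *: (u - c))).
  exact: (cont_ray (Cinfty_derive v fC 0) cu).
have E : int01 (fun t => 'D_(u - c) f (c + t *: (u - c))) = f u - f c.
  have dF (t : R) : 0 <= t <= 1 -> is_derive t 1 (fun t : R => f (c + t *: (u - c)))
      ('D_(u - c) f (c + t *: (u - c))).
    move=> t01; apply: segment_is_derive.
    by apply: (Cinfty_differentiable fC); exact: cs.
  by rewrite (int01_derive dF (cD _)) scale1r scale0r addr0 [c + _]addrC subrK.
rewrite -[LHS](subrK (f c)) addrC -E; congr (_ + _).
transitivity (int01 (fun t => \sum_i l i (u - c) * 'D_(e i) f (c + t *: (u - c)))).
  apply: eq_int01 => t t01; rewrite (derive_frame _ le)//.
  by apply: (Cinfty_differentiable fC); exact: cs.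
rewrite int01_sum; last by move=> i; apply: cont01M => //; exact: cont01_cst.
apply: eq_bigr => i _; rewrite int01Z//; congr (_ * _).
by apply: eq_int01 => t _; rewrite expr0 mul1r.
Qed.

(** * Bump functions and ordinary differential equations *)

Section Bump.
Context {R : realType}.

Lemma derive_real (W : normedModType R) (f : R -> W) (t v : R) (w : W) :
  is_derive t 1 f w -> 'D_v f t = v *: w.
Proof.
move=> [d <-]; rewrite -derive_dirZ; last exact/derivable1_diffP.
by rewrite -[v *: 1]/(v * 1) mulr1.
Qed.

Lemma Ck_is_derive (W : normedModType R) k (f f' : R -> W) (U : set R) : open U ->
  (forall t, U t -> is_derive t 1 f (f' t)) -> Ck k f' U -> Ck k.+1 f U.
Proof.
move=> oU df fk.
have dff t : U t -> differentiable f t.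
  by move=> /df[d _]; apply/derivable1_diffP.
split=> // v.
pose L := ( *:%R (v : R) : W -> W).
have Lc : continuous L by move=> x; apply: continuousZr; exact: cvg_id.
apply: Ck_eq (@Ck_post R R W W k L f' U oU Lc fk) => // t Ut.
by rewrite (derive_real v (df t Ut)).
Qed.

Lemma Ck_prod (V : normedModType R) k (I : Type) (s : seq I) (f : I -> V -> R) U :
  open U -> (forall i, Ck k (f i) U) -> Ck k (fun x => \prod_(i <- s) f i x) U.
Proof.
move=> oU H; elim: s => [|i s IH].
  by apply: Ck_eq (Ck_cst k (1 : R) U) => // x _; rewrite big_nil.
by apply: Ck_eq (CkM oU (H i) IH) => // x _; rewrite big_cons.
Qed.

(* The functions x^-m exp(-1/x), extended by 0 to x <= 0: the derivative of
   the m-th one is a combination of the next two. *)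
Definition flat m (x : R) : R := if 0 < x then x^-1 ^+ m * expR (- x^-1) else 0.

(** From exp y >= y^(m+2) / (m+2)! at y = 1/x. The quadratic decay gives the derivative 0 at the
    origin, where the two branches of [flat] meet. *)
Lemma flat_le m x : 0 <= x -> `|flat m x| <= (m.+2)`!%:R * x ^+ 2.
Proof.
rewrite le_eqVlt => /predU1P[<-|x0].
  by rewrite /flat ltxx normr0 expr0n /= mulr0.
rewrite /flat x0 ger0_norm; last by rewrite mulr_ge0 ?expR_ge0// exprn_ge0// invr_ge0 ltW.
have y0 : 0 < x^-1 by rewrite invr_gt0.
rewrite expRN; set y := x^-1 in y0 *.
have -> : x = y^-1 by rewrite /y invrK.
rewrite ler_pdivrMr ?expR_gt0//.
have H := expR_ge1Dxn m.+1 (ltW y0).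
have F0 : (0 : R) < (m.+2)`!%:R by rewrite ltr0n fact_gt0.
have H2 : y ^+ m.+2 <= (m.+2)`!%:R * expR y.
  rewrite mulrC -ler_pdivrMr//; apply: le_trans H.
  by rewrite lerDr.
have -> : y^-1 ^+ 2 = (y ^+ 2)^-1 by rewrite exprVn.
rewrite -mulrA [X in _ * X]mulrC mulrA.
by rewrite ler_pdivlMr ?exprn_gt0// -exprD addn2.
Qed.

Lemma is_derive_flat m (x : R) :
  is_derive x 1 (flat m) (flat m.+2 x - m%:R * flat m.+1 x).
Proof.
have [x0|x0|->] := ltgtP x 0.
- have H : \near x, cst 0 x = flat m x.
    near=> y; rewrite /flat ltNge ltW//.
    by near: y; exact: lt_nbhsl.
  rewrite {2 3}/flat ltNge (ltW x0) /= mulr0 subr0.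
  by apply: (@near_eq_is_derive R R R (cst 0) _ x 1 0 H); exact: is_derive_cst.
- have H : \near x, (fun y => y^-1 ^+ m * expR (- y^-1)) x = flat m x.
    near=> y; rewrite /flat ifT//.
    by near: y; exact: lt_nbhsr.
  apply: (@near_eq_is_derive R R R _ _ x 1 _ H).
  have xn : x != 0 by rewrite gt_eqF.
  have di : is_derive x 1 (fun y : R => y^-1) (- x ^- 2).
    have := @is_deriveV R id x 1 1 xn (is_derive_id x 1).
    by rewrite /GRing.scale /= mulr1.
  have d2 : is_derive x 1 (fun y : R => expR (- y^-1)) (x ^- 2 * expR (- x^-1)).
    have := @is_derive1_comp R expR (fun y => - y^-1) x _ _ (is_derive_expR _) (is_deriveN di).
    by rewrite opprK mulrC.
  rewrite /flat x0.
  have EX : (fun y : R => y^-1) ^+ m = (fun y => y^-1 ^+ m).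
    by apply/funext => y; rewrite exprfctE.
  have := is_deriveM (is_deriveX m di) d2; rewrite EX => dM.
  apply: is_derive_eq dM _.
  have -> : x ^- 2 = x^-1 ^+ 2 by rewrite exprVn.
  rewrite /GRing.scale /=; move: (x^-1) (expR _) => y z.
  by case: m {H EX} => [|m]; rewrite /= ?expr0 !exprS; ring.
- rewrite /flat !ltxx mulr0 subr0 -/(flat m).
  pose L : {linear R -> R^o} := \0.
  have [||D1 D2] := @differentiable_eps R R R (flat m) 0 (\0 : {linear R -> R}).
  + exact: cst_continuous.
  + move=> e e0; have -> : flat m 0 = 0 by rewrite /flat ltxx.
    pose C : R := (m.+2)`!%:R.
    have C0 : 0 < C by rewrite ltr0n fact_gt0.
    near=> y; rewrite !subr0.
    have [y0|y0] := lerP 0 y; last first.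
      have -> : flat m y = 0 by rewrite /flat ltNge ltW.
      by rewrite normr0 mulr_ge0// ltW.
    apply: le_trans (flat_le _ y0) _; rewrite expr2 mulrA ger0_norm//.
    apply: ler_wpM2r => //; rewrite mulrC -ler_pdivlMr//.
    near: y; have : 0 < e / C by rewrite divr_gt0.
    by move/lt_nbhsl; apply: filterS => y /ltW.
  + apply: DeriveDef; first exact: diff_derivable.
    by rewrite deriveE// D2.
Unshelve. all: by end_near. Qed.


Lemma Ck_flat k m : Ck k (flat m) (setT : set R).
Proof.
elim: k m => [|k IH] m.
  move=> x _; have [d _] := is_derive_flat m x.
  by apply: differentiable_continuous; exact/derivable1_diffP.
apply: (Ck_is_derive (f' := fun x => flat m.+2 x - m%:R * flat m.+1 x)).
- exact: openT.
- by move=> t _; exact: is_derive_flat.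
- apply: CkB; [exact: openT|exact: IH|].
  by apply: CkM; [exact: openT|exact: Ck_cst|exact: IH].
Qed.

(** [flat 0] is positive exactly on the positive reals, so [flat 0 (1 + x) * flat 0 (1 - x)] lives
    on ]-1, 1[; at 0 it equals the square of [flat 0 1], which is divided out. *)
Lemma smooth_bump1 : exists b : R -> R, [/\ Cinfty b setT, b 0 = 1 &
  forall x, 1 <= `|x| -> b x = 0].
Proof.
pose E := flat 0 (1 : R).
have E0 : E != 0 by rewrite /E /flat ltr01 expr0 mul1r gt_eqF// expR_gt0.
exists (fun x => E ^-1 * E^-1 * (flat 0 (1 + x) * flat 0 (1 - x))); split.
- move=> k.
  have H (s : R) : Ck k (fun x : R => flat 0 (1 + s * x)) setT.
    apply: (Ck_comp (U' := setT) (f := flat 0) (g := fun x : R => 1 + s * x)) => //.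
    + exact: findim_R.
    + exact: findim_R.
    + exact: openT.
    + exact: openT.
    + exact: Ck_flat.
    apply: CkD; [exact: openT|exact: Ck_cst|].
    apply: CkM; [exact: openT|exact: Ck_cst|].
    by apply: (@Ck_lin R R^o R^o k idfun); [exact: openT|move=> ?; exact: cvg_id].
  apply: CkM; [exact: openT|exact: Ck_cst|].
  apply: CkM; first exact: openT.
    by apply: Ck_eq (H 1); [exact: openT|move=> x _; rewrite mul1r].
  by apply: Ck_eq (H (- 1)); [exact: openT|move=> x _; rewrite mulN1r].
- rewrite addr0 subr0 -/E; by field.
- move=> x; rewrite ler_normr => /orP[x1|x1]; rewrite /flat.
    by rewrite [X in _ * (_ * X)]ifF ?mulr0//; apply/negbTE; rewrite -leNgt subr_le0.
  rewrite ifF ?mul0r ?mulr0//; apply/negbTE; rewrite -leNgt.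
  by rewrite addrC -lerBrDr sub0r lerNr.
Qed.

Lemma smooth_bump n (c : 'rV[R]_n.+1) (d : R) : 0 < d ->
  exists b : 'rV[R]_n.+1 -> R, [/\ Cinfty b setT, b c = 1 &
    forall x, d <= `|x - c| -> b x = 0].
Proof.
move=> d0; have [b [bC b0 b1]] := smooth_bump1.
exists (fun x => \prod_(i < n.+1) b (d^-1 * (x 0 i - c 0 i))); split.
- move=> k; apply: Ck_prod => [|i]; first exact: openT.
  apply: (Ck_comp (U' := setT) (f := b)
    (g := fun x : 'rV[R]_n.+1 => d^-1 * (x 0 i - c 0 i))) => //.
  + exact: findim_R.
  + exact: findim_R.
  + exact: openT.
  + exact: openT.
  apply: CkM; [exact: openT|exact: Ck_cst|].
  apply: CkB; [exact: openT| |exact: Ck_cst].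
  by apply: Ck_coord; exact: openT.
- by apply: big1 => i _; rewrite subrr mulr0.
(* In the maximum norm some coordinate of x - c attains the norm, and its factor in the product
   vanishes. *)
- move=> x dx; have xc : mx_norm (x - c) != 0.
    by apply: lt0r_neq0; apply: lt_le_trans dx.
  have [[i j] /= E] := mx_norm_neq0 xc.
  rewrite (bigD1 j)//= b1 ?mul0r// normrM gtr0_norm ?invr_gt0//.
  move: E; rewrite !mxE ord1 => <-.
  by rewrite mulrC ler_pdivlMr// mul1r.
Qed.

End Bump.

(** * Primitives, geometric convergence and Picard iteration *)

Section Primitive.
Context {R : realType}.
Implicit Types g : R -> R.

Definition clamp (r t : R) : R := Num.max (- r) (Num.min t r).

Lemma clamp_continuous r : continuous (clamp r).
Proof.
move=> t; apply: (@continuous_max R R (cst (- r)) (fun t => Num.min t r)).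
  exact: cst_continuous.
by apply: (@continuous_min R R id (cst r)); [exact: cvg_id|exact: cst_continuous].
Qed.

Lemma clamp_id r t : `|t| <= r -> clamp r t = t.
Proof.
rewrite ler_norml => /andP[t1 t2].
by rewrite /clamp min_l// max_r.
Qed.

Lemma clamp_le r t : 0 <= r -> `|clamp r t| <= r.
Proof.
move=> r0; rewrite ler_norml /clamp le_max lexx /= ge_max.
by rewrite ge_min lexx orbT andbT; apply: le_trans (r0); rewrite oppr_le0.
Qed.

Lemma clamp_lip r s t : 0 <= r -> `|clamp r s - clamp r t| <= `|s - t|.
Proof.
move=> r0; wlog st : s t / s <= t.
  by move=> H; have [/H//|/ltW/H] := leP s t; rewrite distrC (distrC t).
rewrite !(distrC s) !(distrC (clamp r s)).
have cst0 : clamp r s <= clamp r t.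
  rewrite /clamp ge_max !le_max lexx /= orbC; apply/orP; left.
  by rewrite le_min !ge_min st lexx /= orbT.
rewrite !ger0_norm ?subr_ge0//.
rewrite /clamp; case: (leP t r); case: (leP s r); rewrite ?maxEle ?minEle => *;
  repeat case: ifP; lra.
Qed.

(* A primitive of g on ]-3, 3[, frozen outside [-2, 2]. *)
Definition prim g (t : R) : R :=
  (\int[lebesgue_measure]_(s in `[- 3, clamp 2 t]) g s)%R -
  (\int[lebesgue_measure]_(s in `[- 3, 0]) g s)%R.

Let prim_aux g (t : R) : continuous g -> - 3 < t < 3 ->
  is_derive t 1 (fun x => (\int[lebesgue_measure]_(s in `[- 3, x]) g s)%R -
    (\int[lebesgue_measure]_(s in `[- 3, 0]) g s)%R) (g t).
Proof.
move=> cg /andP[t1 t2].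
have [D E] := @continuous_FTC1_closed R g (- 3) t 3 t2
  (integrable_itv (fun s _ => cg s)) t1 (cg t).
have dF : is_derive t 1 (fun x => \int[lebesgue_measure]_(s in `[- 3, x]) g s)%R (g t).
  by apply: DeriveDef; [exact: D|rewrite -derive1E; exact: E].
have := is_deriveB dF
  (is_derive_cst (\int[lebesgue_measure]_(s in `[- 3, 0]) g s)%R t 1).
by rewrite subr0.
Qed.

Lemma prim_derive g (t : R) : continuous g -> `|t| < 2 -> is_derive t 1 (prim g) (g t).
Proof.
move=> cg t2.
have : - 3 < t < 3 by move: t2; rewrite ltr_norml => /andP[? ?]; apply/andP; split; lra.
move=> /(prim_aux cg); apply: near_eq_is_derive.
have : \forall s \near t, `|s| < 2.
  have : {for t, continuous (fun s : R => `|s|)} by apply: norm_continuous.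
  by move=> /(_ _ (lt_nbhsl t2)).
by apply: filterS => s s2; rewrite /prim clamp_id// ltW.
Qed.

Lemma prim0 g : prim g 0 = 0.
Proof. by rewrite /prim clamp_id ?subrr// normr0. Qed.

Lemma prim_continuous g : continuous g -> continuous (prim g).
Proof.
move=> cg t.
pose H x := (\int[lebesgue_measure]_(s in `[- 3, x]) g s)%R -
    (\int[lebesgue_measure]_(s in `[- 3, 0]) g s)%R.
apply: (@continuous_comp _ _ _ (clamp 2) H); first exact: clamp_continuous.
have t3 : - 3 < clamp 2 t < 3.
  have := @clamp_le 2 t (ler0n _ 2); rewrite ler_norml => /andP[? ?].
  by apply/andP; split; lra.
have [d _] := prim_aux cg t3.
by apply: differentiable_continuous; exact/derivable1_diffP.
Qed.

(** The factor 2 is the radius of the interval outside which [clamp 2] is constant; thanks to this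
    freezing the estimate holds for every real t. *)
Lemma prim_lip g1 g2 (M t : R) : continuous g1 -> continuous g2 ->
  (forall s, `|g1 s - g2 s| <= M) -> `|prim g1 t - prim g2 t| <= 2 * M.
Proof.
move=> c1 c2 gM.
pose H g x := (\int[lebesgue_measure]_(s in `[- 3, x]) g s)%R -
    (\int[lebesgue_measure]_(s in `[- 3, 0]) g s)%R.
have M0 : 0 <= M by apply: le_trans (gM 0).
have dH (s : R) : - 3 < s < 3 -> is_derive s 1 (fun x => H g1 x - H g2 x) (g1 s - g2 s).
  by move=> s3; apply: is_deriveB; exact: prim_aux.
set u := clamp 2 t.
have u2 : `|u| <= 2 by apply: clamp_le.
have -> : prim g1 t - prim g2 t = (H g1 u - H g2 u) - (H g1 0 - H g2 0).
  by rewrite /prim /H -/u; ring.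
move: (H g1) (H g2) dH => H1 H2 dH.
have in3 s : 0 <= s <= 1 -> - 3 < s * u < 3.
  move=> /andP[s0 s1]; have : `|s * u| <= 2.
    by rewrite normrM ger0_norm//; apply: le_trans u2; apply: ler_piMl.
  by rewrite ler_norml => /andP[? ?]; apply/andP; split; lra.
have [|s /andP[/ltW s0 /ltW s1]] := @mvt_segment R R (fun x => H1 x - H2 x) 0 u.
  move=> s s01; rewrite add0r.
  by have [d _] := dH _ (in3 _ s01); exact/derivable1_diffP.
rewrite !add0r => ->; have s01 : 0 <= s <= 1 by rewrite s0.
rewrite (derive_real u (dH _ (in3 _ s01))).
by rewrite normrM; apply: ler_pM.
Qed.

End Primitive.

Section GeometricLimit.
Context {R : realType}.

Lemma geometric_limit n (u : nat -> 'rV[R]_n) (C : R) :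
  (forall k, `|u k.+1 - u k| <= C / 2 ^+ k) ->
  exists l, forall k, `|l - u k| <= 2 * C / 2 ^+ k.
Proof.
move=> H.
have C0 : 0 <= C.
  by apply: le_trans (normr_ge0 (u 1%N - u 0%N)) _; have := H 0%N; rewrite expr0 divr1.
(* The bound telescopes exactly, so the induction on j loses nothing. *)
have step k j : `|u (k + j)%N - u k| <= 2 * C / 2 ^+ k - 2 * C / 2 ^+ (k + j).
  elim: j => [|j IH]; first by rewrite addn0 !subrr normr0.
  rewrite addnS -[_ - u k](subrKA (u (k + j)%N)).
  apply: le_trans (ler_normD _ _) _; apply: le_trans (lerD (H _) IH) _.
  rewrite exprS invfM; set y := (2 ^+ (k + j))^-1.
  have -> : 2 * C * (2^-1 * y) = C * y by field.
  by rewrite le_eqVlt; apply/orP; left; apply/eqP; ring.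
have p2 k : 0 < 2 ^+ k :> R by rewrite exprn_gt0.
have bound k j : (k <= j)%N -> `|u j - u k| <= 2 * C / 2 ^+ k.
  move=> kj; rewrite -(subnKC kj); apply: le_trans (step _ _) _.
  by rewrite lerBlDr lerDl divr_ge0// ?mulr_ge0// ltW.
have small (e : R) : 0 < e -> exists k, 2 * C / 2 ^+ k < e.
  move=> e0; have /cvgrPdist_lt /(_ _ e0) : geometric (2 * C) (2^-1) k @[k --> \oo] --> (0 : R).
    by apply: cvg_geometric; rewrite ger0_norm ?invr_ge0// invf_lt1// ltr1n.
  move=> [k _ Hk]; exists k; have := Hk k (leqnn k).
  rewrite sub0r normrN /geometric /= exprVn => /(le_lt_trans _); apply.
  exact: ler_norm.
have : cvg (u @ \oo).
  apply/cauchy_cvgP; apply: cauchy_exP => e e0.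
  have [k Hk] := small e e0; exists (u k); exists k => // j /= kj.
  rewrite -ball_normE /= distrC; exact: le_lt_trans (bound _ _ kj) Hk.
move=> /cvg_ex[l ul]; exists l => k.
apply/ler_addgt0Pr => e e0.
have /cvgrPdist_lt /(_ _ e0)[j _ Hj] := ul.
have := Hj (maxn j k) (leq_maxl _ _) => /= Hl.
rewrite -[l - _](subrKA (u (maxn j k))) addrC.
apply: le_trans (ler_normD _ _) _; apply: lerD; last exact: ltW.
exact/bound/leq_maxr.
Qed.

End GeometricLimit.

Section Picard.
Context {R : realType} {n : nat}.
Implicit Types g : R -> 'rV[R]_n.

Definition vprim g (t : R) : 'rV[R]_n := \row_j prim (fun s => g s 0 j) t.

Let coordc g j : continuous g -> continuous (fun s => g s 0 j).
Proof.
move=> cg s; apply: (@continuous_comp _ _ _ g (fun x : 'rV[R]_n => x 0 j)).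
  exact: cg.
exact: coord_continuous.
Qed.

Lemma vprim_derive g (t : R) : continuous g -> `|t| < 2 ->
  is_derive t 1 (vprim g) (g t).
Proof.
move=> cg t2.
have D i j : is_derive t 1 (fun s => vprim g s i j) (g t 0 j).
  rewrite (_ : (fun s => _) = prim (fun s => g s 0 j)).
    by apply: prim_derive => //; exact: coordc.
  by apply/funext => s; rewrite mxE.
have d : derivable (vprim g) t 1 by apply/derivable_mxP => i j; have [] := D i j.
apply: DeriveDef => //; rewrite derive_mx//; apply/rowP => j; rewrite !mxE.
by have [] := D 0 j.
Qed.

Lemma vprim0 g : vprim g 0 = 0.
Proof. by apply/rowP => j; rewrite !mxE prim0. Qed.

Lemma vprim_continuous g : continuous g -> continuous (vprim g).
Proof.
move=> cg t; have [m [e [l le]]] := @findim_rV R n.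
suff : Ck 0 (vprim g) setT by apply.
apply: (Ck_eq (f := fun s => \sum_j prim (fun s => g s 0 j) s *: delta_mx 0 j)).
- exact: openT.
- by move=> s _; rewrite [RHS]row_sum_delta; apply: eq_bigr => j _; rewrite mxE.
- apply: Ck_sum => [|j]; first exact: openT.
  apply: Ck_scalel; first exact: openT.
  by move=> s _; apply: prim_continuous; exact: coordc.
Qed.

Lemma vprim_lip g1 g2 (M t : R) : continuous g1 -> continuous g2 ->
  (forall s, `|g1 s - g2 s| <= M) -> `|vprim g1 t - vprim g2 t| <= 2 * M.
Proof.
move=> c1 c2 gM; have M0 : 0 <= M by apply: le_trans (gM 0).
apply: rV_norm_le => [|j]; first by rewrite mulr_ge0.
rewrite !mxE; apply: prim_lip; [exact: coordc|exact: coordc|move=> s].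
by apply: le_trans (gM s); have := rV_coord_le (g1 s - g2 s) j; rewrite !mxE.
Qed.

(** Integrating from 0 over a length of at most 2 costs a factor 2, so a Lipschitz constant 1/4
    makes the integral operator a contraction of ratio 1/2 for the supremum norm over the whole
    line. Truncated primitives spare any control of where the iterates live. *)
Lemma picard (f : 'rV[R]_n -> 'rV[R]_n) (u0 : 'rV[R]_n) :
  (forall x y, `|f x - f y| <= 4^-1 * `|x - y|) ->
  exists c : R -> 'rV[R]_n, c 0 = u0 /\ forall t : R, `|t| < 2 -> is_derive t 1 c (f (c t)).
Proof.
move=> lip.
have fc : continuous f.
  move=> x; apply/(@cvgrPdist_le _ _ _ (nbhs x)) => e e0; near=> y.
  apply: le_trans (lip _ _) _; apply: le_trans (_ : `|x - y| <= e).
    by apply: ler_piMl => //; rewrite invf_le1// ler1n.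
  by near: y; apply: cvgr_dist_le => //; exact: cvg_id.
pose T c := fun t => u0 + vprim (fun s => f (c s)) t.
have Tc c : continuous c -> continuous (T c).
  move=> cc t; apply: continuousD; first exact: cst_continuous.
  apply: vprim_continuous => s.
  by apply: continuous_comp; [exact: cc|exact: fc].
pose u k := iter k T (fun=> u0).
have uc k : continuous (u k).
  by elim: k => [|k IH]; [exact: cst_continuous|exact: Tc].
have Tlip c1 c2 (M t : R) : continuous c1 -> continuous c2 ->
    (forall s, `|c1 s - c2 s| <= M) -> `|T c1 t - T c2 t| <= 2^-1 * M.
  move=> cc1 cc2 H; rewrite /T opprD addrACA subrr add0r.
  have -> : 2^-1 * M = 2 * (4^-1 * M) by field.
  apply: vprim_lip => [s|s|s].
  - by apply: continuous_comp; [exact: cc1|exact: fc].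
  - by apply: continuous_comp; [exact: cc2|exact: fc].
  by apply: le_trans (lip _ _) _; apply: ler_wpM2l => //; rewrite invr_ge0.
pose C := 2 * `|f u0|.
have ustep k t : `|u k.+1 t - u k t| <= C / 2 ^+ k.
  elim: k t => [|k IH] t.
    rewrite expr0 divr1 /u /= /T addrC addKr.
    have := @vprim_lip (fun=> f u0) (fun=> 0) `|f u0| t.
    have -> : vprim (fun=> 0) t = 0.
      apply/rowP => j; rewrite !mxE /prim.
      by rewrite !Rintegral_cst// !mul0r subrr.
    by rewrite !subr0; apply => //; exact: cst_continuous.
  rewrite exprS invfM mulrCA; exact: Tlip (uc _) (uc _) IH.
have [c Hc] : exists c : R -> 'rV[R]_n, forall t k, `|c t - u k t| <= 2 * C / 2 ^+ k.
  have H t : exists l, forall k, `|l - u k t| <= 2 * C / 2 ^+ k.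
    by apply: (@geometric_limit R n (fun k => u k t)) => k; exact: ustep.
  by have [c Hc] := choice H; exists c.
have small (e : R) : 0 < e -> exists k, 2 * C / 2 ^+ k < e.
  move=> e0; have /cvgrPdist_lt /(_ _ e0) : geometric (2 * C) (2^-1) k @[k --> \oo] --> (0 : R).
    by apply: cvg_geometric; rewrite ger0_norm ?invr_ge0// invf_lt1// ltr1n.
  move=> [k _ Hk]; exists k; have := Hk k (leqnn k).
  rewrite sub0r normrN /geometric /= exprVn => /(le_lt_trans _); apply.
  exact: ler_norm.
have cc : continuous c.
  move=> t; apply/cvgrPdist_le => e e0.
  have e30 : 0 < e / 3 by rewrite divr_gt0.
  have [k Hk] := small _ e30.
  have := uc k t => /cvgrPdist_le /(_ _ e30); apply: filterS => s Hs.
  have -> : c t - c s = (c t - u k t) + (u k t - u k s) + (u k s - c s).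
    by rewrite !addrA !subrK.
  have -> : e = e / 3 + e / 3 + e / 3 by field.
  apply: le_trans (ler_normD _ _) _; apply: lerD; last first.
    by rewrite distrC; apply: le_trans (Hc s k) (ltW Hk).
  apply: le_trans (ler_normD _ _) _; apply: lerD => //.
  exact: le_trans (Hc t k) (ltW Hk).
have cT t : c t = T c t.
  apply/eqP; rewrite -subr_eq0 -normr_le0; apply/ler_addgt0Pr => e e0.
  have e20 : 0 < e / 2 by rewrite divr_gt0.
  have [k Hk] := small _ e20; rewrite add0r.
  have -> : c t - T c t = (c t - u k.+1 t) + (T (u k) t - T c t).
    by rewrite addrA subrK.
  apply: le_trans (ler_normD _ _) _; rewrite (splitr e); apply: lerD.
    apply: le_trans (Hc t k.+1) _; apply: le_trans (ltW Hk).
    rewrite exprS invfM mulrCA ler_piMl//.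
      by rewrite divr_ge0// ?mulr_ge0// exprn_ge0.
    by rewrite invf_le1// ler1n.
  apply: le_trans (_ : 2^-1 * (2 * C / 2 ^+ k) <= _).
    by apply: Tlip => // s; rewrite distrC.
  apply: le_trans (ltW Hk); rewrite ler_piMl//.
    by rewrite divr_ge0// ?mulr_ge0// exprn_ge0.
  by rewrite invf_le1// ler1n.
exists c; split; first by rewrite cT /T vprim0 addr0.
move=> t t2; have -> : c = T c by apply/funext.
rewrite -[f _]add0r; apply: is_deriveD.
rewrite -(funext cT); apply: (@vprim_derive (fun s => f (c s))) => // s.
by apply: continuous_comp; [exact: cc|exact: fc].
Unshelve. all: by end_near. Qed.

End Picard.

(** * Smooth maps into a Lie group *)

Section MoreCk.
Context {R : realType}.

Lemma Ck_pair (V A B : normedModType R) k (f : V -> A) (g : V -> B) U : open U ->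
  Ck k f U -> Ck k g U -> Ck k (fun x => (f x, g x)) U.
Proof.
move=> oU; elim: k f g => [|k IH] f g.
  by move=> fk gk x Ux; apply: cvg_pair; [exact: fk|exact: gk].
move=> [f1 f2] [g1 g2]; split=> [x Ux|v].
  by apply: differentiable_pair; [exact: f1|exact: g1].
apply: Ck_eq (IH _ _ (f2 v) (g2 v)) => // x Ux.
have df := f1 _ Ux; have dg := g1 _ Ux.
by rewrite [RHS]deriveE ?diff_pair ?[in LHS]deriveE//; apply: differentiable_pair.
Qed.

Lemma Ck_fst (V A B : normedModType R) k (f : V -> A * B) U : open U ->
  Ck k f U -> Ck k (fun x => (f x).1) U.
Proof.
move=> oU; apply: (@Ck_post _ _ _ _ k fst) => //.
by move=> x; exact: cvg_fst.
Qed.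

Lemma Ck_snd (V A B : normedModType R) k (f : V -> A * B) U : open U ->
  Ck k f U -> Ck k (fun x => (f x).2) U.
Proof.
move=> oU; apply: (@Ck_post _ _ _ _ k snd) => //.
by move=> x; exact: cvg_snd.
Qed.

Lemma Ck_id (V : normedModType R) k (U : set V) : open U -> Ck k (fun x => x) U.
Proof. by move=> oU; apply: (@Ck_lin R V V k idfun) => // x; exact: cvg_id. Qed.

Lemma open_preimage (V T : topologicalType) (F : V -> T) (U : set V) (D : set T) :
  open U -> open D -> (forall x, U x -> {for x, continuous F}) ->
  open (U `&` F @^-1` D).
Proof.
move=> oU oD Fc; rewrite openE => x [Ux Dx].
apply: filterI; first exact: open_near.
by apply: Fc => //; apply: open_near.
Qed.

Lemma open_setX (T1 T2 : topologicalType) (A : set T1) (B : set T2) :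
  open A -> open B -> open (A `*` B).
Proof.
move=> oA oB; rewrite openE => -[a b] [/= Aa Bb].
by exists (A, B) => //; split; exact: open_near.
Qed.

End MoreCk.

(** * Smooth maps into a space with an atlas *)

Section SmoothInto.
Context {R : realType} {n : nat} {T : topologicalType} {atl : set (chart R n T)}.

Lemma smooth_into_sub (V : normedModType R) (F : V -> T) (U U' : set V) :
  U' `<=` U -> smooth_into atl F U -> smooth_into atl F U'.
Proof.
move=> UU [F1 F2]; split=> [x /UU|c cA k]; first exact: F1.
by apply: Ck_sub (F2 c cA k) => x [/UU].
Qed.

Lemma smooth_into_loc (V : normedModType R) (F : V -> T) (U : set V) :
  (forall x, U x -> exists U', U' x /\ smooth_into atl F U') -> smooth_into atl F U.
Proof.
move=> H; split=> [x Ux|c cA k].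
  by have [U' [U'x [H1 _]]] := H x Ux; exact: H1.
apply: Ck_loc => x [Ux Fx]; have [U' [U'x [_ H2]]] := H x Ux.
by exists (U' `&` F @^-1` cdom c); split=> //; exact: H2.
Qed.

Lemma smooth_into_eq (V : normedModType R) (F F' : V -> T) (U : set V) : open U ->
  (forall x, U x -> F x = F' x) -> smooth_into atl F U -> smooth_into atl F' U.
Proof.
move=> oU E [F1 F2].
have c' x : U x -> {for x, continuous F'}.
  move=> Ux; have := F1 x Ux; rewrite /prop_for /continuous_at -E//.
  apply: cvg_trans; apply: near_eq_cvg.
  by apply: filterS (open_near oU Ux) => y /E.
split=> // c cA k.
apply: (@Ck_eq _ _ _ k (fun x => cmap c (F x))).
- by apply: open_preimage => //; exact: cdom_open.
- by move=> x [Ux _]; rewrite E.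
- by apply: Ck_sub (F2 c cA k) => x [Ux]; rewrite /= -E.
Qed.

Lemma smooth_into_comp (V M : normedModType R) (F : M -> T) (h : V -> M)
    (U : set V) (U' : set M) : findim M -> open U -> open U' ->
  (forall x, U x -> U' (h x)) -> Cinfty h U -> smooth_into atl F U' ->
  smooth_into atl (fun x => F (h x)) U.
Proof.
move=> fM oU oU' UU hC [F1 F2]; split=> [x Ux|c cA k].
  apply: continuous_comp; last by apply: F1; exact: UU.
  exact: (Cinfty_continuous hC).
have oF : open (U' `&` F @^-1` cdom c).
  by apply: open_preimage => //; exact: cdom_open.
apply: (Ck_comp (U' := U' `&` F @^-1` cdom c) (f := fun x => cmap c (F x))) => //.
- exact: findim_rV.
- rewrite (_ : _ `&` _ = U `&` h @^-1` (U' `&` F @^-1` cdom c)).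
    by apply: open_preimage => // x Ux; exact: (Cinfty_continuous hC).
  by apply/seteqP; split=> x [Ux Hx]; split=> //; [split=> //; exact: UU|case: Hx].
- by move=> x [/UU].
- exact: F2.
- by apply: Ck_sub (hC k) => x [].
Qed.

Lemma smooth_into_cst (V : normedModType R) (x : T) (U : set V) :
  smooth_into atl (fun=> x) U.
Proof. by split=> [y _|c cA k]; [exact: cst_continuous|exact: Ck_cst]. Qed.

Lemma smooth_into_chart (V : normedModType R) (F : V -> T) (U : set V) c :
  smooth_into atl F U -> atl c -> Cinfty (fun x => cmap c (F x)) (U `&` F @^-1` cdom c).
Proof. by case=> _; apply. Qed.

Lemma smooth_into_open (V : normedModType R) (F : V -> T) (U : set V) (D : set T) :
  open U -> open D -> smooth_into atl F U -> open (U `&` F @^-1` D).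
Proof. by move=> oU oD [F1 _]; apply: open_preimage. Qed.

Lemma cinvK (c : chart R n T) u : cimg c u -> cmap c (cinv c u) = u.
Proof. by move=> [x cx <-]; rewrite cmapK. Qed.

Lemma cdom_cinv (c : chart R n T) u : cimg c u -> cdom c (cinv c u).
Proof. by move=> [x cx <-]; rewrite cmapK. Qed.

Lemma cimgO (c : chart R n T) : open (cimg c).
Proof. exact: cimg_open. Qed.

Lemma cimg_cmap (c : chart R n T) x : cdom c x -> cimg c (cmap c x).
Proof. by move=> cx; exists x. Qed.

End SmoothInto.
Arguments cimgO {R n T} c.

(** * Smooth functions and smooth maps on a Lie group *)

Section GroupCalculus.
Context {R : realType} {n : nat} {G : lieGroupType R n}.
Implicit Types (V : normedModType R) (c : chart R n G).

Local Notation smoothG := (smooth_into (@atlas R n G)).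

Lemma smooth_mul V (F1 F2 : V -> G) U : open U -> smoothG F1 U -> smoothG F2 U ->
  smoothG (fun x => F1 x * F2 x)%g U.
Proof.
move=> oU s1 s2; apply: smooth_into_loc => x Ux.
have [c1 c1A c1x] := atlas_cover (F1 x); have [c2 c2A c2x] := atlas_cover (F2 x).
pose U' := (U `&` F1 @^-1` cdom c1) `&` (U `&` F2 @^-1` cdom c2).
have oU1 := smooth_into_open oU (cdom_open c1) s1.
have oU2 := smooth_into_open oU (cdom_open c2) s2.
have oU' : open U' by apply: openI.
exists U'; split=> //.
apply: (@smooth_into_eq _ _ _ _ _ (fun x => cinv c1 (cmap c1 (F1 x)) * cinv c2 (cmap c2 (F2 x)))%g) => //.
  by move=> y [[_ y1] [_ y2]]; rewrite !cmapK.
apply: (@smooth_into_comp _ _ _ _ _ _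
  (fun p : 'rV[R]_n.+1 * 'rV[R]_n.+1 => (cinv c1 p.1 * cinv c2 p.2)%g)
  (fun x => (cmap c1 (F1 x), cmap c2 (F2 x))) U' (cimg c1 `*` cimg c2)) => //.
- by apply: findim_prod; exact: findim_rV.
- by apply: open_setX; exact: cimg_open.
- by move=> y [[_ y1] [_ y2]]; split; exact: cimg_cmap.
- move=> k; apply: Ck_pair => //.
    by apply: Ck_sub (smooth_into_chart s1 c1A k) => y [].
  by apply: Ck_sub (smooth_into_chart s2 c2A k) => y [].
- exact: mul_smooth.
Qed.

Lemma smooth_endo_comp V (phi : G -> G) (F : V -> G) U : open U ->
  smooth_endo phi -> smoothG F U -> smoothG (fun x => phi (F x)) U.
Proof.
move=> oU sp sF; apply: smooth_into_loc => x Ux.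
have [c cA cx] := atlas_cover (F x).
have oU' := smooth_into_open oU (cdom_open c) sF.
exists (U `&` F @^-1` cdom c); split=> //.
apply: (@smooth_into_eq _ _ _ _ _ (fun x => phi (cinv c (cmap c (F x))))) => //.
  by move=> y [_ yc]; rewrite cmapK.
apply: (@smooth_into_comp _ _ _ _ _ _ (fun u => phi (cinv c u)) _ _ (cimg c)) => //.
- exact: findim_rV.
- exact: cimg_open.
- by move=> y [_]; exact: cimg_cmap.
- exact: (smooth_into_chart sF cA).
- exact: sp.
Qed.

Lemma smooth_inv V (F : V -> G) U : open U -> smoothG F U ->
  smoothG (fun x => (F x)^-1)%g U.
Proof. by move=> oU; apply: smooth_endo_comp => // c; exact: inv_smooth. Qed.

Lemma smooth_endo_mulr (g : G) : smooth_endo (fun x => x * g)%g.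
Proof.
move=> c cA; apply: smooth_mul; [exact: cimg_open|exact: cinv_smooth|].
exact: smooth_into_cst.
Qed.

Lemma smooth_endo_mull (g : G) : smooth_endo (fun x => g * x)%g.
Proof.
move=> c cA; apply: smooth_mul; [exact: cimg_open| |exact: cinv_smooth].
exact: smooth_into_cst.
Qed.

Lemma smooth_endo_conj (g : G) : smooth_endo (conj g).
Proof.
move=> c cA; apply: smooth_mul; [exact: cimg_open| |exact: smooth_into_cst].
exact: smooth_endo_mull.
Qed.

Lemma smooth_fun_into V (f : G -> R) (F : V -> G) U : open U -> smooth_fun f ->
  smoothG F U -> Cinfty (fun x => f (F x)) U.
Proof.
move=> oU sf sF k; apply: Ck_loc => x Ux.
have [c cA cx] := atlas_cover (F x).
have oU' := smooth_into_open oU (cdom_open c) sF.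
exists (U `&` F @^-1` cdom c); split=> //.
apply: (@Ck_eq _ _ _ _ (fun x => f (cinv c (cmap c (F x))))) => //.
  by move=> y [_ yc]; rewrite cmapK.
apply: (Ck_comp (U' := cimg c) (f := fun u => f (cinv c u)) (g := fun x => cmap c (F x))) => //.
- exact: findim_rV.
- exact: findim_R.
- exact: cimg_open.
- by move=> y [_]; exact: cimg_cmap.
- exact: sf.
- exact: (smooth_into_chart sF cA k).
Qed.

Lemma smooth_fun_comp (f : G -> R) (phi : G -> G) : smooth_fun f ->
  smooth_endo phi -> smooth_fun (f \o phi).
Proof.
move=> sf sp c cA.
exact: (smooth_fun_into (cimgO c) sf (sp c cA)).
Qed.

Lemma smooth_fun_cst (r : R) : @smooth_fun R n G (fun=> r).
Proof. by move=> c _ k; exact: Ck_cst. Qed.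

Lemma smooth_funD (f g : G -> R) : smooth_fun f -> smooth_fun g ->
  smooth_fun (fun x => f x + g x).
Proof. by move=> sf sg c cA k; apply: CkD; [exact: cimg_open|exact: sf|exact: sg]. Qed.

Lemma smooth_funM (f g : G -> R) : smooth_fun f -> smooth_fun g ->
  smooth_fun (fun x => f x * g x).
Proof. by move=> sf sg c cA k; apply: CkM; [exact: cimg_open|exact: sf|exact: sg]. Qed.

Lemma smooth_fun_sum (I : Type) (s : seq I) (f : I -> G -> R) :
  (forall i, smooth_fun (f i)) -> smooth_fun (fun x => \sum_(i <- s) f i x).
Proof. by move=> sf c cA k; apply: Ck_sum => [|i]; [exact: cimg_open|exact: sf]. Qed.

Lemma smooth_fun_continuous (f : G -> R) : smooth_fun f -> continuous f.
Proof.
move=> sf x; have [c cA cx] := atlas_cover x.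
have H : {for x, continuous (fun y => f (cinv c (cmap c y)))}.
  apply: (@continuous_comp _ _ _ (cmap c) (fun u => f (cinv c u))).
    exact: cmap_continuous.
  by apply: (Cinfty_continuous (sf c cA)); exact: cimg_cmap.
move: H; rewrite /prop_for /continuous_at cmapK//; apply: cvg_trans; apply: near_eq_cvg.
by apply: filterS (open_near (cdom_open c) cx) => y cy; rewrite cmapK.
Qed.

Lemma mulG_continuous (x y : G) :
  (fun p : G * G => (p.1 * p.2)%g) p @[p --> (x, y)] --> (x * y)%g.
Proof.
have [c1 c1A c1x] := atlas_cover x; have [c2 c2A c2x] := atlas_cover y.
have [H _] := mul_smooth c1 c2 c1A c2A.
have := H (cmap c1 x, cmap c2 y) (Logic.conj (cimg_cmap c1x) (cimg_cmap c2x)).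
rewrite /prop_for /continuous_at /= !cmapK// => {}H.
have K : (fun p : G * G => (cmap c1 p.1, cmap c2 p.2)) p @[p --> (x, y)] -->
    (cmap c1 x, cmap c2 y).
  apply: (@cvg_pair _ _ _ (nbhs (x, y)) (nbhs (cmap c1 x)) (nbhs (cmap c2 y)) _ _ _
    (fun p => cmap c1 p.1) (fun p => cmap c2 p.2)).
    apply: (@cvg_comp _ _ _ fst (cmap c1) _ (nbhs x)); first exact: cvg_fst.
    exact: cmap_continuous.
  apply: (@cvg_comp _ _ _ snd (cmap c2) _ (nbhs y)); first exact: cvg_snd.
  exact: cmap_continuous.
have := cvg_comp _ _ K H; apply: cvg_trans; apply: near_eq_cvg.
have n1 : \forall p \near (x, y), cdom c1 p.1.
  by apply: (@cvg_fst _ _ (nbhs x) (nbhs y)); exact: (open_near (cdom_open c1) c1x).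
have n2 : \forall p \near (x, y), cdom c2 p.2.
  by apply: (@cvg_snd _ _ (nbhs x) (nbhs y)); exact: (open_near (cdom_open c2) c2x).
by apply: filterS2 n1 n2 => -[a b] /= ca cb; rewrite !cmapK.
Qed.

Lemma mull_continuous (g : G) : continuous (fun x : G => g * x)%g.
Proof.
move=> x; apply: (@cvg_comp _ _ _ (fun x => (g, x)) (fun p : G * G => p.1 * p.2)%g _ (nbhs (g, x))).
  by apply: cvg_pair; [exact: cvg_cst|exact: cvg_id].
exact: mulG_continuous.
Qed.

(* phi, a function of the chart coordinate supported in a ball whose closure
   lies in the chart, extended by 0 to the whole group *)
Definition extend0 c (phi : 'rV[R]_n.+1 -> R) (x : G) : R :=
  if pselect (cdom c x) then phi (cmap c x) else 0.

(** At a point outside the chart domain: the closed ball maps onto a compact set, which is closed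
    because the group is Hausdorff, and which misses the point; on its complement the extension is
    identically 0. *)
Lemma extend0_smooth c (phi : 'rV[R]_n.+1 -> R) u0 d : atlas c ->
  (forall u, `|u - u0| <= d -> cimg c u) ->
  (forall u, d < `|u - u0| -> phi u = 0) ->
  Cinfty phi (cimg c) -> smooth_fun (extend0 c phi).
Proof.
move=> cA dc phi0 phiC c' c'A k; apply: Ck_loc => u' cu'.
have [sc _] := cinv_smooth c cA.
have s' := cinv_smooth c' c'A.
have [cx|ncx] := pselect (cdom c (cinv c' u')).
  exists (cimg c' `&` cinv c' @^-1` cdom c); split=> //.
  have oU := smooth_into_open (cimgO c') (cdom_open c) s'.
  apply: (@Ck_eq _ _ _ _ (fun u => phi (cmap c (cinv c' u)))) => //.
    by move=> y [_ yc]; rewrite /extend0; case: pselect.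
  apply: (Ck_comp (U' := cimg c) (f := phi) (g := fun u => cmap c (cinv c' u))) => //.
  - exact: findim_rV.
  - exact: findim_R.
  - exact: cimg_open.
  - by move=> y [_]; exact: cimg_cmap.
  - exact: (smooth_into_chart s' cA k).
pose B : set 'rV[R]_n.+1 := closed_ball_ (@Num.Def.normr R _) u0 d.
have BE u : B u = (`|u - u0| <= d) :> Prop.
  by rewrite /B /closed_ball_ /= distrC.
have cB : compact B.
  apply: bounded_closed_compact.
    exists (`|u0| + d); split; first exact: num_real.
    move=> M HM u /=; rewrite BE => Bu; apply: le_trans (ltW HM).
    by rewrite -[u](subrK u0) addrC; apply: le_trans (ler_normD _ _) _; rewrite lerD2l.
  exact: closed_closed_ball_.
have cK : closed (cinv c @` B).
  apply: compact_closed; first exact: lie_hausdorff.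
  apply: continuous_compact => //.
  by apply: continuous_in_subspaceT => u /set_mem; rewrite BE => /dc; exact: sc.
have nx : ~ (cinv c @` B) (cinv c' u').
  by move=> [u Bu E]; apply: ncx; rewrite -E; apply: cdom_cinv; apply: dc; rewrite -BE.
exists (cimg c' `&` cinv c' @^-1` ~` (cinv c @` B)); split=> //.
have oU := smooth_into_open (cimgO c') (closed_openC cK) s'.
apply: (@Ck_eq _ _ _ _ (fun=> 0 : R)) => //; last exact: Ck_cst.
move=> u [cu Bu]; rewrite /extend0; case: pselect => // ccu.
rewrite phi0// ltNge; apply/negP => H; apply: Bu.
by exists (cmap c (cinv c' u)); rewrite ?cmapK// BE.
Qed.

End GroupCalculus.

(** * The Lie algebra in a chart at the identity *)

Lemma atlas_at1 (R : realType) (n : nat) (G : lieGroupType R n) :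
  exists2 c : chart R n G, atlas c & cdom c 1%g.
Proof. exact: atlas_cover. Qed.

Section ChartAtOne.
Context {R : realType} {n : nat} {G : lieGroupType R n}.

Local Notation E := 'rV[R]_n.+1.

Definition chart1 : chart R n G := s2val (cid2 (atlas_at1 G)).

Lemma chart1A : atlas chart1.
Proof. exact: (s2valP (cid2 (atlas_at1 G))). Qed.

Lemma chart1_dom : cdom chart1 1%g.
Proof. exact: (s2valP' (cid2 (atlas_at1 G))). Qed.

(** Translating the chart so that the identity has coordinate 0 lets products, exponentials and
    linear estimates all be expanded at the origin. *)
Definition iota (u : E) : G := cinv chart1 (cmap chart1 1%g + u).

Definition kappa (x : G) : E := cmap chart1 x - cmap chart1 1%g.

Definition Dom : set E := [set u | cimg chart1 (cmap chart1 1%g + u)].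

Lemma DomO : open Dom.
Proof.
rewrite /Dom -[X in open X]setTI; apply: open_preimage; [exact: openT|exact: cimgO|].
by move=> x _; apply: continuousD; [exact: cst_continuous|exact: cvg_id].
Qed.

Lemma Dom0 : Dom 0.
Proof. by rewrite /Dom /= addr0; apply: cimg_cmap; exact: chart1_dom. Qed.

Lemma iota0 : iota 0 = 1%g.
Proof. by rewrite /iota addr0 cmapK//; exact: chart1_dom. Qed.

Lemma kappa1 : kappa 1%g = 0.
Proof. by rewrite /kappa subrr. Qed.

Lemma kappaK x : cdom chart1 x -> iota (kappa x) = x.
Proof. by move=> cx; rewrite /iota /kappa addrC subrK cmapK. Qed.

Lemma iotaK u : Dom u -> kappa (iota u) = u.
Proof. by move=> du; rewrite /kappa /iota cinvK// addrC addKr. Qed.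

Lemma cdom_iota u : Dom u -> cdom chart1 (iota u).
Proof. exact: cdom_cinv. Qed.

Lemma Dom_kappa x : cdom chart1 x -> Dom (kappa x).
Proof. by move=> cx; rewrite /Dom /kappa /= addrC subrK; exact: cimg_cmap. Qed.

Lemma smooth_iota : smooth_into (@atlas R n G) iota Dom.
Proof.
apply: (@smooth_into_comp _ _ _ _ _ _ (cinv chart1) (fun u => cmap chart1 1%g + u) _
  (cimg chart1)).
- exact: findim_rV.
- exact: DomO.
- exact: cimgO.
- by [].
- by move=> k; apply: CkD; [exact: DomO|exact: Ck_cst|exact: Ck_id DomO].
- by apply: cinv_smooth; exact: chart1A.
Qed.

Lemma smooth_kappa (V : normedModType R) (F : V -> G) U : open U ->
  smooth_into (@atlas R n G) F U ->
  Cinfty (fun x => kappa (F x)) (U `&` F @^-1` cdom chart1).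
Proof.
move=> oU sF k.
have oU' := smooth_into_open oU (cdom_open chart1) sF.
apply: CkB => //; last exact: Ck_cst.
exact: (smooth_into_chart sF chart1A k).
Qed.

Lemma kappa_continuous x : cdom chart1 x -> {for x, continuous kappa}.
Proof.
move=> cx; apply: (@continuousB _ _ _ (cmap chart1)); last exact: cst_continuous.
exact: cmap_continuous.
Qed.

Lemma iota_continuous u : Dom u -> {for u, continuous iota}.
Proof. by have [H _] := smooth_iota; exact: H. Qed.

Lemma smooth_fun_iota (f : G -> R) : smooth_fun f -> Cinfty (fun u => f (iota u)) Dom.
Proof. by move=> sf; apply: smooth_fun_into (DomO) sf smooth_iota. Qed.

Lemma Dom_ball : exists2 r : R, 0 < r & forall u, `|u| <= r -> Dom u.
Proof.
have /nbhs_ballP[r /= r0 Hr] := open_near DomO Dom0.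
exists (r / 2); first by rewrite divr_gt0.
move=> u ur; apply: Hr; rewrite -ball_normE /= sub0r normrN.
by apply: le_lt_trans ur _; rewrite ltr_pdivrMr// ltr_pMr// ltr1n.
Qed.

Definition rad : R := s2val (cid2 Dom_ball).

Lemma rad_gt0 : 0 < rad.
Proof. exact: (s2valP (cid2 Dom_ball)). Qed.

Lemma rad_Dom u : `|u| <= rad -> Dom u.
Proof. exact: (s2valP' (cid2 Dom_ball)). Qed.

Lemma half_rad_gt0 : 0 < rad / 2.
Proof. by rewrite divr_gt0// rad_gt0. Qed.

Definition bump : E -> R := sval (cid (smooth_bump 0 half_rad_gt0)).

Lemma bumpP : [/\ Cinfty bump setT, bump 0 = 1 & forall x, rad / 2 <= `|x| -> bump x = 0].
Proof.
have := svalP (cid (smooth_bump (0 : E) half_rad_gt0)); rewrite -/bump => -[b1 b2 b3].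
by split=> // x xr; apply: b3; rewrite subr0.
Qed.

(** Elements of [lie_algebra] act on globally defined smooth functions, so a function of the chart
    coordinate is cut off by [bump] and extended by 0. *)
Definition lift (phi : E -> R) (x : G) : R :=
  if pselect (cdom chart1 x) then bump (kappa x) * phi (kappa x) else 0.

Lemma bumpM_smooth (phi : E -> R) : Cinfty phi (ball 0 rad) ->
  Cinfty (fun u => bump u * phi u) setT.
Proof.
have [b1 b2 b3] := bumpP.
move=> phiC k; apply: Ck_loc => u _.
have [ur|ur] := ltP `|u| rad.
  exists (ball 0 rad); split; first by rewrite -ball_normE /= sub0r normrN.
  apply: CkM; [exact: ball_open|by apply: Ck_sub (b1 k)|exact: phiC].
exists (~` closed_ball_ (@Num.Def.normr R E) 0 (rad / 2)); split.
  rewrite /closed_ball_ /= sub0r normrN; apply/negP; rewrite -ltNge.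
  by apply: lt_le_trans ur; rewrite ltr_pdivrMr// ltr_pMr ?ltr1n// rad_gt0.
apply: (@Ck_eq _ _ _ _ (fun=> 0 : R)); last exact: Ck_cst.
  by apply: closed_openC; exact: closed_closed_ball_.
move=> y; rewrite /closed_ball_ /= sub0r normrN => /negP; rewrite -ltNge => /ltW/b3 ->.
by rewrite mul0r.
Qed.

Lemma lift_smooth (phi : E -> R) : Cinfty phi (ball 0 rad) -> smooth_fun (lift phi).
Proof.
move=> phiC; have [b1 b2 b3] := bumpP.
pose psi u := bump u * phi u.
have -> : lift phi = extend0 chart1 (fun u => psi (u - cmap chart1 1%g)).
  by apply/funext => x.
apply: (@extend0_smooth _ _ _ _ _ (cmap chart1 1%g) rad).
- exact: chart1A.
- by move=> u /rad_Dom; rewrite /Dom /= addrC subrK.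
- move=> u ur; rewrite /psi b3 ?mul0r//; apply: le_trans (ltW ur).
  by rewrite ler_pdivrMr// ler_pMr ?ler1n// rad_gt0.
move=> k.
apply: (Ck_comp (U' := setT) (f := psi) (g := fun u => u - cmap chart1 1%g)) => //.
- exact: findim_rV.
- exact: findim_R.
- exact: cimgO.
- exact: openT.
- exact: bumpM_smooth.
- by apply: CkB; [exact: cimgO|exact: Ck_id (cimgO _)|exact: Ck_cst].
Qed.

Lemma lift1 (phi : E -> R) : lift phi 1%g = phi 0.
Proof.
rewrite /lift; case: pselect => [?|nc] /=; last by have := nc chart1_dom.
by have [_ b0 _] := bumpP; rewrite kappa1 b0 mul1r.
Qed.

Lemma lift_iota (phi : E -> R) u : Dom u -> lift phi (iota u) = bump u * phi u.
Proof.
move=> du; rewrite /lift; case: pselect => [?|nc] /=; last by have := nc (cdom_iota du).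
by rewrite iotaK.
Qed.

Definition coordf (i : 'I_n.+1) : G -> R := lift (fun u => u 0 i).

Lemma coordf_smooth i : smooth_fun (coordf i).
Proof. by apply: lift_smooth => k; apply: Ck_coord; exact: ball_open. Qed.

End ChartAtOne.
Arguments chart1 {R n} G.
Arguments Dom {R n} G _.
Arguments rad {R n} G.
Arguments bump {R n} G _.
Arguments coordf {R n} G _ _.
Arguments Dom0 {R n} G.
Arguments DomO {R n} G.
Arguments bumpP {R n} G.

Lemma derive_pair (R : realType) (V A B : normedModType R) (f : V -> A) (g : V -> B) x v :
  differentiable f x -> differentiable g x ->
  'D_v (fun y => (f y, g y)) x = ('D_v f x, 'D_v g x).
Proof.
move=> df dg; rewrite [LHS]deriveE; last exact: differentiable_pair.
by rewrite diff_pair// [in RHS]deriveE// deriveE.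
Qed.

Lemma derive_coord (R : realType) m (i : 'I_m) (x v : 'rV[R]_m) :
  'D_v (fun u : 'rV[R]_m => u 0 i) x = v 0 i.
Proof.
have [l [[lc _] lE]] := @rV_frame R m.
have -> : (fun u : 'rV[R]_m => u 0 i) = l i by apply/funext => u; rewrite lE.
have did : differentiable (fun u : 'rV[R]_m => u) x by exact: ex_diff.
have := derive_post v (lc i) did.
by rewrite derive_id lE.
Qed.

Lemma deriveMc (R : realType) (V : normedModType R) (f : V -> R) (r : R) x v :
  differentiable f x -> 'D_v (fun y => r * f y) x = r * 'D_v f x.
Proof. by move=> df; apply: deriveZ; exact: diff_derivable. Qed.

(** * Identification of the Lie algebra with row vectors *)

Section LieAlgebraCoordinates.
Context {R : realType} {n : nat} {G : lieGroupType R n}.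

Local Notation E := 'rV[R]_n.+1.
Implicit Types (X Y : vfield G) (f : G -> R).

(** The left-invariant field whose value at 1 is the chart vector v. Together with [co], its inverse
    on [lie_algebra], it carries linear algebra on row vectors over to the Lie algebra. *)
Definition vf (v : E) : vfield G := fun f =>
  if pselect (smooth_fun f) then (fun x => 'D_v (fun u => f (x * iota u)%g) 0)
  else (fun=> 0).

Definition co X : E := \row_i X (coordf G i) 1%g.

Lemma vfE v f x : smooth_fun f -> vf v f x = 'D_v (fun u => f (x * iota u)%g) 0.
Proof. by move=> sf; rewrite /vf; case: pselect. Qed.

Lemma vf_non v f : ~ smooth_fun f -> vf v f = (fun=> 0).
Proof. by move=> sf; rewrite /vf; case: pselect. Qed.

Lemma smooth_fun_mull f g : smooth_fun f -> smooth_fun (fun x => f (g * x)%g).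
Proof. by move=> sf; apply: (smooth_fun_comp sf); exact: smooth_endo_mull. Qed.

Lemma smooth_fun_mulr f g : smooth_fun f -> smooth_fun (fun x => f (x * g)%g).
Proof. by move=> sf; apply: (smooth_fun_comp sf); exact: smooth_endo_mulr. Qed.

Lemma mull_iota_differentiable f x : smooth_fun f ->
  differentiable (fun u => f (x * iota u)%g) 0.
Proof.
move=> /(smooth_fun_mull x)/smooth_fun_iota/Cinfty_differentiable; apply.
exact: Dom0.
Qed.

Lemma vf_linear (r : R) v w : vf (r *: v + w) = r *: vf v + vf w.
Proof.
apply/funext => f; apply/funext => x.
have [sf|nsf] := pselect (smooth_fun f).
  rewrite vfE// derive_lin; last exact: mull_iota_differentiable.
  by rewrite -!vfE.
rewrite vf_non// -[RHS]/(r *: vf v f x + vf w f x) !vf_non//.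
by rewrite scaler0 addr0.
Qed.

Lemma vf_smooth v f : smooth_fun f -> smooth_fun (vf v f).
Proof.
move=> sf c cA.
have -> : (fun u => vf v f (cinv c u)) =
    (fun u => 'D_v (fun w => f (cinv c u * iota w)%g) 0).
  by apply/funext => u; rewrite vfE.
(* The field is a partial derivative, at second argument 0, of a jointly smooth function, which
   gives smoothness in u. *)
pose H (p : E * E) := f (cinv c p.1 * iota p.2)%g.
have oD : open (cimg c `*` (Dom G)) by apply: (@open_setX E E); [exact: cimgO|exact: DomO].
have HC : Cinfty H (cimg c `*` (Dom G)).
  apply: smooth_fun_into => //; apply: smooth_mul => //.
    apply: (@smooth_into_comp _ _ _ _ _ _ (cinv c) fst _ (cimg c)) => //.
    - exact: findim_rV.
    - exact: cimgO.
    - by move=> p [].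
    - by move=> k; apply: Ck_fst => //; exact: Ck_id.
    - exact: cinv_smooth.
  apply: (@smooth_into_comp _ _ _ _ _ _ iota snd _ (Dom G)) => //.
  - exact: findim_rV.
  - exact: DomO.
  - by move=> p [].
  - by move=> k; apply: Ck_snd => //; exact: Ck_id.
  - exact: smooth_iota.
have E1 u : cimg c u -> 'D_v (fun w => f (cinv c u * iota w)%g) 0 = 'D_((0 : E), v) H (u, 0).
  move=> cu; have dH : differentiable H (u, 0).
    by apply: (Cinfty_differentiable HC); split=> //; exact: Dom0.
  have di : differentiable (fun w : E => (u, w)) 0.
    by apply: differentiable_pair.
  have := derive_comp v di dH; rewrite /H /= => ->; congr ('D_ _ _ _).
  have dc : differentiable (fun w : E => u) 0 by exact: differentiable_cst.
  have did : differentiable (fun w : E => w) 0 by exact: ex_diff.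
  by rewrite (derive_pair v dc did) derive_cst derive_id.
move=> k; apply: (@Ck_eq _ _ _ _ (fun u => 'D_((0 : E), v) H (u, 0))).
- exact: cimgO.
- by move=> u cu; rewrite E1.
apply: (Ck_comp (U' := cimg c `*` (Dom G)) (f := fun p => 'D_((0 : E), v) H p)
  (g := fun u : E => (u, 0 : E))) => //.
- by apply: findim_prod; exact: findim_rV.
- exact: findim_R.
- exact: cimgO.
- by move=> u cu; split=> //; exact: Dom0.
- exact: (Cinfty_derive _ HC).
- by apply: Ck_pair; [exact: cimgO|apply: Ck_id; exact: cimgO|exact: Ck_cst].
Qed.

Lemma vf_lie v : lie_algebra G (vf v).
Proof.
split.
- exact: vf_non.
- exact: vf_smooth.
- move=> r f1 f2 s1 s2; apply/funext => x.
  have s12 : smooth_fun (fun x => r * f1 x + f2 x).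
    apply: smooth_funD => //; apply: smooth_funM => //; exact: smooth_fun_cst.
  have d1 := mull_iota_differentiable x s1; have d2 := mull_iota_differentiable x s2.
  rewrite !vfE// deriveD; last 2 first.
  + by apply: diff_derivable; apply: differentiableM.
  + exact: diff_derivable.
  by rewrite deriveMc.
- move=> f1 f2 s1 s2; apply/funext => x.
  have s12 : smooth_fun (fun x => f1 x * f2 x) by exact: smooth_funM.
  have d1 := mull_iota_differentiable x s1; have d2 := mull_iota_differentiable x s2.
  rewrite !vfE// deriveM; [|exact: diff_derivable..].
  by rewrite iota0 mulg1 [X in _ + X]mulrC.
- move=> g f sf; apply/funext => x; rewrite !vfE//; last exact: smooth_fun_mull.
  by congr ('D_v _ 0); apply/funext => u; rewrite mulgA.
Qed.

Section Derivation.
Context (X : vfield G).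
Context (XL : lie_algebra G X).

Lemma lie_transl f x : smooth_fun f -> X f x = X (fun y => f (x * y)%g) 1%g.
Proof. by case: XL => _ _ _ _ /(_ x f)H /H ->; rewrite mulg1. Qed.

Lemma lie_cst r : X (fun=> r) = (fun=> 0).
Proof.
case: XL => _ _ lin leib _.
have s1 : @smooth_fun R n G (fun=> 1) by exact: smooth_fun_cst.
have H1 : X (fun=> 1) = (fun=> 0).
  have := leib _ _ s1 s1; rewrite mulr1 => H; apply/funext => x.
  by have := congr1 (@^~ x) H; rewrite mul1r mulr1 => /eqP; rewrite eq_sym -subr_eq0 addrK => /eqP.
have s0 : @smooth_fun R n G (fun=> 0) by exact: smooth_fun_cst.
have H0 : X (fun=> 0) = (fun=> 0).
  have := lin (- 1) _ _ s0 s0; rewrite mulr0 addr0 => ->.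
  by apply/funext => x; rewrite mulN1r addNr.
have := lin r _ _ s1 s0; rewrite mulr1 addr0 => ->.
by rewrite H1 H0; apply/funext => x; rewrite mulr0 addr0.
Qed.

Lemma lie_sum (I : Type) (s : seq I) (f : I -> G -> R) x :
  (forall i, smooth_fun (f i)) ->
  X (fun x => \sum_(i <- s) f i x) x = \sum_(i <- s) X (f i) x.
Proof.
move=> sf; case: XL => _ _ lin _ _; elim: s => [|i s IH].
  rewrite big_nil (_ : (fun y => _) = fun=> 0) ?lie_cst//.
  by apply/funext => y; rewrite big_nil.
rewrite big_cons -IH.
have := lin 1 _ _ (sf i) (smooth_fun_sum s sf) => /(congr1 (@^~ x)).
rewrite mul1r => <-; congr (X _ _); apply/funext => y.
by rewrite big_cons mul1r.
Qed.

End Derivation.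

(* Hadamard's lemma: a derivation at 1 only sees the first order Taylor
   coefficients in the chart. *)
Lemma lie_taylor f : smooth_fun f -> exists g : 'I_n.+1 -> R,
  forall X, lie_algebra G X -> X f 1%g = \sum_i co X 0 i * g i.
Proof.
move=> sf; have fC := smooth_fun_iota sf.
have [l [le lE]] := @rV_frame R n.+1.
have inball (u : E) : (ball 0 (rad G) u : Prop) = (`|u| < (rad G)).
  by rewrite -ball_normE /= sub0r normrN.
have fB : Cinfty (fun u => f (iota u)) (ball 0 (rad G)).
  by move=> k; apply: Ck_sub (fC k) => u; rewrite inball => /ltW; exact: rad_Dom.
have [g [gC gE]] := hadamard le fB.
have [b1 b2 b3] := bumpP G.
exists (fun i => g i 0) => X XL; have [_ _ lin leib _] := XL.
pose A : G -> R := lift (fun=> 1).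
have sA : smooth_fun A by apply: lift_smooth => k; exact: Ck_cst.
have sg i : smooth_fun (lift (G := G) (g i)) by apply: lift_smooth; exact: gC.
have sAA : smooth_fun (fun x => A x * A x) by apply: smooth_funM.
have sc : @smooth_fun R n G (fun=> - f 1%g) by exact: smooth_fun_cst.
have sf1 : smooth_fun (fun x => 1 * f x + - f 1%g).
  apply: smooth_funD => //; apply: smooth_funM => //; exact: smooth_fun_cst.
have sP := smooth_funM sf1 sAA.
(* The expansion of f holds in the chart only. Multiplied by the square of the cutoff it becomes a
   global identity, since [coordf] and [lift] each bring one factor [bump]. At 1 the cutoff is 1 and
   [f - f 1] is 0, so no derivative of the cutoff survives. *)
have PQ : (fun x => (1 * f x + - f 1%g) * (A x * A x)) =
    (fun x => \sum_i coordf G i x * lift (g i) x).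
  apply/funext => x; rewrite /coordf /A /lift; case: pselect => [cx|ncx]; last first.
    by rewrite mulr0 mulr0 big1// => i _; rewrite mul0r.
  rewrite !mulr1; have [ur|ur] := ltP `|kappa x| (rad G); last first.
    rewrite b3 ?mulr0; last first.
      by apply: le_trans ur; rewrite ler_pdivrMr// ler_pMr ?ler1n// rad_gt0.
    by rewrite big1// => i _ /=; rewrite !mul0r.
  have := gE (kappa x); rewrite inball => /(_ ur); rewrite kappaK// iota0 mul1r => ->.
  rewrite addrC addKr mulr_suml; apply: eq_bigr => i _.
  by rewrite lE subr0 /=; ring.
have := congr1 (fun h => X h 1%g) PQ; rewrite leib// lie_sum//; last first.
  by move=> i; apply: smooth_funM => //; exact: coordf_smooth.
rewrite lin// (lie_cst XL) addr0 mul1r.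
have -> : A 1%g = 1 by rewrite /A lift1.
rewrite !mulr1 mul1r subrr mul0r add0r => ->.
apply: eq_bigr => i _; rewrite leib//; last exact: coordf_smooth.
by rewrite /coordf !lift1 !mxE mul0r add0r.
Qed.

Lemma co_vf v : co (vf v) = v.
Proof.
have [b1 b2 b3] := bumpP G.
apply/rowP => i; rewrite mxE vfE; last exact: coordf_smooth.
have H : \forall u \near (0 : E), (fun u : E => (bump G) u * u 0 i) u
    = coordf G i (1 * iota u)%g.
  by apply: filterS (open_near (DomO G) (Dom0 G)) => u du; rewrite mul1g /coordf lift_iota.
rewrite -(near_eq_derive _ H) deriveM; last 2 first.
- by apply: diff_derivable; apply: (Cinfty_differentiable b1).
- by apply: diff_derivable; exact: differentiable_coord.
rewrite b2 mxE [(0 : R) *: _]scale0r addr0 scale1r.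
by rewrite derive_coord.
Qed.

Lemma lie_vf X : lie_algebra G X -> X = vf (co X).
Proof.
move=> XL; apply/funext => f; have [N _ _ _ _] := XL.
have [sf|nsf] := pselect (smooth_fun f); last by rewrite N// vf_non.
apply/funext => x; rewrite (lie_transl XL)// (lie_transl (vf_lie _))//.
have [g Hg] := lie_taylor (smooth_fun_mull x sf).
by rewrite !Hg//; [rewrite co_vf|exact: vf_lie].
Qed.

Lemma co_linear (r : R) X Y : co (r *: X + Y) = r *: co X + co Y.
Proof. by apply/rowP => i; rewrite !mxE. Qed.

Lemma lie_combo (r : R) X Y : lie_algebra G X -> lie_algebra G Y ->
  lie_algebra G (r *: X + Y).
Proof. by move=> /lie_vf -> /lie_vf ->; rewrite -vf_linear; exact: vf_lie. Qed.

Lemma vf0 : vf 0 = 0.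
Proof.
by have := vf_linear (- 1) 0 0; rewrite scaler0 addr0 scaleN1r addNr.
Qed.

Lemma lie0 : lie_algebra G 0.
Proof. by rewrite -vf0; exact: vf_lie. Qed.

Lemma lieD X Y : lie_algebra G X -> lie_algebra G Y -> lie_algebra G (X + Y).
Proof. by move=> XL YL; rewrite -[X]scale1r; exact: lie_combo. Qed.

Lemma lieZ r X : lie_algebra G X -> lie_algebra G (r *: X).
Proof. by move=> XL; rewrite -[_ *: _]addr0; apply: lie_combo => //; exact: lie0. Qed.

Lemma lieN X : lie_algebra G X -> lie_algebra G (- X).
Proof. by rewrite -scaleN1r; exact: lieZ. Qed.

Lemma lieB X Y : lie_algebra G X -> lie_algebra G Y -> lie_algebra G (X - Y).
Proof. by move=> XL YL; apply: lieD => //; exact: lieN. Qed.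

Lemma lie_sum_mem (I : Type) (s : seq I) (F : I -> vfield G) :
  (forall i, lie_algebra G (F i)) -> lie_algebra G (\sum_(i <- s) F i).
Proof.
move=> H; elim/big_ind: _ => //; [exact: lie0|exact: lieD].
Qed.

Lemma lie_bracket X Y : lie_algebra G X -> lie_algebra G Y ->
  lie_algebra G (bracket X Y).
Proof.
move=> [X1 X2 X3 X4 X5] [Y1 Y2 Y3 Y4 Y5]; rewrite /bracket.
have s0 : @smooth_fun R n G (fun=> 0) by exact: smooth_fun_cst.
split.
- move=> f nf; apply/funext => x; rewrite (X1 _ nf) (Y1 _ nf).
  by rewrite (lie_cst (And5 X1 X2 X3 X4 X5)) (lie_cst (And5 Y1 Y2 Y3 Y4 Y5)) subrr.
- move=> f sf; have := smooth_funD (X2 _ (Y2 _ sf))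
    (smooth_funM (smooth_fun_cst (- 1)) (Y2 _ (X2 _ sf))).
  by congr (smooth_fun _); apply/funext => x; rewrite mulN1r.
- move=> r f1 f2 s1 s2; apply/funext => x.
  rewrite X3// Y3// X3//; [|exact: Y2..]; rewrite Y3//; [|exact: X2..].
  by ring.
- move=> f1 f2 s1 s2; apply/funext => x.
  have XD f g : smooth_fun f -> smooth_fun g ->
      X (fun x => f x + g x) = (fun x => X f x + X g x).
    move=> sf sg; have := X3 1 f g sf sg; rewrite (_ : (fun x => 1 * f x + g x) = (fun x => f x + g x)).
      by move=> ->; apply/funext => y; rewrite mul1r.
    by apply/funext => y; rewrite mul1r.
  have YD f g : smooth_fun f -> smooth_fun g ->
      Y (fun x => f x + g x) = (fun x => Y f x + Y g x).
    move=> sf sg; have := Y3 1 f g sf sg; rewrite (_ : (fun x => 1 * f x + g x) = (fun x => f x + g x)).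
      by move=> ->; apply/funext => y; rewrite mul1r.
    by apply/funext => y; rewrite mul1r.
  have sm f g := @smooth_funM R n G f g.
  rewrite X4// Y4// XD; [|by apply: sm => //; exact: Y2..].
  rewrite YD; [|by apply: sm => //; exact: X2..].
  rewrite !X4//; [|exact: Y2..]; rewrite !Y4//; [|exact: X2..].
  by ring.
- move=> g f sf; apply/funext => x; rewrite X5// Y5//.
  by rewrite X5 ?Y5//; [exact: X2|exact: Y2].
Qed.

Lemma bracket_anti X Y : bracket X Y = - bracket Y X.
Proof.
apply/funext => f; apply/funext => x.
by rewrite -[RHS]/(- bracket Y X f x) /bracket opprB.
Qed.

Lemma lie_apply (r : R) X f1 f2 x : lie_algebra G X -> smooth_fun f1 -> smooth_fun f2 ->
  X (fun y => r * f1 y + f2 y) x = r * X f1 x + X f2 x.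
Proof. by case=> _ _ H _ _ s1 s2; rewrite H. Qed.

Lemma lie_smooth X f : lie_algebra G X -> smooth_fun f -> smooth_fun (X f).
Proof. by case=> _ H _ _ _; exact: H. Qed.

Lemma lie_non X f : lie_algebra G X -> ~ smooth_fun f -> X f = (fun=> 0).
Proof. by case=> H _ _ _ _; exact: H. Qed.

Lemma vfield_eq X Y : lie_algebra G X -> lie_algebra G Y ->
  (forall f x, smooth_fun f -> X f x = Y f x) -> X = Y.
Proof.
move=> XL YL H; apply/funext => f.
have [sf|nsf] := pselect (smooth_fun f); last by rewrite !lie_non.
by apply/funext => x; exact: H.
Qed.

Lemma bracket_linearr (r : R) X Y Z : lie_algebra G X -> lie_algebra G Y ->
  lie_algebra G Z -> bracket X (r *: Y + Z) = r *: bracket X Y + bracket X Z.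
Proof.
move=> XL YL ZL; apply: vfield_eq.
- by apply: lie_bracket => //; exact: lie_combo.
- by apply: lie_combo; exact: lie_bracket.
move=> f x sf; rewrite -[RHS]/(r * bracket X Y f x + bracket X Z f x) /bracket.
rewrite -[(r *: Y + Z) (X f) x]/(r * Y (X f) x + Z (X f) x).
rewrite -[(r *: Y + Z) f]/(fun x => r * Y f x + Z f x).
rewrite lie_apply//; [|exact: lie_smooth..].
by ring.
Qed.

Lemma bracket_linearl (r : R) X Y Z : lie_algebra G X -> lie_algebra G Y ->
  lie_algebra G Z -> bracket (r *: Y + Z) X = r *: bracket Y X + bracket Z X.
Proof.
move=> XL YL ZL; rewrite bracket_anti bracket_linearr// (bracket_anti X Y).
by rewrite (bracket_anti X Z) scalerN opprD !opprK.
Qed.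

Lemma jacobi X Y Z : lie_algebra G X -> lie_algebra G Y -> lie_algebra G Z ->
  bracket X (bracket Y Z) = bracket (bracket X Y) Z + bracket Y (bracket X Z).
Proof.
move=> XL YL ZL; apply: vfield_eq.
- by do 2 apply: lie_bracket => //.
- by apply: lieD; do 2 apply: lie_bracket => //.
have sub U f g y : lie_algebra G U -> smooth_fun f -> smooth_fun g ->
    U (fun x => f x - g x) y = U f y - U g y.
  move=> UL sf sg; have := lie_apply (- 1) y UL sg sf.
  rewrite (_ : (fun x => -1 * g x + f x) = (fun x => f x - g x)).
    by move=> ->; ring.
  by apply/funext => x; ring.
move=> f x sf.
rewrite -[RHS]/(bracket (bracket X Y) Z f x + bracket Y (bracket X Z) f x) /bracket.
have sX := lie_smooth XL; have sY := lie_smooth YL; have sZ := lie_smooth ZL.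
rewrite !sub//; try by do 2 (apply: sX || apply: sY || apply: sZ).
by ring.
Qed.

End LieAlgebraCoordinates.

(** * Integral curves *)

Section Curves.
Context {R : realType}.

Lemma ball0E (V : normedModType R) (x : V) r : (ball 0 r x : Prop) = (`|x| < r).
Proof. by rewrite -ball_normE /= sub0r normrN. Qed.

Lemma curve_bound m (c c' : R -> 'rV[R]_m) (w : 'rV[R]_m) (r M s t : R) :
  (forall u : R, `|u| < r -> is_derive u 1 c (c' u)) ->
  (forall u : R, `|u| < r -> `|c' u - w| <= M) ->
  `|s| < r -> `|t| < r -> `|c t - c s - (t - s) *: w| <= M * `|t - s|.
Proof.
move=> dc cM sr tr.
have M0 : 0 <= M by apply: le_trans (cM _ sr).
apply: (@mvt_bound _ _ _ c s t 0 _ r); rewrite ?ball0E//; first by rewrite mulr_ge0.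
move=> u; rewrite ball0E => ur; have [d _] := dc u ur.
split; first exact/derivable1_diffP.
rewrite (derive_real _ (dc u ur)) -scalerBr normrZ mulrC.
by apply: ler_wpM2r => //; exact: cM.
Qed.

Lemma is_derive_diag (H : R * R -> R) (t : R) (a b : R) : differentiable H (t, t) ->
  is_derive t 1 (fun s => H (s, t)) a -> is_derive t 1 (fun s => H (t, s)) b ->
  is_derive t 1 (fun s => H (s, s)) (a + b).
Proof.
move=> dH [_ <-] [_ <-].
have did : differentiable (fun s : R => s) t by exact: ex_diff.
have dct : differentiable (fun s : R => t) t by exact: differentiable_cst.
have d1 := differentiable_pair did did.
have d2 := differentiable_pair did dct.
have d3 := differentiable_pair dct did.
have e1 := derive_comp (1 : R) d1 dH; have e2 := derive_comp (1 : R) d2 dH.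
have e3 := derive_comp (1 : R) d3 dH.
rewrite derive_pair// derive_id in e1.
rewrite derive_pair// derive_id derive_cst in e2.
rewrite derive_pair// derive_id derive_cst in e3.
apply: DeriveDef; first by apply: diff_derivable; exact: (differentiable_comp d1 dH).
rewrite e1 e2 e3 !deriveE// -linearD; congr ('d H _ _).
by congr pair; rewrite /= ?addr0 ?add0r.
Qed.

Lemma is_derive0_cst (h : R -> R) (r : R) :
  (forall t : R, `|t| < r -> is_derive t 1 h 0) ->
  forall t : R, `|t| < r -> h t = h 0.
Proof.
move=> dh t tr; have [|s /andP[/ltW s0 /ltW s1]] := @mvt_segment R R h 0 t.
  move=> s /andP[s0 s1]; rewrite add0r.
  have [|d _] := dh (s *: t); last exact/derivable1_diffP.
  by apply: le_lt_trans tr; rewrite normrZ ger0_norm//; exact: ler_piMl.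
rewrite !add0r => /eqP; rewrite subr_eq => /eqP ->.
rewrite (derive_real t (dh (s *: t) _)) ?scaler0 ?add0r//.
by apply: le_lt_trans tr; rewrite normrZ ger0_norm//; exact: ler_piMl.
Qed.

End Curves.

Section IntegralCurves.
Context {R : realType} {n : nat} {G : lieGroupType R n}.
Local Notation E := 'rV[R]_n.+1.
Local Notation smoothG := (smooth_into (@atlas R n G)).
Implicit Types (X Y : vfield G) (al be : R -> G).

Definition velocity al (t : R) X :=
  forall f, smooth_fun f -> is_derive t 1 (fun s => f (al s)) (X f (al t)).

(** Translating f so that [al t] is moved to x recovers [X f x] for every x from the derivative of
    the curve at the single time t. *)
Lemma velocity_uniq al t X Y : lie_algebra G X -> lie_algebra G Y ->
  velocity al t X -> velocity al t Y -> X = Y.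
Proof.
move=> XL YL vX vY; apply: vfield_eq => // f x sf.
pose h y := f (x * (al t)^-1 * y)%g.
have sh : smooth_fun h by exact: smooth_fun_mull.
have [_ E1] := vX h sh; have [_ E2] := vY h sh.
have EX Z : lie_algebra G Z -> Z h (al t) = Z f x.
  by case=> _ _ _ _ H; rewrite /h H// -mulgA mulVg mulg1.
by rewrite -(EX X)// -(EX Y)// -E1 -E2.
Qed.

(** The lift of the constant 1 forces x into the chart domain with [bump] equal to 1; the coordinate
    functions then force [kappa x = 0]. *)
Lemma separate1 (x : G) : (forall f, smooth_fun f -> f x = f 1%g) -> x = 1%g.
Proof.
move=> H; have [b1 b2 b3] := bumpP G.
have s1 : smooth_fun (lift (G := G) (fun=> 1)).
  by apply: lift_smooth => k; exact: Ck_cst.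
have := H _ s1; rewrite lift1 /lift; case: pselect => [cx|nc] /=; last first.
  by move=> /eqP; rewrite eq_sym oner_eq0.
rewrite mulr1 => bx; rewrite -(kappaK cx); suff -> : kappa x = 0 by rewrite iota0.
apply/rowP => i; have := H _ (coordf_smooth i).
rewrite /coordf lift1 /lift; case: pselect => [?|//] /=.
by rewrite bx mul1r.
Qed.

Lemma curve2_smooth al be r (f : G -> R) : smoothG al (ball 0 r) -> smoothG be (ball 0 r) ->
  smooth_fun f -> Cinfty (fun p : R * R => f (al p.1 * be p.2)%g) (ball 0 r `*` ball 0 r).
Proof.
move=> sa sb sf.
have oB : open (ball (0 : R) r `*` ball (0 : R) r) by apply: (@open_setX R R); exact: ball_open.
apply: smooth_fun_into => //; apply: smooth_mul => //.
  apply: (@smooth_into_comp _ _ _ _ _ _ al fst _ (ball 0 r)) => //.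
  - exact: findim_R.
  - exact: ball_open.
  - by move=> p [].
  - by move=> k; apply: Ck_fst => //; exact: Ck_id.
apply: (@smooth_into_comp _ _ _ _ _ _ be snd _ (ball 0 r)) => //.
- exact: findim_R.
- exact: ball_open.
- by move=> p [].
- by move=> k; apply: Ck_snd => //; exact: Ck_id.
Qed.

Lemma curve_mul_derive al be r (f : G -> R) (t a b : R) : smoothG al (ball 0 r) ->
  smoothG be (ball 0 r) -> smooth_fun f -> `|t| < r ->
  is_derive t 1 (fun s => f (al s * be t)%g) a ->
  is_derive t 1 (fun s => f (al t * be s)%g) b ->
  is_derive t 1 (fun s => f (al s * be s)%g) (a + b).
Proof.
move=> sa sb sf tr da db.
have HC := curve2_smooth sa sb sf.
apply: (@is_derive_diag _ (fun p : R * R => f (al p.1 * be p.2)%g)) => //.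
by apply: (Cinfty_differentiable HC); split; rewrite /= ball0E.
Qed.

(** The quotient [al * be^-1] has zero derivative against every smooth f, and smooth functions
    separate points from 1. *)
Lemma integral_curve_uniq al be r X : lie_algebra G X ->
  smoothG al (ball 0 r) -> smoothG be (ball 0 r) ->
  (forall t : R, `|t| < r -> velocity al t X) ->
  (forall t : R, `|t| < r -> velocity be t X) -> al 0 = be 0 ->
  forall t : R, `|t| < r -> al t = be t.
Proof.
move=> XL sa sb va vb ab0 t tr.
have oB : open (ball (0 : R) r) by exact: ball_open.
have sbV : smoothG (fun t => (be t)^-1)%g (ball 0 r) by exact: smooth_inv.
suff H u : `|u| < r -> (al u * (be u)^-1)%g = 1%g.
  by rewrite -[al t](mulgK (be t)^-1%g) invgK H// mul1g.
move=> ur; apply: separate1 => f sf.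
suff K (s : R) : `|s| < r -> is_derive s 1 (fun s => f (al s * (be s)^-1)%g) 0.
  by rewrite (is_derive0_cst K ur) ab0 mulgV.
move=> sr; set a := al s; set b := be s.
pose f1 := fun x => f (x * b^-1)%g.
have sf1 : smooth_fun f1 by exact: smooth_fun_mulr.
pose f2 := fun x => f1 (a * b^-1 * x)%g.
have sf2 : smooth_fun f2 by exact: smooth_fun_mull.
have d1 := va s sr f1 sf1.
have d2 := vb s sr f2 sf2.
(* e is the contribution of the inverse. No formula for it is derived: the curve
   [a * b^-1 * be u * (be u)^-1] is constant and its derivative is the same sum, so that sum
   vanishes. *)
pose e := 'D_1 (fun u => f (a * (be u)^-1)%g) s.
have dV : is_derive s 1 (fun u => f (a * (be u)^-1)%g) e.
  apply: derivableP; apply/derivable1_diffP.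
  apply: Cinfty_differentiable (_ : ball 0 r s); last by rewrite ball0E.
  exact: (smooth_fun_into oB (smooth_fun_mull a sf) sbV).
have K1 : is_derive s 1 (fun u => f (al u * (be u)^-1)%g) (X f1 a + e).
  exact: (curve_mul_derive sa sbV sf sr d1 dV).
have sc : smoothG (fun u => a * b^-1 * be u)%g (ball 0 r).
  by apply: smooth_mul => //; exact: smooth_into_cst.
have K2 : is_derive s 1 (fun u => f (a * b^-1 * be u * (be u)^-1)%g) (X f2 b + e).
  have ab : (a * b^-1 * be s)%g = a by rewrite -mulgA mulVg mulg1.
  apply: (curve_mul_derive sc sbV sf sr d2).
  by rewrite ab; exact: dV.
have [_ E1] := K2.
have E0 : X f2 b + e = 0.
  rewrite -E1 (_ : (fun u => _) = cst (f (a * b^-1)%g)) ?derive_cst//.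
  by apply/funext => z; rewrite mulgK.
have <- : X f1 a + e = 0.
  by rewrite -E0; congr (_ + e); case: XL => _ _ _ _ ->//; rewrite -mulgA mulVg mulg1.
exact: K1.
Qed.

Definition Pmul (p : E * E) : E := kappa (iota p.1 * iota p.2 : G)%g.

Definition PDom : set (E * E) :=
  (Dom G `*` Dom G) `&` (fun p => iota p.1 * iota p.2 : G)%g @^-1` cdom (chart1 G).

Lemma DomDomO : open (Dom G `*` Dom G).
Proof. by apply: (@open_setX E E); exact: DomO. Qed.

Lemma smooth_iota_mul : smoothG (fun p : E * E => iota p.1 * iota p.2)%g (Dom G `*` Dom G).
Proof.
apply: smooth_mul; first exact: DomDomO.
  apply: (@smooth_into_comp _ _ _ _ _ _ iota fst _ (Dom G)) => //.
  - exact: findim_rV.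
  - exact: DomDomO.
  - exact: DomO.
  - by move=> p [].
  - by move=> k; apply: Ck_fst; [exact: DomDomO|apply: Ck_id; exact: DomDomO].
  - exact: smooth_iota.
apply: (@smooth_into_comp _ _ _ _ _ _ iota snd _ (Dom G)) => //.
- exact: findim_rV.
- exact: DomDomO.
- exact: DomO.
- by move=> p [].
- by move=> k; apply: Ck_snd; [exact: DomDomO|apply: Ck_id; exact: DomDomO].
- exact: smooth_iota.
Qed.

Lemma PDomO : open PDom.
Proof.
exact: smooth_into_open DomDomO (cdom_open _) smooth_iota_mul.
Qed.

Lemma Pmul_smooth : Cinfty Pmul PDom.
Proof. exact: smooth_kappa DomDomO smooth_iota_mul. Qed.

Lemma PDom_r u : Dom G u -> PDom (u, 0).
Proof.
move=> du; split; first by split=> //; exact: Dom0.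
by rewrite /= iota0 mulg1; exact: cdom_iota.
Qed.

Lemma Pmul_r u : Dom G u -> Pmul (u, 0) = u.
Proof. by move=> du; rewrite /Pmul /= iota0 mulg1 iotaK. Qed.

Lemma Pmul_l u : Dom G u -> Pmul (0, u) = u.
Proof. by move=> du; rewrite /Pmul /= iota0 mul1g iotaK. Qed.

Lemma iota_Pmul p : PDom p -> iota (Pmul p) = (iota p.1 * iota p.2 : G)%g.
Proof. by move=> [_ pd]; rewrite /Pmul kappaK. Qed.

(* The left-invariant field vf v read in the chart at 1. *)
Definition Fld (v u : E) : E := 'D_((0 : E), v) Pmul (u, 0).

Lemma Fld_Ck k v : Ck k (Fld v) (Dom G).
Proof.
apply: (Ck_comp (U' := PDom) (f := fun p => 'D_((0 : E), v) Pmul p)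
  (g := fun u : E => (u, 0 : E))).
- by apply: findim_prod; exact: findim_rV.
- exact: findim_rV.
- exact: DomO.
- exact: PDomO.
- exact: PDom_r.
- exact: (Cinfty_derive _ Pmul_smooth).
- by apply: Ck_pair; [exact: DomO|apply: Ck_id; exact: DomO|exact: Ck_cst].
Qed.

Lemma Pmul_diff u : Dom G u -> differentiable Pmul (u, 0).
Proof. by move=> du; apply: (Cinfty_differentiable Pmul_smooth); exact: PDom_r. Qed.

Lemma Fld_linear (r : R) v w u : Dom G u -> Fld (r *: v + w) u = r *: Fld v u + Fld w u.
Proof.
move=> du; rewrite /Fld -derive_lin; last exact: Pmul_diff.
by congr ('D_ _ _ _); congr pair; rewrite /= scaler0 addr0.
Qed.

Lemma derive_inr (W : normedModType R) (H : E * E -> W) u v w :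
  differentiable H (u, w) -> 'D_v (fun y => H (u, y)) w = 'D_((0 : E), v) H (u, w).
Proof.
move=> dH.
have dc : differentiable (fun w : E => u) w by exact: differentiable_cst.
have did : differentiable (fun w : E => w) w by exact: ex_diff.
rewrite (derive_comp v (differentiable_pair dc did) dH).
by rewrite (derive_pair v dc did) derive_cst derive_id.
Qed.

Lemma Fld0 v : Fld v 0 = v.
Proof.
rewrite /Fld -derive_inr; last by apply: Pmul_diff; exact: Dom0.
have H : \forall y \near (0 : E), id y = Pmul (0, y).
  by apply: filterS (open_near (DomO G) (Dom0 G)) => y dy; rewrite Pmul_l.
by rewrite -(near_eq_derive _ H) derive_id.
Qed.

Lemma vf_Fld v (f : G -> R) u : smooth_fun f -> Dom G u ->
  vf v f (iota u) = 'D_(Fld v u) (fun w => f (iota w)) u.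
Proof.
move=> sf du; rewrite vfE//.
have dP := Pmul_diff du.
have dc : differentiable (fun w : E => u) (0 : E) by exact: differentiable_cst.
have did : differentiable (fun w : E => w) (0 : E) by exact: ex_diff.
have dPu : differentiable (fun w => Pmul (u, w)) 0.
  exact: (differentiable_comp (differentiable_pair dc did) dP).
have df : differentiable (fun w => f (iota w)) (Pmul (u, 0)).
  by rewrite Pmul_r//; apply: (Cinfty_differentiable (smooth_fun_iota sf)).
have E1 : 'D_v (fun w => f (iota (Pmul (u, w)))) 0 = 'D_(Fld v u) (fun w => f (iota w)) u.
  rewrite (derive_comp v dPu df) (derive_inr v dP) /Fld.
  by rewrite (Pmul_r du).
rewrite -E1; apply: near_eq_derive.
have oI : \forall p \near (u, 0 : E), PDom p by apply: (open_near PDomO); exact: PDom_r.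
have c : {for (0 : E), continuous (fun w : E => (u, w))}.
  exact: differentiable_continuous (differentiable_pair dc did).
have : \forall w \near (0 : E), PDom (u, w) by exact: c oI.
by apply: filterS => w pw; rewrite iota_Pmul.
Qed.

Lemma rV_sum_norm (v : E) : \sum_i `|v 0 i| <= n.+1%:R * `|v|.
Proof.
apply: le_trans (_ : \sum_(i < n.+1) `|v| <= _).
  by apply: ler_sum => i _; exact: rV_coord_le.
by rewrite sumr_const card_ord mulr_natl.
Qed.

Lemma Fld_sum v u : Dom G u -> Fld v u = \sum_i v 0 i *: Fld (delta_mx 0 i) u.
Proof.
move=> du; rewrite {1}(row_sum_delta v).
have F0 : Fld 0 u = 0.
  by have := Fld_linear (- 1) 0 0 du; rewrite scaler0 addr0 scaleN1r addNr.
elim/big_ind2: _ => //.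
  by move=> _ x2 _ y2 <- <-; rewrite -[x2]scale1r (Fld_linear _ _ _ du) !scale1r.
by move=> i _; rewrite -[_ *: delta_mx 0 i]addr0 (Fld_linear _ _ _ du) F0 addr0.
Qed.

(** The Lipschitz constant has to be proportional to |v|: for small v this makes the field fit for
    Picard iteration and its flow close to that of a constant field. Linearity in v reduces the
    bound to the basis vectors. *)
Lemma Fld_lip : exists C d : R, [/\ 1 <= C, 0 < d <= rad G &
  forall v y z, `|y| <= d -> `|z| <= d -> `|Fld v y - Fld v z| <= C * `|v| * `|y - z|].
Proof.
have H i : exists Cd : R * R, [/\ 1 <= Cd.1, 0 < Cd.2 & forall y z, `|y| <= Cd.2 ->
    `|z| <= Cd.2 -> `|Fld (delta_mx 0 i) y - Fld (delta_mx 0 i) z| <= Cd.1 * `|y - z|].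
  have F1 := Fld_Ck 1 (delta_mx 0 i).
  have [d d0 Hd] := strict_diff (findim_rV _) (DomO G) (Dom0 G) F1 ltr01.
  set L := 'd (Fld (delta_mx 0 i)) (0 : E).
  have Lc : continuous L.
    by apply: diff_continuous; apply: (proj1 F1); exact: Dom0.
  have [k k0 Hk] := linear_lipschitz Lc.
  exists (1 + k, d / 2); split=> /=; [by rewrite lerDl ltW|by rewrite divr_gt0|].
  move=> y z yd zd; rewrite -[_ - Fld _ z](subrK (L (y - z))).
  have d2 : d / 2 < d by rewrite ltr_pdivrMr// ltr_pMr// ltr1n.
  apply: le_trans (ler_normD _ _) _; rewrite mulrDl; apply: lerD; last exact: Hk.
  rewrite -deriveE; last by apply: (proj1 F1); exact: Dom0.
  by apply: Hd; rewrite ball0E; exact: le_lt_trans d2.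
have [Cd HCd] := choice H.
pose C : R := n.+1%:R * (1 + \sum_i (Cd i).1).
pose d := \big[Num.min/rad G]_i (Cd i).2.
have C0 i : 0 <= (Cd i).1 by case: (HCd i) => h _ _; apply: le_trans h.
have S0 : 0 <= \sum_i (Cd i).1 by apply: sumr_ge0.
exists C, d; split.
- have n1 : (1 : R) <= n.+1%:R by rewrite ler1n.
  by apply: le_trans n1 _; rewrite /C ler_peMr// lerDl.
- apply/andP; split; last exact: bigmin_le_id.
  by apply: lt_bigmin; [exact: rad_gt0|move=> i _; case: (HCd i)].
move=> v y z yd zd.
have dle i : d <= (Cd i).2 by exact: bigmin_le_cond.
have dr : d <= rad G by exact: bigmin_le_id.
have dy : Dom G y by apply: rad_Dom; exact: le_trans dr.
have dz : Dom G z by apply: rad_Dom; exact: le_trans dr.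
rewrite !Fld_sum// -sumrB; apply: le_trans (ler_norm_sum _ _ _) _.
apply: le_trans (_ : \sum_i `|v 0 i| * ((1 + \sum_j (Cd j).1) * `|y - z|) <= _).
  apply: ler_sum => i _; rewrite -scalerBr normrZ; apply: ler_wpM2l => //.
  have [_ _ h] := HCd i; apply: le_trans (h y z _ _) _.
  - exact: le_trans (dle i).
  - exact: le_trans (dle i).
  apply: ler_wpM2r => //; rewrite (bigD1 i)//= addrCA lerDl.
  by rewrite addr_ge0// sumr_ge0.
rewrite -mulr_suml /C [X in _ <= X](_ : _ = n.+1%:R * `|v| * ((1 + \sum_j (Cd j).1) * `|y - z|)); last by ring.
apply: ler_wpM2r; last exact: rV_sum_norm.
by rewrite mulr_ge0// addr_ge0.
Qed.

End IntegralCurves.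

Section VectorClamp.
Context {R : realType} {m : nat}.

(** Truncation makes a field that is Lipschitz on a ball Lipschitz everywhere, as Picard iteration
    asks; solutions that stay in the ball do not see it. *)
Definition vclamp (r : R) (u : 'rV[R]_m) : 'rV[R]_m := \row_j clamp r (u 0 j).

Lemma vclamp_id r u : `|u| <= r -> vclamp r u = u.
Proof.
move=> ur; apply/rowP => j; rewrite mxE clamp_id//.
exact: le_trans (rV_coord_le _ _) ur.
Qed.

Lemma vclamp_le r u : 0 <= r -> `|vclamp r u| <= r.
Proof. by move=> r0; apply: rV_norm_le => // j; rewrite mxE clamp_le. Qed.

Lemma vclamp_lip r u v : 0 <= r -> `|vclamp r u - vclamp r v| <= `|u - v|.
Proof.
move=> r0; apply: rV_norm_le => // j; rewrite !mxE.
apply: le_trans (clamp_lip _ _ r0) _.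
by have := rV_coord_le (u - v) j; rewrite !mxE.
Qed.

End VectorClamp.

Section CurveBound.
Context {R : realType} {m : nat}.

Lemma curve_bound0 (c c' : R -> 'rV[R]_m) (w : 'rV[R]_m) (M t : R) : 0 <= t -> 0 <= M ->
  (forall u : R, 0 <= u <= t -> is_derive u 1 c (c' u) /\ `|c' u - w| <= M) ->
  `|c t - c 0 - t *: w| <= M * t.
Proof.
move=> t0 M0 H; apply: rV_norm_le => [|j]; first by rewrite mulr_ge0.
have in0t (s : R) : 0 <= s <= 1 -> 0 <= s * t <= t.
  by move=> /andP[s0 s1]; rewrite mulr_ge0//= ler_piMl.
have dj (s : R) : 0 <= s <= t -> is_derive s 1 (fun s => c s 0 j) (c' s 0 j).
  move=> st; have [[d E] _] := H s st.
  have /derivable_mxP/(_ 0 j) dj := d.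
  by apply: DeriveDef => //; rewrite -E derive_mx// mxE.
have [s s01|s /andP[/ltW s0 /ltW s1]] := @mvt_segment R R (fun s => c s 0 j) 0 t.
  by rewrite add0r; have [d _] := dj _ (in0t _ s01); exact/derivable1_diffP.
have s01 : 0 <= s <= 1 by rewrite s0.
rewrite !add0r !mxE => ->; rewrite (derive_real t (dj _ (in0t _ s01))).
rewrite -[t *: _]/(t * _) -mulrBr normrM ger0_norm// mulrC.
apply: ler_wpM2r => //; have [_] := H _ (in0t _ s01); apply: le_trans.
by have := rV_coord_le (c' (s * t) - w) j; rewrite !mxE.
Qed.

End CurveBound.

(** * Flow of small left-invariant fields *)

Section Flow.
Context {R : realType} {n : nat} {G : lieGroupType R n}.
Local Notation E := 'rV[R]_n.+1.
Local Notation smoothG := (smooth_into (@atlas R n G)).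
Local Notation F := (@Fld R n G).

(* Integral curves through 1 of the fields vf v with v small, in the chart;
   the last clause makes the time-one map strictly differentiable at 0. *)
Lemma flow_exists : exists (dl C : R) (gam : E -> R -> E), [/\ 0 < dl, 0 < C,
  (forall v, `|v| <= dl -> gam v 0 = 0 /\
    forall t : R, `|t| < 2 -> Dom G (gam v t) /\ is_derive t 1 (gam v) (F v (gam v t))) &
  forall r v w, r <= dl -> `|v| <= r -> `|w| <= r ->
    `|gam v 1 - gam w 1 - (v - w)| <= C * r * `|v - w|].
Proof.
have [C [d1 [C1 /andP[d10 d1r] lip1]]] := @Fld_lip R n G.
have C0 : 0 < C by apply: lt_le_trans C1.
pose d := Num.min d1 C^-1.
have d0 : 0 < d by rewrite lt_min d10 invr_gt0.
have dr : d <= rad G by apply: le_trans d1r; rewrite ge_min lexx.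
have Cd : C * d <= 1.
  by rewrite -(mulfV (lt0r_neq0 C0)) ler_pM2l// ge_min lexx orbT.
have lip v y z : `|y| <= d -> `|z| <= d -> `|F v y - F v z| <= C * `|v| * `|y - z|.
  by move=> yd zd; apply: lip1; [apply: le_trans yd _|apply: le_trans zd _];
    rewrite ge_min lexx.
pose B := 1 + C * d.
have B1 : 1 <= B by rewrite lerDl mulr_ge0// ltW.
have B0 : 0 < B by apply: lt_le_trans B1.
(* The first bound gives C |v| <= 1/4, the Lipschitz constant for Picard iteration; the second keeps
   the curve within d up to time 2, where the truncation is inactive. *)
pose dl := Num.min ((4 * C)^-1) (d / (2 * B)).
have dl0 : 0 < dl by rewrite lt_min invr_gt0 divr_gt0 ?mulr_gt0.
have dlC : C * dl <= 4^-1.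
  apply: le_trans (_ : C * (4 * C)^-1 <= _); last by rewrite invfM mulrCA divff ?mulr1// gt_eqF.
  by apply: ler_wpM2l; [exact: ltW|rewrite ge_min lexx].
have dlB : 2 * (dl * B) <= d.
  have : dl <= d / (2 * B) by rewrite ge_min lexx orbT.
  by rewrite ler_pdivlMr ?mulr_gt0// mulrCA.
have inD u : `|u| <= d -> Dom G u by move=> ud; apply: rad_Dom; exact: le_trans dr.
have Fb v u : `|u| <= d -> `|F v u - v| <= C * `|v| * `|u|.
  move=> ud; have := lip v u 0 ud; rewrite normr0 subr0 Fld0; apply; exact: ltW.
have Fn v u : `|u| <= d -> `|F v u| <= `|v| * B.
  move=> ud; rewrite -[F v u](subrK v); apply: le_trans (ler_normD _ _) _.
  rewrite /B mulrDr mulr1 addrC lerD2l; apply: le_trans (Fb v u ud) _.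
  by rewrite -mulrA mulrCA; apply: ler_wpM2l => //; apply: ler_wpM2l => //; exact: ltW.
have ex v : exists g : R -> E, `|v| <= dl -> g 0 = 0 /\
    forall t : R, `|t| < 2 -> `|g t| <= 2 * (`|v| * B) /\ is_derive t 1 g (F v (g t)).
  have [vd|nvd] := pselect (`|v| <= dl); last by exists (fun=> 0).
  have [|g [g0 dg]] := @picard R n.+1 (fun u => F v (vclamp d u)) 0.
    move=> x y; apply: le_trans (lip _ _ _ _ _) _.
    - by apply: vclamp_le; exact: ltW.
    - by apply: vclamp_le; exact: ltW.
    apply: ler_pM => //; first by rewrite mulr_ge0// ltW.
    - by apply: le_trans dlC; apply: ler_wpM2l => //; exact: ltW.
    - by apply: vclamp_lip; exact: ltW.
  exists g => _; split=> // t t2.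
  have gd u : `|u| < 2 -> `|g u| <= 2 * (`|v| * B).
    move=> u2; have := @curve_bound R n.+1 g (fun s => F v (vclamp d (g s))) 0 2 (`|v| * B) 0 u dg.
    rewrite normr0 g0 scaler0 !subr0 => H; apply: le_trans (H _ _ _) _ => //.
    - by move=> s s2; rewrite subr0; apply: Fn; apply: vclamp_le; exact: ltW.
    - by rewrite mulrC; apply: ler_wpM2r; [rewrite mulr_ge0// ltW|exact: ltW].
  split; first exact: gd.
  have := dg t t2; rewrite vclamp_id//; apply: le_trans (gd t t2) _.
  apply: le_trans dlB; rewrite ler_pM2l//; apply: ler_wpM2r => //; exact: ltW.
have [gam Hg] := choice ex.
have gamd v t : `|v| <= dl -> `|t| < 2 -> `|gam v t| <= d.
  move=> vd t2; have [_ /(_ t t2)[H _]] := Hg v vd; apply: le_trans H _.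
  apply: le_trans dlB; rewrite ler_pM2l//; apply: ler_wpM2r => //; exact: ltW.
(* 2CB comes from the distance of [Fld (v - w)] to the constant v - w along the curve, 4C from the
   bound 4 |v - w| on the separation of the two curves. *)
exists dl, (2 * C * B + 4 * C), gam; split=> //.
- by rewrite addr_gt0// !mulr_gt0.
- move=> v vd; have [g0 H] := Hg v vd; split=> // t t2; have [_ D] := H t t2.
  by split=> //; apply: inD; exact: gamd.
move=> r v w rd vr wr.
have vd := le_trans vr rd; have wd := le_trans wr rd.
have r0 : 0 <= r by apply: le_trans vr.
have [gv0 Hv] := Hg v vd; have [gw0 Hw] := Hg w wd.
pose D t := gam v t - gam w t.
pose D' t := F v (gam v t) - F w (gam w t).
have dD (t : R) : `|t| < 2 -> is_derive t 1 D (D' t).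
  by move=> t2; apply: is_deriveB; [case: (Hv t t2)|case: (Hw t t2)].
have D'E t : `|t| < 2 -> D' t = F (v - w) (gam v t) + (F w (gam v t) - F w (gam w t)).
  move=> t2; have Dv : Dom G (gam v t) by apply: inD; exact: gamd.
  rewrite (_ : v - w = -1 *: w + v); last by rewrite scaleN1r addrC.
  by rewrite (Fld_linear _ _ _ Dv) scaleN1r addrA [- _ + _]addrC subrK.
have D0 : D 0 = 0 by rewrite /D gv0 gw0 subrr.
have cD (t : R) : `|t| < 2 -> {for t, continuous D}.
  by move=> /dD[dd _]; apply: differentiable_continuous; exact/derivable1_diffP.
have lt2 t : 0 <= t <= 1 -> `|t| < 2 :> R.
  by move=> /andP[t0 t1]; rewrite ger0_norm//; apply: le_lt_trans t1 _; rewrite ltr1n.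
(* The maximum S of the separation is bounded in terms of itself: S <= |v - w| + K, where K contains
   the term C r S <= S / 4. Absorbing that term takes the place of Gronwall's inequality. *)
have [s s01 Hs] : exists2 s : R, s \in `[0, 1]%R & forall t : R, t \in `[0, 1]%R -> `|D t| <= `|D s|.
  apply: (@EVT_max R (fun t => `|D t|)) => //.
  apply: continuous_in_subspaceT => t /set_mem /=; rewrite in_itv /= => /lt2 t2.
  by apply: continuous_comp; [exact: cD|exact: norm_continuous].
set S := `|D s|.
have sn : `|s| < 2 by apply: lt2; rewrite in_itv in s01.
have [s0 s1] : 0 <= s /\ s <= 1 by move: s01; rewrite in_itv /= => /andP.
have HS t : 0 <= t <= 1 -> `|D t| <= S by move=> t01; apply: Hs; rewrite in_itv.
have Dest t : 0 <= t <= 1 -> `|D' t - (v - w)| <= C * `|v - w| * `|gam v t| + C * `|w| * S.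
  move=> t01; have t2 := lt2 t t01; rewrite D'E// addrAC.
  apply: le_trans (ler_normD _ _) _; apply: lerD; first by apply: Fb; exact: gamd.
  apply: le_trans (lip w _ _ (gamd v t vd t2) (gamd w t wd t2)) _.
  by apply: ler_wpM2l; [rewrite mulr_ge0// ltW|exact: HS].
have gvr t : `|t| < 2 -> `|gam v t| <= 2 * (r * B).
  move=> t2; have [H _] := Hv t t2; apply: le_trans H _.
  by rewrite ler_pM2l//; apply: ler_wpM2r => //; exact: ltW.
have S0 : 0 <= S by exact: normr_ge0.
pose K := C * `|v - w| * (2 * (r * B)) + C * r * S.
have K0 : 0 <= K by rewrite addr_ge0// !mulr_ge0// ltW.
have DK t : 0 <= t <= 1 -> `|D' t - (v - w)| <= K.
  move=> t01; apply: le_trans (Dest t t01) _; apply: lerD.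
    by apply: ler_wpM2l; [rewrite mulr_ge0// ltW|exact: gvr (lt2 t t01)].
  by apply: ler_wpM2r => //; apply: ler_wpM2l => //; exact: ltW.
have mvi t : 0 <= t <= 1 -> `|D t - t *: (v - w)| <= K * t.
  move=> /andP[t0 t1]; have := @curve_bound0 R n.+1 D D' (v - w) K t t0 K0.
  rewrite D0 subr0; apply=> u /andP[u0 ut].
  have u01 : 0 <= u <= 1 by rewrite u0 (le_trans ut).
  by split; [exact: dD (lt2 u u01)|exact: DK].
have i01 : 0 <= (1 : R) <= 1 by rewrite ler01 lexx.
have := mvi 1 i01; rewrite mulr1 scale1r => /le_trans; apply.
have SS : S <= `|v - w| + K.
  have s01' : 0 <= s <= 1 by rewrite s0.
  have := mvi s s01' => Hm.
  rewrite /S -[D s](subrK (s *: (v - w))); apply: le_trans (ler_normD _ _) _.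
  rewrite addrC normrZ ger0_norm//; apply: lerD; first exact: ler_piMl.
  by apply: le_trans Hm _; exact: ler_piMr.
have Cr : C * r <= 4^-1 by apply: le_trans dlC; apply: ler_wpM2l => //; exact: ltW.
have rB : 2 * (r * B) <= d.
  apply: le_trans dlB; rewrite ler_pM2l//; apply: ler_wpM2r => //; exact: ltW.
have x0 : 0 <= `|v - w| by [].
have e1 : C * `|v - w| * (2 * (r * B)) <= `|v - w|.
  rewrite mulrAC ler_piMl//; apply: le_trans Cd.
  by apply: ler_wpM2l => //; exact: ltW.
have e2 : C * r * S <= 4^-1 * S by apply: ler_wpM2r.
have S4 : S <= 4 * `|v - w|.
  move: SS; rewrite /K; move: (C * `|v - w| * _) (C * r * S) e1 e2 x0 S0 => p q e1 e2 x0 S0 SS.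
  lra.
rewrite /K.
have e3 : C * r * S <= C * r * (4 * `|v - w|).
  by apply: ler_wpM2l => //; rewrite mulr_ge0// ltW.
apply: le_trans (lerD (lexx _) e3) _.
by rewrite le_eqVlt; apply/orP; left; apply/eqP; ring.
Qed.


Lemma integral_curve_smooth v (c : R -> E) : (forall t : R, `|t| < 2 ->
    Dom G (c t) /\ is_derive t 1 c (F v (c t))) ->
  smoothG (fun t => iota (c t)) (ball 0 2) /\
  forall t : R, `|t| < 2 -> velocity (fun t => iota (c t) : G) t (vf v).
Proof.
move=> H.
have dc (t : R) : ball 0 2 t -> is_derive t 1 c (F v (c t)).
  by rewrite ball0E => /H[].
have cC : Cinfty c (ball 0 2).
  elim=> [|k IH].
    by move=> t /dc[d _]; apply: differentiable_continuous; exact/derivable1_diffP.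
  (* Bootstrap: a C^k solution has a C^k right-hand side, hence is C^(k+1). *)
  apply: (Ck_is_derive (f' := fun t => F v (c t))); [exact: ball_open|].
  apply: (Ck_comp (U' := Dom G) (f := F v) (g := c)) => //.
  - exact: findim_rV.
  - exact: findim_rV.
  - exact: ball_open.
  - exact: DomO.
  - by move=> t; rewrite ball0E => /H[].
  - exact: Fld_Ck.
split.
  apply: (@smooth_into_comp _ _ _ _ _ _ iota c _ (Dom G)) => //.
  - exact: findim_rV.
  - exact: ball_open.
  - exact: DomO.
  - by move=> t; rewrite ball0E => /H[].
  - exact: smooth_iota.
move=> t t2 f sf; have [Dt dt] := H t t2.
rewrite vf_Fld//; have [d E1] := dt.
have dct : differentiable c t by exact/derivable1_diffP.
have df : differentiable (fun w => f (iota w)) (c t).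
  exact: (Cinfty_differentiable (smooth_fun_iota sf)).
have dcomp : differentiable (fun s => f (iota (c s))) t.
  exact: (differentiable_comp dct df).
apply: DeriveDef; first exact: diff_derivable.
by rewrite (derive_comp (1 : R) dct df) E1.
Qed.

End Flow.

(** * The exponential map *)

Section OneParameter.
Context {R : realType} {n : nat} {G : lieGroupType R n}.
Local Notation E := 'rV[R]_n.+1.
Local Notation smoothG := (smooth_into (@atlas R n G)).
Implicit Types (X Y : vfield G) (g al be : R -> G).

Lemma smooth_curve_ball g r : smooth_curve g -> smoothG g (ball 0 r).
Proof. exact: smooth_into_sub. Qed.

Lemma velocity_mull g t X (x : G) : lie_algebra G X -> velocity g t X ->
  velocity (fun s => x * g s)%g t X.
Proof.
move=> XL vg f sf; have := vg _ (smooth_fun_mull x sf).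
by case: XL => _ _ _ _ /(_ x f sf) ->.
Qed.

Lemma smooth_mull g U (x : G) : open U -> smoothG g U -> smoothG (fun s => x * g s)%g U.
Proof. by move=> oU sg; apply: smooth_mul => //; exact: smooth_into_cst. Qed.

Lemma is_derive_shift0 (h : R -> R) (s t : R) (a : R) :
  is_derive (s + t) 1 h a -> is_derive t 1 (fun u => h (s + u)) a.
Proof.
move=> dh; have ds : is_derive t 1 (fun u : R => s + u) 1.
  by have := is_deriveD (is_derive_cst s t 1) (is_derive_id t (1 : R)); rewrite add0r.
by have := is_derive1_comp dh ds; rewrite mulr1.
Qed.

Lemma velocity_shift g s t X : velocity g (s + t) X -> velocity (fun u => g (s + u)) t X.
Proof. by move=> vg f sf; apply: (@is_derive_shift0 (fun u => f (g u))); exact: vg. Qed.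

Lemma smooth_shift g (s : R) (U V : set R) : open U -> open V ->
  (forall t, V t -> U (s + t)) -> smoothG g U -> smoothG (fun t => g (s + t)) V.
Proof.
move=> oU oV UV sg.
apply: (@smooth_into_comp _ _ _ _ R R g (fun t => s + t) V U) => //.
- exact: findim_R.
- by move=> k; apply: CkD => //; [exact: Ck_cst|exact: Ck_id].
Qed.

(** For fixed s both sides are integral curves of X in t with the same initial value, so uniqueness
    applies. *)
Lemma local_hom g X : lie_algebra G X -> smoothG g (ball 0 2) -> g 0 = 1%g ->
  (forall t : R, `|t| < 2 -> velocity g t X) ->
  forall s t : R, `|s| < 1 -> `|t| < 1 -> g (s + t) = (g s * g t)%g.
Proof.
move=> XL sg g0 vg s t s1 t1.
have in2 u : `|u| < 1 -> `|s + u| < 2.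
  by move=> u1; apply: le_lt_trans (ler_normD _ _) _; apply: ltrD.
have lt2 u : `|u| < 1 -> `|u| < 2 :> R by move=> /lt_trans; apply; rewrite ltr1n.
apply: (@integral_curve_uniq R n G (fun u => g (s + u)) (fun u => g s * g u)%g 1 X) => //.
- apply: (@smooth_shift g s (ball 0 2)) => //; try exact: ball_open.
  by move=> u; rewrite !ball0E; exact: in2.
- apply: smooth_mull; first exact: ball_open.
  by apply: smooth_into_sub sg => u; rewrite !ball0E; exact: lt2.
- by move=> u /in2/vg/velocity_shift.
- by move=> u /lt2/vg/(velocity_mull (g s) XL).
- by rewrite addr0 g0 mulg1.
Qed.

(** The extension is g (t / m)^m for any integer m > |t|. Two choices p and q agree through the
    common refinement t / (p q), and values of g at small arguments commute because addition
    does. *)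
Lemma hom_extend g : (forall s t : R, `|s| < 1 -> `|t| < 1 -> g (s + t) = (g s * g t)%g) ->
  exists ga : R -> G, (forall s t, ga (s + t) = (ga s * ga t)%g) /\
    forall t : R, `|t| < 1 -> ga t = g t.
Proof.
move=> hom.
have g0 : g 0 = 1%g.
  have := hom 0 0; rewrite normr0 ltr01 addr0 => /(_ isT isT) /(congr1 (fun z => (g 0)^-1 * z)%g).
  by rewrite mulVg mulKg.
have pow (j : nat) (t : R) : `|j%:R * t| < 1 -> g (j%:R * t) = (g t ^+ j)%g.
  elim: j => [|j IH]; first by rewrite mul0r g0.
  have [->|t0] := eqVneq t 0.
    by rewrite mulr0 g0 expg1n.
  move=> H; have jt : `|j%:R * t| < 1.
    apply: le_lt_trans H; rewrite !normrM; apply: ler_wpM2r => //.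
    by rewrite !ger0_norm// ler_nat.
  have t1 : `|t| < 1.
    apply: le_lt_trans H; rewrite normrM ger0_norm// ler_peMl//.
    by rewrite ler1n.
  by rewrite -natr1 mulrDl mul1r hom// IH// expgSr.
pose bnd (t : R) := Num.bound `|t|.
have bndP t : `|t| < (bnd t)%:R by exact: archi_boundP.
have quo (t : R) (m : nat) : `|t| < m%:R -> `|t / m%:R| < 1.
  move=> tm; have m0 : 0 < m%:R :> R by apply: le_lt_trans tm.
  by rewrite normrM normfV [`|m%:R|]ger0_norm// ltr_pdivrMr// mul1r.
pose ga (t : R) := (g (t / (bnd t)%:R)%R ^+ bnd t)%g.
have indep (t : R) (m : nat) : `|t| < m%:R -> ga t = (g (t / m%:R)%R ^+ m)%g.
  move=> tm; have tb := bndP t; rewrite /ga; set b := bnd t in tb *.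
  have m0 : m%:R != 0 :> R by rewrite gt_eqF//; apply: le_lt_trans tm.
  have b0 : b%:R != 0 :> R by rewrite gt_eqF//; apply: le_lt_trans tb.
  have key (p q : nat) : p%:R != 0 :> R -> q%:R != 0 :> R -> `|t| < p%:R ->
      (g (t / p%:R)%R ^+ p)%g = (g (t / (p%:R * q%:R))%R ^+ (q * p)%N)%g.
    move=> p0 q0 tp.
    have E1 : t / p%:R = q%:R * (t / (p%:R * q%:R)) by rewrite invfM [t * (_ * _)]mulrA mulrCA divff// mulr1.
    by rewrite [in LHS]E1 pow ?expgnA// -E1; exact: quo.
  by rewrite (key b m)// (key m b)// [X in g (t / X)]mulrC mulnC.
exists ga; split=> [s t|t t1].
  pose m := (bnd s + bnd t)%N.
  have sm : `|s| < m%:R by apply: lt_le_trans (bndP s) _; rewrite ler_nat leq_addr.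
  have tm : `|t| < m%:R by apply: lt_le_trans (bndP t) _; rewrite ler_nat leq_addl.
  have stm : `|s + t| < m%:R.
    apply: le_lt_trans (ler_normD _ _) _; rewrite natrD; exact: ltrD.
  rewrite (indep _ m stm) (indep s m sm) (indep t m tm) mulrDl.
  have h1 := hom _ _ (quo _ _ sm) (quo _ _ tm).
  have h2 := hom _ _ (quo _ _ tm) (quo _ _ sm).
  have com : commute (g (s / m%:R)) (g (t / m%:R)).
    by rewrite /commute -h1 -h2 addrC.
  by rewrite h1 expgMn.
have t1' : `|t| < 1%:R by [].
by rewrite (indep t 1%N t1') divr1.
Qed.

Lemma hom_velocity ga X : lie_algebra G X ->
  (forall s t, ga (s + t) = (ga s * ga t)%g) -> velocity ga 0 X ->
  forall t, velocity ga t X.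
Proof.
move=> XL hom v0 t f sf.
have := velocity_mull (ga t) XL v0 sf.
rewrite -{1}(subrr t) [t - t]addrC.
move=> H; have := @is_derive_shift0 (fun u => f (ga t * ga u)%g) (- t) t _ H.
rewrite -hom addr0; congr (is_derive _ _ _ _).
by apply/funext => u; rewrite -hom addrA subrr add0r.
Qed.

Lemma hom0 (ga : R -> G) : (forall s t, ga (s + t) = (ga s * ga t)%g) -> ga 0 = 1%g.
Proof.
move=> hom; have := hom 0 0; rewrite addr0 => /(congr1 (fun z => (ga 0)^-1 * z)%g).
by rewrite mulVg mulKg.
Qed.

Lemma one_param_uniq al be X : lie_algebra G X -> smooth_curve al -> smooth_curve be ->
  (forall s t, al (s + t) = (al s * al t)%g) -> (forall s t, be (s + t) = (be s * be t)%g) ->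
  velocity al 0 X -> velocity be 0 X -> al = be.
Proof.
move=> XL sa sb ha hb va vb; apply/funext => t.
apply: (@integral_curve_uniq R n G al be (`|t| + 1) X) => //.
- exact: smooth_curve_ball.
- exact: smooth_curve_ball.
- by move=> u _; exact: hom_velocity.
- by move=> u _; exact: hom_velocity.
- by rewrite !hom0.
- by rewrite ltrDl.
Qed.

Lemma local_one_param g X : lie_algebra G X -> smoothG g (ball 0 2) -> g 0 = 1%g ->
  (forall t : R, `|t| < 2 -> velocity g t X) ->
  exists ga, [/\ smooth_curve ga, forall s t, ga (s + t) = (ga s * ga t)%g,
    velocity ga 0 X & forall t : R, `|t| < 2 -> ga t = g t].
Proof.
move=> XL sg g0 vg.
have [ga [hom E1]] := hom_extend (local_hom XL sg g0 vg).
have lt2 u : `|u| < 1 -> `|u| < 2 :> R by move=> /lt_trans; apply; rewrite ltr1n.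
have sga : smooth_curve ga.
  apply: smooth_into_loc => t _; exists (ball t 1); split; first exact: ballxx.
  apply: (@smooth_into_eq _ _ _ _ _ (fun u => ga t * g (- t + u))%g).
  - exact: ball_open.
  - move=> u; rewrite -ball_normE /= distrC => tu.
    have tu' : `|- t + u| < 1 by rewrite addrC.
    by rewrite -(E1 _ tu') -hom addrA subrr add0r.
  - apply: smooth_mull; first exact: ball_open.
    apply: (@smooth_shift g (- t) (ball 0 2)) => //; try exact: ball_open.
    move=> u; rewrite ball0E -ball_normE /= distrC => tu.
    by apply: lt2; rewrite addrC.
have v0 : velocity ga 0 X.
  move=> f sf; have := vg 0 _ f sf; rewrite normr0 ltr0n => /(_ isT).
  rewrite g0 hom0//; apply: near_eq_is_derive.
  have : \forall u \near (0 : R), ball 0 1 u by exact: nbhsx_ballx.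
  by apply: filterS => u; rewrite ball0E => u1; rewrite E1.
exists ga; split=> // t t2.
apply: (@integral_curve_uniq R n G ga g 2 X) => //.
- exact: smooth_curve_ball.
- by move=> u _; exact: hom_velocity.
- by rewrite g0 hom0.
Qed.

Lemma one_param_scale ga X (r : R) : lie_algebra G X -> smooth_curve ga ->
  (forall s t, ga (s + t) = (ga s * ga t)%g) -> velocity ga 0 X ->
  let be := fun t => ga (r * t) in
  [/\ smooth_curve be, forall s t, be (s + t) = (be s * be t)%g &
   velocity be 0 (r *: X)].
Proof.
move=> XL sg hom v0 be; split.
- apply: (@smooth_into_comp _ _ _ _ R R ga (fun t => r * t) setT setT) => //.
  + exact: findim_R.
  + exact: openT.
  + exact: openT.
  + by move=> k; apply: CkM; [exact: openT|exact: Ck_cst|apply: Ck_id; exact: openT].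
- by move=> s t; rewrite /be mulrDr hom.
move=> f sf; rewrite /be mulr0.
have dm : is_derive (0 : R) 1 (fun u : R => r * u) r.
  have := @is_deriveZ _ _ _ id r (0 : R) 1 1 (is_derive_id (0 : R) 1).
  by rewrite -[r *: 1]/(r * 1) mulr1.
have dv := v0 f sf; rewrite -(mulr0 r) in dv.
have := is_derive1_comp dv dm.
by rewrite mulr0 mulrC.
Qed.

End OneParameter.

Section Exp.
Context {R : realType} {n : nat} {G : lieGroupType R n}.
Local Notation E := 'rV[R]_n.+1.
Local Notation smoothG := (smooth_into (@atlas R n G)).
Implicit Types (X Y : vfield G) (g al be : R -> G).

Lemma lie_exp_uniq ga X : lie_algebra G X -> smooth_curve ga ->
  (forall s t, ga (s + t) = (ga s * ga t)%g) -> velocity ga 0 X -> lie_exp X = ga 1.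
Proof.
move=> XL sg hom v0; rewrite /lie_exp; case: xgetP => [g -> [al [sa ha [_ va] ->]]|].
  by congr (_ 1); apply: (@one_param_uniq _ _ _ al ga X).
move=> /(_ (ga 1)) []; exists ga; split=> //.
Qed.

Lemma small_exp : exists dl C : R, [/\ 0 < dl, 0 < C,
  forall v, `|v| <= dl -> cdom (chart1 G) (lie_exp (vf v)) &
  forall r v w, r <= dl -> `|v| <= r -> `|w| <= r ->
    `|kappa (lie_exp (vf v : vfield G)) - kappa (lie_exp (vf w : vfield G)) - (v - w)|
      <= C * r * `|v - w|].
Proof.
have [dl [C [gam [dl0 C0 H1 H2]]]] := @flow_exists R n G.
have key v : `|v| <= dl -> Dom G (gam v 1) /\ lie_exp (vf v) = iota (gam v 1) :> G.
  move=> vd; have [g0 Hg] := H1 v vd.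
  have [sg vg] := integral_curve_smooth Hg.
  have [|ga [sga hom v0 E1]] := local_one_param (vf_lie v) sg _ vg.
    by rewrite /= g0 iota0.
  have n1 : `|1 : R| < 2 by rewrite normr1 ltr1n.
  split; first by have [] := Hg 1 n1.
  by rewrite (lie_exp_uniq (vf_lie v) sga hom v0) E1.
exists dl, C; split=> // [v vd|r v w rd vr wr].
  by have [D ->] := key v vd; exact: cdom_iota.
have [Dv ->] := key v (le_trans vr rd); have [Dw ->] := key w (le_trans wr rd).
by rewrite !iotaK//; exact: H2.
Qed.

(** X is divided by an integer large enough for the local flow to exist, and the resulting
    one-parameter group is reparametrized. *)
Lemma one_param_exists X : lie_algebra G X -> exists ga : R -> G,
  [/\ smooth_curve ga, forall s t, ga (s + t) = (ga s * ga t)%g & velocity ga 0 X].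
Proof.
move=> XL; have [dl [C [gam [dl0 C0 H1 _]]]] := @flow_exists R n G.
pose v := co X; pose m := (Num.bound (`|v| / dl)).+1.
have m0 : 0 < m%:R :> R by rewrite ltr0n.
have vd : `|m%:R^-1 *: v| <= dl.
  rewrite normrZ normfV [`|m%:R|]ger0_norm// mulrC ler_pdivrMr// mulrC -ler_pdivrMr//.
  apply: le_trans (ltW (archi_boundP _)) _; first by rewrite divr_ge0// ltW.
  by rewrite ler_nat.
have [g0 Hg] := H1 _ vd.
have [sg vg] := integral_curve_smooth Hg.
have [|ga [sga hom v0 _]] := local_one_param (vf_lie _) sg _ vg.
  by rewrite /= g0 iota0.
have [sb hb vb] := one_param_scale m%:R (vf_lie _) sga hom v0.
exists (fun t => ga (m%:R * t)); split=> //.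
move: vb; have -> : m%:R *: vf (m%:R^-1 *: v) = X.
  have := vf_linear (G := G) m%:R (m%:R^-1 *: v) 0.
  rewrite vf0 !addr0 => <-; rewrite scalerA divff ?gt_eqF// scale1r.
  by rewrite -lie_vf.
by [].
Qed.

Lemma lie_exp_curve X : lie_algebra G X ->
  [/\ smooth_curve (fun t => lie_exp (t *: X)),
      forall s t, lie_exp ((s + t) *: X) = (lie_exp (s *: X) * lie_exp (t *: X))%g &
      forall t, velocity (fun t => lie_exp (t *: X)) t X].
Proof.
move=> XL; have [ga [sg hom v0]] := one_param_exists XL.
have E1 : (fun t => lie_exp (t *: X)) = ga.
  apply/funext => t; have [sb hb vb] := one_param_scale t XL sg hom v0.
  by rewrite (lie_exp_uniq (lieZ t XL) sb hb vb) mulr1.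
split; first by rewrite E1.
  by move=> s t; have := hom s t; rewrite -E1.
by rewrite E1 => t; exact: hom_velocity.
Qed.

Lemma lie_exp0 : lie_exp (0 : vfield G) = 1%g.
Proof.
have [_ h _] := lie_exp_curve (lie0 (G := G)).
by have := hom0 h; rewrite scaler0.
Qed.

Lemma lie_expN X : lie_algebra G X -> lie_exp (- X) = (lie_exp X)^-1%g.
Proof.
move=> XL; have [_ h _] := lie_exp_curve XL.
have := h (-1) 1; rewrite addNr scale0r lie_exp0 scaleN1r scale1r.
by move=> /(congr1 (fun z => z * (lie_exp X)^-1)%g); rewrite mul1g mulgK.
Qed.

End Exp.

(** * Products of exponentials *)

Section StrictDifferential.
Context {R : realType}.

(** Strict differentiability at 0. L is a bare map, so that explicit formulas can be used directly;
    its bound and its compatibility with subtraction are assumed where they matter. *)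
Definition strict0 (V W : normedModType R) (f L : V -> W) :=
  forall eta : R, 0 < eta -> exists2 d : R, 0 < d & forall y z, `|y| <= d -> `|z| <= d ->
    `|f y - f z - L (y - z)| <= eta * `|y - z|.

Definition bounded_by (V W : normedModType R) (L : V -> W) (K : R) :=
  forall x, `|L x| <= K * `|x|.

Lemma strict0_lip (V W : normedModType R) (f L : V -> W) (K : R) :
  strict0 f L -> bounded_by L K -> exists2 d : R, 0 < d & forall y z, `|y| <= d ->
    `|z| <= d -> `|f y - f z| <= (K + 1) * `|y - z|.
Proof.
move=> /(_ 1 ltr01)[d d0 Hd] LK; exists d => // y z yd zd.
rewrite -[f y - f z](subrK (L (y - z))); apply: le_trans (ler_normD _ _) _.
by rewrite addrC mulrDl; apply: lerD; [exact: LK|exact: Hd].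
Qed.

Lemma strict0_comp (V W X : normedModType R) (f L : V -> W) (g M : W -> X) (K1 K2 : R) :
  strict0 f L -> strict0 g M -> bounded_by L K1 -> bounded_by M K2 -> f 0 = 0 ->
  0 <= K1 -> 0 <= K2 ->
  (forall x y, M (x - y) = M x - M y) -> strict0 (g \o f) (M \o L).
Proof.
move=> sf sg LK MK f0 K10 K20 Mlin eta eta0.
have [d1 d10 H1] := strict0_lip sf LK.
pose e2 := eta / (2 * (K1 + 1)).
have K1p : 0 < K1 + 1 by apply: ltr_wpDl.
have K2p : 0 < K2 + 1 by apply: ltr_wpDl.
have e20 : 0 < e2 by rewrite divr_gt0// mulr_gt0.
have [d2 d20 H2] := sg _ e20.
pose e3 := eta / (2 * (K2 + 1)).
have e30 : 0 < e3 by rewrite divr_gt0// mulr_gt0.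
have [d3 d30 H3] := sf _ e30.
pose d := Num.min d1 (Num.min (d2 / (K1 + 1)) d3).
have d0 : 0 < d by rewrite !lt_min d10 d30 divr_gt0.
have dd1 : d <= d1 by rewrite ge_min lexx.
have dd2 : d <= d2 / (K1 + 1) by rewrite !ge_min lexx orbT.
have dd3 : d <= d3 by rewrite !ge_min lexx !orbT.
exists d => // y z yd zd.
have fsmall w : `|w| <= d -> `|f w| <= d2.
  move=> wd; have := H1 w 0 (le_trans wd dd1); rewrite normr0 f0 !subr0 => /(_ (ltW d10)).
  move=> /le_trans; apply; rewrite mulrC -ler_pdivlMr//; exact: le_trans dd2.
have A := H2 _ _ (fsmall y yd) (fsmall z zd).
have B := H1 y z (le_trans yd dd1) (le_trans zd dd1).
have C := H3 y z (le_trans yd dd3) (le_trans zd dd3).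
have -> : (g \o f) y - (g \o f) z - (M \o L) (y - z) =
   (g (f y) - g (f z) - M (f y - f z)) + M (f y - f z - L (y - z)).
  by rewrite /= [M (_ - _ - _)]Mlin addrA subrK.
apply: le_trans (ler_normD _ _) _; rewrite [X in X * _](splitr eta) mulrDl.
apply: lerD.
  apply: le_trans A _; apply: le_trans (_ : e2 * ((K1 + 1) * `|y - z|) <= _).
    by apply: ler_wpM2l => //; exact: ltW.
  rewrite mulrA; apply: ler_wpM2r => //; rewrite /e2 le_eqVlt; apply/orP; left.
  by apply/eqP; field; rewrite gt_eqF.
apply: le_trans (MK _) _; apply: le_trans (_ : (K2 + 1) * (e3 * `|y - z|) <= _).
  by apply: ler_pM => //; rewrite lerDl.
rewrite mulrA; apply: ler_wpM2r => //; rewrite /e3 le_eqVlt; apply/orP; left.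
by apply/eqP; field; rewrite gt_eqF.
Qed.

Lemma prod_normE (V W : normedModType R) (p : V * W) : `|p| = Num.max `|p.1| `|p.2|.
Proof. by []. Qed.

Lemma norm_fst_le (V W : normedModType R) (p : V * W) : `|p.1| <= `|p|.
Proof. by rewrite prod_normE le_max lexx. Qed.

Lemma norm_snd_le (V W : normedModType R) (p : V * W) : `|p.2| <= `|p|.
Proof. by rewrite prod_normE le_max lexx orbT. Qed.

Lemma strict0_pair (V W V' W' : normedModType R) (f L : V -> W) (g M : V' -> W') :
  strict0 f L -> strict0 g M ->
  strict0 (fun p : V * V' => (f p.1, g p.2)) (fun p => (L p.1, M p.2)).
Proof.
move=> sf sg eta eta0; have [d1 d10 H1] := sf _ eta0; have [d2 d20 H2] := sg _ eta0.
exists (Num.min d1 d2); first by rewrite lt_min d10.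
move=> y z; rewrite !le_min => /andP[y1 y2] /andP[z1 z2].
rewrite prod_normE ge_max /=; apply/andP; split.
  apply: le_trans (H1 _ _ _ _) _.
  - exact: le_trans (norm_fst_le _) y1.
  - exact: le_trans (norm_fst_le _) z1.
  by apply: ler_wpM2l; [exact: ltW|exact: (norm_fst_le (y - z))].
apply: le_trans (H2 _ _ _ _) _.
- exact: le_trans (norm_snd_le _) y2.
- exact: le_trans (norm_snd_le _) z2.
by apply: ler_wpM2l; [exact: ltW|exact: (norm_snd_le (y - z))].
Qed.

(** Simplified Newton iteration x -> x + (u - Phi (S x)). As S enters only through its bound C and
    the relation L (S x) = x, the radius is chosen before S: this is the source of the uniformity
    over all decompositions. *)
Lemma strict0_solve m (V : normedModType R) (Phi L : V -> 'rV[R]_m) (C : R) :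
  strict0 Phi L -> Phi 0 = 0 -> 0 < C -> exists2 r : R, 0 < r &
  forall S : 'rV[R]_m -> V, (forall x y, S (x - y) = S x - S y) -> bounded_by S C ->
    (forall x, L (S x) = x) ->
    forall u, `|u| <= r -> exists x, `|x| <= 2 * `|u| /\ Phi (S x) = u.
Proof.
(* With this precision the map x - Phi (S x) has Lipschitz constant 1/2, because |S (x - y)| <= C |x
   - y|. *)
move=> sP P0 C0; have e0 : 0 < (2 * C)^-1 by rewrite invr_gt0 mulr_gt0.
have [d d0 Hd] := sP _ e0.
exists (d / (2 * C)); first by rewrite divr_gt0// mulr_gt0.
move=> S Slin SC LS u; rewrite ler_pdivlMr ?mulr_gt0// => ur.
have S0 : S 0 = 0 by have := Slin 0 0; rewrite !subrr.
have Sd x : `|x| <= 2 * `|u| -> `|S x| <= d.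
  move=> xu; apply: le_trans (SC x) _; apply: le_trans ur.
  by rewrite mulrC mulrCA mulrA; apply: ler_wpM2r => //; exact: ltW.
have key x y : `|x| <= 2 * `|u| -> `|y| <= 2 * `|u| ->
    `|x - y - (Phi (S x) - Phi (S y))| <= 2^-1 * `|x - y|.
  move=> xu yu; have H := Hd _ _ (Sd x xu) (Sd y yu); rewrite -Slin LS in H.
  rewrite (distrC (x - y)); apply: le_trans H _; apply: le_trans (_ : (2 * C)^-1 * (C * `|x - y|) <= _).
    by apply: ler_wpM2l => //; exact: ltW.
  have -> : (2 * C)^-1 * (C * `|x - y|) = 2^-1 * `|x - y| by field; rewrite gt_eqF.
  by [].
pose T x := x + (u - Phi (S x)).
pose xs k := iter k T 0.
(* The first invariant keeps every iterate within 2 |u|, where the contraction estimate is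
   available. *)
have Hk k : `|xs k| <= 2 * `|u| - 2 * `|u| / 2 ^+ k /\ `|xs k.+1 - xs k| <= `|u| / 2 ^+ k.
  elim: k => [|k [IH1 IH2]].
    rewrite expr0 !divr1 subrr /xs /= normr0; split=> //.
    by rewrite /T S0 P0 !subr0 add0r.
  have p2 : 0 < 2 ^+ k :> R by rewrite exprn_gt0.
  have u2 (j : nat) : 2 * `|u| - 2 * `|u| / 2 ^+ j <= 2 * `|u|.
    by rewrite gerBl divr_ge0// mulr_ge0.
  have B1 : `|xs k.+1| <= 2 * `|u| - 2 * `|u| / 2 ^+ k.+1.
    rewrite -[xs k.+1](subrK (xs k)) addrC; apply: le_trans (ler_normD _ _) _.
    apply: le_trans (lerD IH1 IH2) _; rewrite exprS invfM.
    by rewrite le_eqVlt; apply/orP; left; apply/eqP; field; rewrite gt_eqF.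
  split=> //.
  have -> : xs k.+2 - xs k.+1 = xs k.+1 - xs k - (Phi (S (xs k.+1)) - Phi (S (xs k))).
    have E1 : xs k.+2 = xs k.+1 + (u - Phi (S (xs k.+1))) by [].
    have E2 : xs k.+1 = xs k + (u - Phi (S (xs k))) by [].
    rewrite E1; move: (Phi (S (xs k.+1))) => P1; rewrite E2.
    by apply/rowP => j; rewrite !mxE; ring.
  apply: le_trans (key _ _ _ _) _.
  - exact: le_trans B1 (u2 _).
  - exact: le_trans IH1 (u2 _).
  rewrite exprS invfM mulrCA; exact: ler_wpM2l.
have [x Hx] := geometric_limit (fun k => proj2 (Hk k)).
have x2 : `|x| <= 2 * `|u| by have := Hx 0%N; rewrite /xs /= subr0 expr0 divr1.
exists x; split=> //; apply/eqP; rewrite eq_sym -subr_eq0 -normr_le0.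
apply/ler_addgt0Pr => e ee0; rewrite add0r.
have : geometric (4 * `|u|) (2^-1) k @[k --> \oo] --> (0 : R).
  by apply: cvg_geometric; rewrite ger0_norm ?invr_ge0// invf_lt1// ltr1n.
move=> /cvgrPdist_le /(_ _ ee0)[k _ /(_ k (leqnn k))].
rewrite sub0r normrN /geometric /= exprVn => Hk4.
have {Hk4} Hk4 : 4 * `|u| / 2 ^+ k <= e.
  by apply: le_trans Hk4; exact: ler_norm.
apply: le_trans Hk4.
have p2 : 0 < 2 ^+ k :> R by rewrite exprn_gt0.
have xk2 : `|xs k| <= 2 * `|u|.
  by apply: le_trans (proj1 (Hk k)) _; rewrite gerBl divr_ge0// mulr_ge0.
have -> : u - Phi (S x) = (xs k.+1 - x) - (xs k - x - (Phi (S (xs k)) - Phi (S x))).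
  have -> : xs k.+1 = xs k + (u - Phi (S (xs k))) by [].
  by apply/rowP => j; rewrite !mxE; ring.
apply: le_trans (ler_normB _ _) _.
have h1 := Hx k; have h2 := Hx k.+1; rewrite distrC in h2.
have h3 := key _ _ xk2 x2; rewrite distrC in h1.
apply: le_trans (lerD h2 h3) _.
have h4 : 2^-1 * `|xs k - x| <= 2^-1 * (2 * `|u| / 2 ^+ k).
  by apply: ler_wpM2l => //; rewrite invr_ge0.
apply: le_trans (lerD (lexx _) h4) _.
rewrite exprS invfM; set q := (2 ^+ k)^-1.
have q0 : 0 <= `|u| * q by rewrite mulr_ge0// invr_ge0 ltW.
have -> : 2 * `|u| * (2^-1 * q) = `|u| * q by field.
have -> : 2^-1 * (2 * `|u| * q) = `|u| * q by field.
by rewrite -mulrA; lra.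
Qed.

End StrictDifferential.

Section GroupChartProducts.
Context {R : realType} {n : nat} {G : lieGroupType R n}.
Local Notation E := 'rV[R]_n.+1.
Implicit Types (X Y : vfield G).

Definition expc (v : E) : E := kappa (lie_exp (vf v : vfield G)).

Lemma expc0 : expc 0 = 0.
Proof. by rewrite /expc vf0 lie_exp0 kappa1. Qed.

Lemma expc_strict : strict0 expc id.
Proof.
move=> eta eta0; have [dl [C [dl0 C0 _ H]]] := @small_exp R n G.
exists (Num.min dl (eta / C)); first by rewrite lt_min dl0 divr_gt0.
move=> y z yd zd; apply: le_trans (H _ _ _ _ yd zd) _; first by rewrite ge_min lexx.
apply: ler_wpM2r => //; rewrite mulrC -ler_pdivlMr//.
by rewrite ge_min lexx orbT.
Qed.

Lemma Pmul_strict : strict0 (@Pmul R n G) (fun p => p.1 + p.2).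
Proof.
have P0 : @PDom R n G 0 by exact: (@PDom_r R n G 0 (Dom0 G)).
have HC := @Pmul_smooth R n G 1.
move=> eta eta0; have [d d0 Hd] := strict_diff (findim_prod (findim_rV _) (findim_rV _))
  PDomO P0 HC eta0.
exists (d / 2); first by rewrite divr_gt0.
have d2 : d / 2 < d by rewrite ltr_pdivrMr// ltr_pMr// ltr1n.
move=> y z yd zd.
have D p : 'D_p (@Pmul R n G) (0, 0) = p.1 + p.2 :> E.
  have dP : differentiable (@Pmul R n G) (0, 0) by apply: Pmul_diff; exact: Dom0.
  have Ep : p = (1 : R) *: (p.1, 0) + (0, p.2).
    by case: p => a b; rewrite scale1r; congr pair; rewrite /= ?addr0 ?add0r.
  have := derive_lin (p.1, 0) (0, p.2) (1 : R) dP; rewrite -Ep scale1r => ->.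
  rewrite -[X in _ + X]/(Fld p.2 0) Fld0; congr (_ + _).
  have dc : differentiable (fun w : E => (0 : E)) (0 : E) by exact: differentiable_cst.
  have did : differentiable (fun w : E => w) (0 : E) by exact: ex_diff.
  have := derive_comp p.1 (differentiable_pair did dc) dP.
  rewrite (derive_pair _ did dc) derive_id derive_cst => <-.
  have H : \forall y \near (0 : E), id y = @Pmul R n G (y, 0).
    by apply: filterS (open_near (DomO G) (Dom0 G)) => w dw; rewrite Pmul_r.
  by rewrite -(near_eq_derive _ H) derive_id.
by rewrite -D; apply: Hd; rewrite ball0E; exact: le_lt_trans d2.
Qed.

Lemma PDom_near : exists2 d : R, 0 < d & forall p : E * E, `|p| <= d -> (@PDom R n G) p.
Proof.
have P0 : @PDom R n G 0 by exact: (@PDom_r R n G 0 (Dom0 G)).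
have /nbhs_ballP[d /= d0 Hd] := open_near PDomO P0.
exists (d / 2); first by rewrite divr_gt0.
move=> p pd; apply: Hd; rewrite ball0E; apply: le_lt_trans pd _.
by rewrite ltr_pdivrMr// ltr_pMr// ltr1n.
Qed.

(** The bracketing (1 2)(3 4) gives strict differentiability by applying the composition lemma to
    the same two-factor map twice. *)
Definition mul4 (p : (E * E) * (E * E)) : E :=
  Pmul (G := G) (Pmul (G := G) (expc p.1.1, expc p.1.2),
    Pmul (G := G) (expc p.2.1, expc p.2.2)).

Lemma mul4_strict : strict0 mul4 (fun p => p.1.1 + p.1.2 + (p.2.1 + p.2.2)).
Proof.
have bid : bounded_by (id : E -> E) 1 by move=> x; rewrite mul1r.
have bP : bounded_by (fun p : E * E => p.1 + p.2) 2.
  move=> p; apply: le_trans (ler_normD _ _) _; rewrite mulr_natl mulr2n.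
  by apply: lerD; [exact: norm_fst_le|exact: norm_snd_le].
have addP (x y : E * E) : (x - y).1 + (x - y).2 = (x.1 + x.2) - (y.1 + y.2).
  by rewrite opprD addrACA.
have s2 := strict0_pair expc_strict expc_strict.
have b2 : bounded_by (fun p : E * E => (id p.1, id p.2)) 1 by move=> [x y]; rewrite mul1r.
have Pm0 : Pmul (G := G) (0, 0) = 0 by rewrite Pmul_r//; exact: Dom0.
have q2 := strict0_comp s2 Pmul_strict b2 bP.
have z2 : (fun p : E * E => (expc p.1, expc p.2)) 0 = 0 by rewrite /= expc0.
have {}q2 := q2 z2 ler01 (ler0n _ 2) addP.
have s4 := strict0_pair q2 q2.
have b4 : bounded_by (fun p : (E * E) * (E * E) =>
    (((fun p : E * E => p.1 + p.2) \o (fun p => (id p.1, id p.2))) p.1,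
     ((fun p : E * E => p.1 + p.2) \o (fun p => (id p.1, id p.2))) p.2)) 2.
  move=> p; rewrite prod_normE ge_max /=; apply/andP; split.
    apply: le_trans (bP p.1) _; apply: ler_wpM2l => //; exact: norm_fst_le.
  apply: le_trans (bP p.2) _; apply: ler_wpM2l => //; exact: norm_snd_le.
have q4 := strict0_comp s4 Pmul_strict b4 bP.
have z4 : (fun p : (E * E) * (E * E) =>
    ((@Pmul R n G \o (fun p => (expc p.1, expc p.2))) p.1,
     (@Pmul R n G \o (fun p => (expc p.1, expc p.2))) p.2)) 0 = 0.
  by rewrite /= expc0 Pm0.
exact: (q4 z4 (ler0n _ 2) (ler0n _ 2) addP).
Qed.

Lemma strict0_small (V : normedModType R) (f L : V -> E) K : strict0 f L ->
  bounded_by L K -> f 0 = 0 -> forall e : R, 0 < e -> exists2 d : R, 0 < d &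
  forall x, `|x| <= d -> `|f x| <= e.
Proof.
move=> sf LK f0 e e0; have [d d0 H] := strict0_lip sf LK.
have K1 : 0 < `|K| + 1 by apply: ltr_wpDl.
exists (Num.min d (e / (`|K| + 1))); first by rewrite lt_min d0 divr_gt0.
move=> x; rewrite le_min => /andP[xd xe].
have := H x 0 xd; rewrite normr0 f0 !subr0 => /(_ (ltW d0)) /le_trans; apply.
apply: le_trans (_ : (`|K| + 1) * `|x| <= _).
  by apply: ler_wpM2r => //; rewrite lerD2r ler_norm.
by rewrite mulrC -ler_pdivlMr.
Qed.

Lemma expc_cdom : exists2 d : R, 0 < d &
  forall v, `|v| <= d -> cdom (chart1 G) (lie_exp (vf v)) /\ `|expc v| <= 2 * `|v|.
Proof.
have [dl [C [dl0 C0 H _]]] := @small_exp R n G.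
have bid : bounded_by (id : E -> E) 1 by move=> x; rewrite mul1r.
have [d d0 Hd] := strict0_lip expc_strict bid.
exists (Num.min dl d); first by rewrite lt_min dl0.
move=> v; rewrite le_min => /andP[v1 v2]; split; first exact: H.
by have := Hd v 0 v2; rewrite normr0 expc0 !subr0 => /(_ (ltW d0)).
Qed.

Lemma mul4_exp : exists2 d : R, 0 < d & forall v1 v2 v3 v4 : E,
  `|v1| <= d -> `|v2| <= d -> `|v3| <= d -> `|v4| <= d ->
  iota (mul4 ((v1, v2), (v3, v4))) = (lie_exp (vf v1) * lie_exp (vf v2) *
    lie_exp (vf v3) * lie_exp (vf v4) :> G)%g.
Proof.
have bid : bounded_by (id : E -> E) 1 by move=> x; rewrite mul1r.
have bP : bounded_by (fun p : E * E => p.1 + p.2) 2.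
  move=> p; apply: le_trans (ler_normD _ _) _; rewrite mulr_natl mulr2n.
  by apply: lerD; [exact: norm_fst_le|exact: norm_snd_le].
have [d1 d10 H1] := expc_cdom.
have [d2 d20 H2] := PDom_near.
have Pm0 : Pmul (G := G) 0 = 0 by rewrite [Pmul _]Pmul_r//; exact: Dom0.
have [d3 d30 H3] := strict0_small Pmul_strict bP Pm0 d20.
pose e := Num.min d2 d3; have e0 : 0 < e by rewrite lt_min d20.
have [d4 d40 H4] := strict0_small expc_strict bid expc0 e0.
exists (Num.min d1 d4); first by rewrite lt_min d10.
move=> v1 v2 v3 v4; rewrite !le_min => /andP[a1 b1] /andP[a2 b2] /andP[a3 b3] /andP[a4 b4].
have K v : `|v| <= d1 -> iota (expc v) = lie_exp (vf v) :> G.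
  by move=> vd; rewrite /expc kappaK//; case: (H1 v vd).
have pr v w : `|v| <= d4 -> `|w| <= d4 -> `|(expc v, expc w)| <= e.
  by move=> vd wd; rewrite prod_normE ge_max; apply/andP; split; exact: H4.
have pD v w : `|v| <= d4 -> `|w| <= d4 -> PDom (G := G) (expc v, expc w).
  by move=> vd wd; apply: H2; apply: le_trans (pr v w vd wd) _; rewrite ge_min lexx.
have pS v w : `|v| <= d4 -> `|w| <= d4 -> `|Pmul (G := G) (expc v, expc w)| <= d2.
  by move=> vd wd; apply: H3; apply: le_trans (pr v w vd wd) _; rewrite ge_min lexx orbT.
have Pm : @PDom R n G (Pmul (G := G) (expc v1, expc v2), Pmul (G := G) (expc v3, expc v4)).
  by apply: H2; rewrite prod_normE ge_max; apply/andP; split; exact: pS.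
have E12 : iota (Pmul (G := G) (expc v1, expc v2)) = (lie_exp (vf v1) * lie_exp (vf v2) : G)%g.
  by apply: etrans (iota_Pmul (pD v1 v2 b1 b2)) _; rewrite -(K v1 a1) -(K v2 a2).
have E34 : iota (Pmul (G := G) (expc v3, expc v4)) = (lie_exp (vf v3) * lie_exp (vf v4) : G)%g.
  by apply: etrans (iota_Pmul (pD v3 v4 b3 b4)) _; rewrite -(K v3 a3) -(K v4 a4).
rewrite /mul4; apply: etrans (iota_Pmul Pm) _.
exact: etrans (congr2 (fun a b : G => a * b)%g E12 E34) (mulgA _ _ _).
Qed.

Lemma mul4_0 : mul4 0 = 0.
Proof. by rewrite /mul4 /= expc0 Pmul_r ?Pmul_r//; exact: Dom0. Qed.

(** The equation [mul4 (S x) = expc z] is solved with S = (S1, S2, S3, S4), a right inverse of the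
    sum of four vectors. In 4 |z| one factor 2 comes from the iteration, the other from |expc z| <=
    2 |z|. *)
Lemma four_factor (C : R) : 0 < C -> exists2 r : R, 0 < r &
  forall S1 S2 S3 S4 : E -> E,
    (forall i : 'I_4, let S := tnth [tuple S1; S2; S3; S4] i in
      (forall x y, S (x - y) = S x - S y) /\ bounded_by S C) ->
    (forall x, S1 x + S2 x + (S3 x + S4 x) = x) ->
    forall z, `|z| <= r -> exists x, `|x| <= 4 * `|z| /\
      lie_exp (vf z) = (lie_exp (vf (S1 x)) * lie_exp (vf (S2 x)) *
        lie_exp (vf (S3 x)) * lie_exp (vf (S4 x)) :> G)%g.
Proof.
move=> C0; have [r1 r10 H1] := strict0_solve mul4_strict mul4_0 C0.
have [d1 d10 Hd1] := expc_cdom; have [d2 d20 Hd2] := mul4_exp.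
pose r := Num.min (r1 / 2) (Num.min d1 (d2 / (4 * C))).
have r0 : 0 < r by rewrite !lt_min d10 !divr_gt0// mulr_gt0.
exists r => // S1 S2 S3 S4 HS sum z; rewrite !le_min => /and3P[z1 z2 z3].
have [l1 c1] := HS 0; have [l2 c2] := HS 1; have [l3 c3] := HS 2%:R; have [l4 c4] := HS 3%:R.
rewrite !(tnth_nth S1) /= in l1 c1 l2 c2 l3 c3 l4 c4.
pose S x := ((S1 x, S2 x), (S3 x, S4 x)).
have Slin x y : S (x - y) = S x - S y by rewrite /S l1 l2 l3 l4.
have SC : bounded_by S C by move=> x; rewrite !prod_normE !ge_max /= c1 c2 c3 c4.
have zr : `|expc z| <= r1.
  by apply: le_trans (proj2 (Hd1 z z2)) _; rewrite mulrC -ler_pdivlMr.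
have [x [x2 E1]] := H1 S Slin SC sum _ zr.
have xz : `|x| <= 4 * `|z|.
  apply: le_trans x2 _; rewrite (_ : 4 = 2 * 2 :> R); last by ring.
  by rewrite -mulrA ler_pM2l//; exact: (proj2 (Hd1 z z2)).
exists x; split=> //.
have Sb (T : E -> E) : bounded_by T C -> `|T x| <= d2.
  move=> Tb; apply: le_trans (Tb x) _.
  apply: le_trans (_ : C * (4 * `|z|) <= _); first by apply: ler_wpM2l => //; exact: ltW.
  have -> : C * (4 * `|z|) = `|z| * (4 * C) by ring.
  by rewrite -ler_pdivlMr// mulr_gt0.
rewrite -Hd2; [|exact: Sb..].
by rewrite -/(S x) E1 /expc kappaK//; case: (Hd1 z z2).
Qed.

Lemma exp_onto : exists r : R, 0 < r /\ forall u : E, `|u| <= r -> Dom G u /\ exists v,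
  `|v| <= 2 * `|u| /\ lie_exp (vf v) = iota u :> G.
Proof.
have [r1 r10 H1] := strict0_solve expc_strict expc0 ltr01.
have [d1 d10 Hd1] := expc_cdom.
exists (Num.min r1 (Num.min (rad G) (d1 / 2))); split.
  by rewrite !lt_min r10 rad_gt0 divr_gt0.
move=> u; rewrite !le_min => /and3P[u1 u2 u3]; split; first exact: rad_Dom.
have [||| x [x2 E1]] := H1 id _ _ _ u u1 => //.
  by move=> x; rewrite mul1r.
exists x; split=> //; rewrite -E1 /expc kappaK//.
by apply: (proj1 (Hd1 _ _)); apply: le_trans x2 _; rewrite mulrC -ler_pdivlMr.
Qed.

End GroupChartProducts.

(** * The adjoint action *)

Section Automorphisms.
Context {R : realType} {n : nat} {G : lieGroupType R n}.
Implicit Types (X Y Z : vfield G) (f : G -> R) (phi psi : G -> G).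

(** The inverse psi is part of the data since [pushforward] takes it as an argument; conjugations
    and involutions are treated alike. *)
Record automorphism phi psi : Prop := Automorphism {
  auto_smooth : smooth_endo phi;
  auto_smoothV : smooth_endo psi;
  auto_mul : forall x y, phi (x * y)%g = (phi x * phi y)%g;
  autoK : forall x, psi (phi x) = x;
  autoVK : forall x, phi (psi x) = x }.

Lemma automorphism_inv phi psi : automorphism phi psi -> automorphism psi phi.
Proof.
case=> s1 s2 m k1 k2; split=> // x y.
by rewrite -[x in LHS]k2 -[y in LHS]k2 -m k1.
Qed.

Lemma invol_auto phi : lie_involution phi -> automorphism phi phi.
Proof. by case=> s m k. Qed.

Lemma conj_auto (g : G) : automorphism (conj g) (conj g^-1%g).
Proof.
split; [exact: smooth_endo_conj|exact: smooth_endo_conj| | |].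
- by move=> x y; rewrite /conj !mulgA -(mulgA _ g^-1%g g) mulVg mulg1.
- by move=> x; rewrite /conj invgK !mulgA mulVg mul1g -mulgA mulVg mulg1.
- by move=> x; rewrite /conj invgK !mulgA mulgV mul1g -mulgA mulgV mulg1.
Qed.

Section Push.
Context (phi psi : G -> G).
Context (A : automorphism phi psi).

Let push : vfield G -> vfield G := Defs.pushforward phi psi.

Lemma smooth_fun_phi f : smooth_fun (f \o phi) <-> smooth_fun f.
Proof.
split=> sf; last exact: smooth_fun_comp sf (auto_smooth A).
have -> : f = (f \o phi) \o psi by apply/funext => x /=; rewrite (autoVK A).
exact: smooth_fun_comp sf (auto_smoothV A).
Qed.

Lemma push_lie X : lie_algebra G X -> lie_algebra G (push X).
Proof.
move=> [X1 X2 X3 X4 X5]; split.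
- move=> f nf; apply/funext => x; rewrite /push /Defs.pushforward X1//.
  by rewrite smooth_fun_phi.
- by move=> f sf; apply: smooth_fun_comp (auto_smoothV A); apply/X2/smooth_fun_phi.
- move=> r f1 f2 /(proj2 (smooth_fun_phi _)) s1 /(proj2 (smooth_fun_phi _)) s2.
  apply/funext => x.
  by rewrite /push /Defs.pushforward -(congr1 (@^~ (psi x)) (X3 r _ _ s1 s2)).
- move=> f1 f2 /(proj2 (smooth_fun_phi _)) s1 /(proj2 (smooth_fun_phi _)) s2.
  apply/funext => x.
  rewrite /push /Defs.pushforward.
  have := congr1 (@^~ (psi x)) (X4 _ _ s1 s2); rewrite /= !(autoVK A) => <-.
  by [].
- move=> g f /(proj2 (smooth_fun_phi _)) sf; apply/funext => x; rewrite /push /Defs.pushforward.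
  have := congr1 (@^~ (psi x)) (X5 (psi g) _ sf).
  rewrite -(auto_mul (automorphism_inv A)) => <-; congr (X _ _).
  by apply/funext => y; rewrite /= (auto_mul A) (autoVK A).
Qed.

Lemma pushK X : Defs.pushforward psi phi (push X) = X.
Proof.
apply/funext => f; apply/funext => x; rewrite /push /Defs.pushforward (autoK A).
by congr (X _ _); apply/funext => y; rewrite /= (autoK A).
Qed.

Lemma push_bracket X Y : push (bracket X Y) = bracket (push X) (push Y).
Proof.
apply/funext => f; apply/funext => x; rewrite /push /Defs.pushforward /bracket.
by congr (X _ _ - Y _ _); apply/funext => y; rewrite /= (autoK A).
Qed.

Lemma push_velocity (ga : R -> G) t X : velocity ga t X ->
  velocity (fun s => phi (ga s)) t (push X).
Proof.
move=> v f sf; rewrite /push /Defs.pushforward (autoK A).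
by have := v _ (proj2 (smooth_fun_phi f) sf).
Qed.

Lemma push_exp X : lie_algebra G X -> lie_exp (push X) = phi (lie_exp X).
Proof.
move=> XL; have [sg hom v] := lie_exp_curve XL.
have := @lie_exp_uniq R n G (fun t => phi (lie_exp (t *: X))) (push X) (push_lie XL).
rewrite scale1r; apply.
- by apply: smooth_endo_comp; [exact: openT|exact: auto_smooth A|exact: sg].
- by move=> s t; rewrite hom (auto_mul A).
- exact: push_velocity.
Qed.

End Push.

Lemma Ad_lie g X : lie_algebra G X -> lie_algebra G (Ad g X).
Proof. exact: push_lie (conj_auto g) X. Qed.

Lemma Ad_exp g X : lie_algebra G X -> lie_exp (Ad g X) = (g * lie_exp X * g^-1)%g.
Proof. exact: push_exp (conj_auto g) X. Qed.

Lemma AdZ g r X : Ad g (r *: X) = r *: Ad g X.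
Proof. by []. Qed.

Lemma Ad_bracket g X Y : Ad g (bracket X Y) = bracket (Ad g X) (Ad g Y).
Proof. exact: push_bracket (conj_auto g) X Y. Qed.

Lemma Ad_mul g h X : Ad (g * h)%g X = Ad g (Ad h X).
Proof.
apply/funext => f; apply/funext => x; rewrite /Ad /Defs.pushforward.
congr (X _ _); last by rewrite /conj !invgM !invgK !mulgA.
by apply/funext => y; rewrite /= /conj invgM !mulgA.
Qed.

Lemma Ad1 X : Ad 1%g X = X.
Proof.
apply/funext => f; apply/funext => x; rewrite /Ad /Defs.pushforward.
congr (X _ _); last by rewrite /conj !invg1 mul1g mulg1.
by apply/funext => y; rewrite /= /conj invg1 mul1g mulg1.
Qed.

Lemma AdK g X : Ad g^-1%g (Ad g X) = X.
Proof. by rewrite -Ad_mul mulVg Ad1. Qed.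

Lemma AdVK g X : Ad g (Ad g^-1%g X) = X.
Proof. by rewrite -Ad_mul mulgV Ad1. Qed.

Lemma d_invol_Ad phi g X : lie_involution phi ->
  d_invol phi (Ad g X) = Ad (phi g) (d_invol phi X).
Proof.
move=> phiI; have [_ m k] := phiI.
have m1 : phi 1%g = 1%g.
  have := m 1%g 1%g; rewrite mulg1 => /(congr1 (fun z => (phi 1%g)^-1 * z)%g).
  by rewrite mulVg mulKg.
have mV y : phi y^-1%g = (phi y)^-1%g.
  have : (phi y * phi y^-1)%g = 1%g by rewrite -m mulgV.
  by move=> /(congr1 (fun z => (phi y)^-1 * z)%g); rewrite mulKg mulg1.
apply/funext => f; apply/funext => x; rewrite /d_invol /Ad /Defs.pushforward.
congr (X _ _); last by rewrite /conj !invgK !m mV !k.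
by apply/funext => y; rewrite /= /conj !m mV.
Qed.

Lemma d_involK phi X : lie_involution phi -> d_invol phi (d_invol phi X) = X.
Proof. by move=> /invol_auto A; exact: pushK A X. Qed.

Lemma d_invol_comm phi psi X : (forall x, phi (psi x) = psi (phi x)) ->
  d_invol phi (d_invol psi X) = d_invol psi (d_invol phi X).
Proof.
move=> c; apply/funext => f; apply/funext => x; rewrite /d_invol /Defs.pushforward c.
by congr (X _ _); apply/funext => y; rewrite /= c.
Qed.

Lemma lie_derive_exp X f x : lie_algebra G X -> smooth_fun f ->
  is_derive (0 : R) 1 (fun t => f (x * lie_exp (t *: X))%g) (X f x).
Proof.
move=> XL sf; have [sg hom v] := lie_exp_curve XL.
have := velocity_mull x XL (v 0) sf.
by rewrite scale0r lie_exp0 mulg1.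
Qed.

Lemma smooth_curve_prod2 (a b : R -> G) : smooth_curve a -> smooth_curve b ->
  smooth_into (@atlas R n G) (fun p : R * R => a p.1 * b p.2)%g setT.
Proof.
move=> sa sb; apply: smooth_mul; first exact: openT.
  apply: (@smooth_into_comp _ _ _ _ (R * R)%type R a fst setT setT) => //.
  - exact: findim_R.
  - exact: openT.
  - exact: openT.
  - by move=> k; apply: Ck_fst; [exact: openT|apply: Ck_id; exact: openT].
apply: (@smooth_into_comp _ _ _ _ (R * R)%type R b snd setT setT) => //.
- exact: findim_R.
- exact: openT.
- exact: openT.
- by move=> k; apply: Ck_snd; [exact: openT|apply: Ck_id; exact: openT].
Qed.

Lemma derive_fst (H : R * R -> R) (s t : R) : differentiable H (s, t) ->
  is_derive s 1 (fun u => H (u, t)) ('D_((1 : R), (0 : R)) H (s, t)).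
Proof.
move=> dH; have did : differentiable (fun u : R => u) s by exact: ex_diff.
have dc : differentiable (fun u : R => t) s by exact: differentiable_cst.
have d := differentiable_pair did dc.
apply: DeriveDef; first by apply: diff_derivable; exact: (differentiable_comp d dH).
by rewrite (derive_comp (1 : R) d dH) (derive_pair _ did dc) derive_id derive_cst.
Qed.

Lemma derive_snd (H : R * R -> R) (s t : R) : differentiable H (s, t) ->
  is_derive t 1 (fun u => H (s, u)) ('D_((0 : R), (1 : R)) H (s, t)).
Proof.
move=> dH; have did : differentiable (fun u : R => u) t by exact: ex_diff.
have dc : differentiable (fun u : R => s) t by exact: differentiable_cst.
have d := differentiable_pair dc did.
apply: DeriveDef; first by apply: diff_derivable; exact: (differentiable_comp d dH).
by rewrite (derive_comp (1 : R) d dH) (derive_pair _ dc did) derive_id derive_cst.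
Qed.

Lemma is_derive_uniq (h : R -> R) (t a b : R) : is_derive t 1 h a -> is_derive t 1 h b -> a = b.
Proof. by move=> [_ <-] [_ <-]. Qed.

(* Both mixed second derivatives at 0 of f (x exp (t X) exp (s Y) exp (- t X)) and
   of f (x exp (t X) exp (s Y)) are exchanged by Schwarz's theorem. *)
Lemma Ad_derive X Y f x : lie_algebra G X -> lie_algebra G Y -> smooth_fun f ->
  is_derive (0 : R) 1 (fun t => Ad (lie_exp (t *: X)) Y f x) (bracket X Y f x).
Proof.
move=> XL YL sf.
have [sX hX vX] := lie_exp_curve XL; have [sY hY vY] := lie_exp_curve YL.
set a := fun t => lie_exp (t *: X) in sX hX vX *.
set b := fun t => lie_exp (t *: Y) in sY hY vY *.
have a0 : a 0 = 1%g by rewrite /a scale0r lie_exp0.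
have b0 : b 0 = 1%g by rewrite /b scale0r lie_exp0.
have sXV : smooth_curve (fun t => (a t)^-1%g) by apply: smooth_inv => //; exact: openT.
have oT : open (setT : set (R * R)) by exact: openT.
pose M (p : R * R) := f (x * (a p.1 * b p.2))%g.
have MC : Cinfty M setT.
  by apply: (smooth_fun_into oT (smooth_fun_mull x sf)); exact: smooth_curve_prod2.
pose K (p : R * R) := f (x * (a p.1 * b p.2 * (a p.1)^-1))%g.
have KC : Cinfty K setT.
  apply: (smooth_fun_into oT (smooth_fun_mull x sf)); apply: smooth_mul => //.
    exact: smooth_curve_prod2.
  apply: (@smooth_into_comp _ _ _ _ (R * R)%type R (fun t => (a t)^-1%g) fst setT setT) => //.
  - exact: findim_R.
  - exact: openT.
  - by move=> k; apply: Ck_fst => //; exact: Ck_id.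
have Kd p : differentiable K p by exact: (Cinfty_differentiable KC).
have Md p : differentiable M p by exact: (Cinfty_differentiable MC).
pose e1 : R * R := (1, 0); pose e2 : R * R := (0, 1).
have Kd1 v p : differentiable (fun q => 'D_v K q) p.
  exact: (Cinfty_differentiable (Cinfty_derive v KC)).
have Md1 v p : differentiable (fun q => 'D_v M q) p.
  exact: (Cinfty_differentiable (Cinfty_derive v MC)).
have E1 t : Ad (a t) Y f x = 'D_e2 K (t, 0).
  apply: (is_derive_uniq _ (derive_snd (Kd (t, 0)))).
  have := lie_derive_exp x (Ad_lie (a t) YL) sf.
  congr (is_derive _ _ _ _); apply/funext => s; rewrite /K /= /b.
  by rewrite -AdZ -Ad_exp//; exact: lieZ.
have E2 s : 'D_e1 M (0, s) = X (fun y => f (y * b s)%g) x.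
  apply: (is_derive_uniq (derive_fst (Md (0, s)))).
  have := lie_derive_exp x XL (smooth_fun_mulr (b s) sf).
  by congr (is_derive _ _ _ _); apply/funext => t; rewrite /M /= mulgA.
have E3 t : 'D_e2 M (t, 0) = Y f (x * a t)%g.
  apply: (is_derive_uniq (derive_snd (Md (t, 0)))).
  have := lie_derive_exp (x * a t)%g YL sf.
  by congr (is_derive _ _ _ _); apply/funext => s; rewrite /M /= mulgA.
(* The variable t occurs twice in [K]; the product rule at t = 0 gives X acting on the left of exp
   (s Y) and -X acting on its right. *)
have E4 s : 'D_e1 K (0, s) = X (fun y => f (y * b s)%g) x - X f (x * b s)%g.
  have H1 := derive_fst (Kd (0, s)).
  apply: (is_derive_uniq H1).
  have sXb : smooth_curve (fun t => x * a t * b s)%g.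
    apply: smooth_mul; [exact: openT| |exact: smooth_into_cst].
    by apply: smooth_mull => //; exact: openT.
  have := @curve_mul_derive R n G (fun t => x * a t * b s)%g (fun t => (a t)^-1)%g 1 f 0
    (X (fun y => f (y * b s)%g) x) (- X f (x * b s)%g)
    (smooth_curve_ball 1 sXb) (smooth_curve_ball 1 sXV) sf.
  rewrite normr0 ltr01 a0 mulg1 => /(_ isT) H.
  have : is_derive (0 : R) 1 (fun t => f (x * a t * b s * (a t)^-1)%g)
     (X (fun y => f (y * b s)%g) x - X f (x * b s)%g).
    apply: H.
      have := lie_derive_exp x XL (smooth_fun_mulr (b s) sf).
      by congr (is_derive _ _ _ _); apply/funext => t; rewrite invg1 mulg1.
    have := lie_derive_exp (x * b s)%g (lieN XL) sf.
    congr (is_derive _ _ _ _); apply/funext => t; congr (f (_ * _)%g).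
    by rewrite scalerN lie_expN//; exact: lieZ.
  by congr (is_derive _ _ _ _); apply/funext => t; rewrite /K /= !mulgA.
have -> : (fun t => Ad (a t) Y f x) = (fun t => 'D_e2 K (t, 0)).
  by apply/funext => t; exact: E1.
have -> : bracket X Y f x = 'D_e1 (fun q => 'D_e2 K q) (0, 0).
  rewrite (@schwarz R _ K (0, 0) e2 e1 setT oT I (KC 2%N)).
  have h1 := derive_snd (Kd1 e1 (0, 0)).
  have h2 := derive_snd (Md1 e1 (0, 0)).
  have h3 : is_derive (0 : R) 1 (fun s => X f (x * b s)%g) (Y (X f) x).
    by apply: lie_derive_exp => //; exact: lie_smooth.
  have h4 := is_deriveB h2 h3.
  have h5 : is_derive (0 : R) 1 (fun s => 'D_e1 K (0, s)) ('D_e2 (fun q => 'D_e1 M q) (0, 0) - Y (X f) x).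
    by have := h4; congr (is_derive _ _ _ _); apply/funext => s; rewrite E4 -E2.
  have <- := is_derive_uniq h5 h1.
  rewrite -(@schwarz R _ M (0, 0) e2 e1 setT oT I (MC 2%N)).
  rewrite /bracket; congr (_ - _).
  apply: (is_derive_uniq _ (derive_fst (Md1 e2 (0, 0)))).
  have := lie_derive_exp x XL (lie_smooth YL sf).
  by congr (is_derive _ _ _ _); apply/funext => t; rewrite E3.
exact: (derive_fst (Kd1 e2 (0, 0))).
Qed.

(** Conjugation by exp (t X) fixes the one-parameter group of X, hence its velocity. *)
Lemma Ad_exp_self X s t : lie_algebra G X -> Ad (lie_exp (t *: X)) (s *: X) = s *: X.
Proof.
move=> XL; have [sX hX vX] := lie_exp_curve XL.
suff H : Ad (lie_exp (t *: X)) X = X.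
  by rewrite AdZ H.
apply: (@velocity_uniq R n G (fun s => lie_exp (s *: X)) 0) => //; first exact: Ad_lie.
have := push_velocity (conj_auto (lie_exp (t *: X))) (vX 0).
rewrite -/(Ad _ X) => v f sf; have := v f sf.
have E u : conj (lie_exp (t *: X)) (lie_exp (u *: X)) = lie_exp (u *: X).
  have -> : lie_exp (u *: X) = (lie_exp (- t *: X) * lie_exp ((t + u) *: X))%g.
    by rewrite -hX addKr.
  rewrite /conj; set e := lie_exp (t *: X).
  have eV : (e * lie_exp (- t *: X))%g = 1%g by rewrite -hX addrN scale0r lie_exp0.
  have -> : e^-1%g = lie_exp (- t *: X).
    by rewrite -[RHS](mulKg e) eV mulg1.
  by rewrite mulgA eV mul1g -!hX; congr (lie_exp (_ *: X)); ring.
have -> : (fun s0 : R => f (conj (lie_exp (t *: X)) (lie_exp (s0 *: X)))) =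
    (fun s0 => f (lie_exp (s0 *: X))) by apply/funext => u; rewrite E.
by rewrite E.
Qed.

(** h t = Ad (exp (t X)) Y f x solves h' = r h, because Ad (exp (t X)) fixes X and so preserves the
    eigenvalue relation; multiplied by exp (- r t) it is constant. *)
Lemma Ad_exp_eigen X Y (r : R) : lie_algebra G X -> lie_algebra G Y ->
  bracket X Y = r *: Y -> Ad (lie_exp X) Y = expR r *: Y.
Proof.
move=> XL YL E; pose a t := lie_exp (t *: X).
have hX s t : a (s + t) = (a s * a t)%g by have [_ H _] := lie_exp_curve XL; exact: H.
apply: vfield_eq; [exact: Ad_lie|exact: lieZ|].
move=> f x sf.
pose h t := Ad (a t) Y f x.
have dh (t : R) : is_derive t 1 h (r * h t).
  have YtL : lie_algebra G (Ad (a t) Y) by exact: Ad_lie.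
  have := Ad_derive x XL YtL sf.
  have -> : bracket X (Ad (a t) Y) = r *: Ad (a t) Y.
    have <- : Ad (a t) X = X.
      by have := Ad_exp_self 1 t XL; rewrite scale1r.
    by rewrite -Ad_bracket E.
  rewrite -[(r *: _) f x]/(r * h t) => H.
  have H' : is_derive (- t + t) 1 (fun s => Ad (lie_exp (s *: X)) (Ad (a t) Y) f x) (r * h t).
    by rewrite addNr.
  have := is_derive_shift0 H'; congr (is_derive _ _ _ _); apply/funext => u.
  by rewrite -Ad_mul -/(a _) -hX addrAC addNr add0r.
have dk (t : R) : is_derive t 1 (fun t => expR (- (r * t)) * h t) 0.
  have d1 : is_derive t 1 (fun t : R => - (r * t)) (- r).
    have := is_deriveN (is_deriveZ r (is_derive_id t (1 : R))).
    by rewrite -[r *: 1]/(r * 1) mulr1.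
  have d2 := @is_derive1_comp R expR (fun t : R => - (r * t)) t _ _ (is_derive_expR (- (r * t))) d1.
  move: (is_deriveM d2 (dh t)); congr (is_derive _ _ _ _).
  by rewrite /GRing.scale /=; ring.
have c1 : `|1 : R| < 2 by rewrite normr1 ltr1n.
have := @is_derive0_cst R _ 2 (fun t _ => dk t) 1 c1.
rewrite mulr0 oppr0 expR0 mul1r mulr1 /h /a scale0r lie_exp0 Ad1 scale1r.
move=> /(congr1 (fun z => expR r * z)); rewrite mulrA -expRD addrN expR0 mul1r => ->.
by [].
Qed.

End Automorphisms.

(** * The Riemannian distance to the identity *)

Section Velocity.
Context {R : realType} {n : nat} {G : lieGroupType R n}.
Notation E := 'rV[R]_n.+1.
Implicit Types (X Y Z : vfield G) (f : G -> R) (gam : R -> G).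

(** [curve_length] integrates a chosen velocity at each time. The continuity in t needed for this
    integral comes from writing the coordinates as partial derivatives on the diagonal of [coordf]
    at (gam s)^-1 gam t. *)
Lemma curve_velocity gam : smooth_curve gam -> exists v : R -> E,
  (forall i, continuous (fun t => v t 0 i)) /\ forall t, velocity gam t (vf (v t)).
Proof.
move=> sg.
have oT : open [set: R * R] by exact: openT.
have sgV : smooth_curve (fun t => (gam t)^-1)%g by apply: smooth_inv => //; exact: openT.
pose c (i : 'I_n.+1) (p : R * R) := coordf G i ((gam p.1)^-1 * gam p.2)%g.
have cC i : Cinfty (c i) setT.
  apply: (smooth_fun_into oT (coordf_smooth i)).
  exact: (smooth_curve_prod2 sgV sg).
pose v (t : R) : E := \row_i 'D_((0 : R), (1 : R)) (c i) (t, t).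
exists v; split.
  move=> i; have H := Cinfty_continuous (Cinfty_derive ((0 : R), (1 : R)) (cC i)).
  have -> : (fun t => v t 0 i) = (fun t => 'D_((0 : R), (1 : R)) (c i) (t, t)).
    by apply/funext => t; rewrite mxE.
  move=> t; apply: (@continuous_comp _ _ _ (fun t : R => (t, t)) ('D_((0 : R), (1 : R)) (c i))).
    have CT : Ck 0 (fun t : R => t) setT by apply: Ck_id; exact: openT.
    exact: (Ck_pair openT CT CT t I).
  exact: H.
(* At a fixed t the velocity is computed in the chart at 1 as w; testing on the coordinate functions
   identifies w with [v t]. *)
move=> t; pose K (s : R) : E := kappa ((gam t)^-1 * gam s : G)%g.
pose U := [set: R] `&` (fun s => (gam t)^-1 * gam s)%g @^-1` cdom (chart1 G).
have stg : smooth_curve (fun s => (gam t)^-1 * gam s)%g by apply: smooth_mull => //; exact: openT.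
have oU : open U by apply: smooth_into_open stg; [exact: openT|exact: cdom_open].
have KC : Cinfty K U by apply: smooth_kappa => //; exact: openT.
have Ut : U t by split=> //=; rewrite mulVg; exact: chart1_dom.
have Kd : differentiable K t by exact: (Cinfty_differentiable KC).
pose w := 'D_(1 : R) K t.
have A : velocity gam t (vf w).
  move=> f sf; have Kt : K t = 0 by rewrite /K mulVg kappa1.
  pose F (u : E) := f (gam t * iota u)%g.
  have Fd : differentiable F (K t) by rewrite Kt; exact: mull_iota_differentiable.
  have E : \forall s \near t, F (K s) = f (gam s).
    apply: filterS (open_near oU Ut) => s [_ /= Us].
    by rewrite /F /K kappaK// mulgA mulgV mul1g.
  rewrite vfE// -/F -[X in 'D_w F X]Kt /w -(derive_comp _ Kd Fd).
  rewrite (near_eq_derive _ E); apply: DeriveDef => //.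
  by apply/diff_derivable/(near_eq_differentiable E)/differentiable_comp.
suff -> : v t = w by [].
apply/rowP => i; rewrite mxE.
have D1 := derive_snd (Cinfty_differentiable (cC i) (I : setT (t, t))).
have sc := smooth_fun_mull (gam t)^-1%g (coordf_smooth (G := G) i).
have D2 := A _ sc.
have := is_derive_uniq D1 D2 => ->.
have [_ _ _ _ ->] := vf_lie (G := G) w; last exact: coordf_smooth.
by rewrite mulVg; have := congr1 (fun u : E => u 0 i) (co_vf (G := G) w); rewrite mxE.
Qed.

End Velocity.

Section Compactness.
Context {R : realType}.

Lemma sum_continuous (T : topologicalType) (I : Type) (s : seq I) (h : I -> T -> R) (x : T) :
  (forall i, {for x, continuous (h i)}) -> {for x, continuous (fun y => \sum_(i <- s) h i y)}.
Proof.
move=> hc; elim: s => [|i s IH].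
  have -> : (fun y => \sum_(i <- [::]) h i y) = (fun=> 0) by apply/funext => y; rewrite big_nil.
  exact: cst_continuous.
have -> : (fun y => \sum_(j <- i :: s) h j y) = (fun y => h i y + \sum_(j <- s) h j y).
  by apply/funext => y; rewrite big_cons.
by apply: cvgD; [exact: hc|exact: IH].
Qed.

Lemma compact_rball m (r : R) : compact [set u : 'rV[R]_m | `|u| <= r].
Proof.
apply: bounded_closed_compact.
  by exists r; split; [exact: num_real|move=> x rx u /= /le_trans; apply; exact: ltW].
have -> : [set u : 'rV[R]_m | `|u| <= r] = (fun u : 'rV[R]_m => `|u|) @^-1` [set t : R | t <= r] by [].
apply: preimage_closed => [u _|]; [exact: norm_continuous|exact: closed_le].
Qed.

Lemma compact_sphere m : compact [set u : 'rV[R]_m | `|u| = 1].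
Proof.
apply: (subclosed_compact _ (@compact_rball m 1)); last by move=> u /= ->.
have -> : [set u : 'rV[R]_m | `|u| = 1] = (fun u : 'rV[R]_m => `|u|) @^-1` [set t : R | t = 1] by [].
apply: preimage_closed => [u _|]; [exact: norm_continuous|exact: closed_eq].
Qed.

Lemma compact_min (T : topologicalType) (A : set T) (h : T -> R) : compact A -> A !=set0 ->
  (forall x, A x -> {for x, continuous h}) -> exists2 c, A c & forall x, A x -> h c <= h x.
Proof.
move=> cA A0 hc; have [|c /set_mem Ac H] := @compact_EVT_min T R h A A0 cA.
  by apply: continuous_in_subspaceT => x /set_mem; exact: hc.
by exists c => // x /mem_set/H.
Qed.

End Compactness.

Section Distance.
Context {R : realType} {n : nat} {G : lieGroupType R n}.
Context (rho : G -> vfield G -> vfield G -> R) (rhoR : riemannian_metric rho).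
Notation E := 'rV[R]_n.+1.
Implicit Types (X Y Z : vfield G) (f : G -> R) (gam : R -> G).

Let e i : vfield G := vf (delta_mx 0 i).

Lemma rho_suml x (I : Type) (s : seq I) (r : I -> R) (X : I -> vfield G) Z :
  (forall i, lie_algebra G (X i)) -> lie_algebra G Z ->
  rho x (\sum_(i <- s) r i *: X i) Z = \sum_(i <- s) r i * rho x (X i) Z.
Proof.
case: rhoR => _ lin _ _ XL ZL; elim: s => [|i s IH].
  rewrite !big_nil; have := lin x (-1) 0 0 Z (lie0 (G := G)) (lie0 (G := G)) ZL.
  by rewrite scaler0 addr0 mulN1r addNr.
rewrite !big_cons lin ?IH//; apply: lie_sum_mem => j; exact: lieZ.
Qed.

Lemma rho_form x (v : E) :
  rho x (vf v) (vf v) = \sum_i \sum_j v 0 i * v 0 j * rho x (e i) (e j).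
Proof.
have [sym _ _ _] := rhoR.
have eL i : lie_algebra G (e i) by exact: vf_lie.
have vE : vf v = \sum_i v 0 i *: e i.
  rewrite {1}(row_sum_delta v); elim/big_rec2: _ => [|i X u _ <-]; first exact: vf0.
  exact: vf_linear.
rewrite {1}vE rho_suml//; last exact: vf_lie.
apply: eq_bigr => i _; rewrite sym//; last exact: vf_lie.
rewrite vE rho_suml// mulr_sumr; apply: eq_bigr => j _.
by rewrite sym// mulrA.
Qed.

Lemma rho_pos x (v : E) : v != 0 -> 0 < rho x (vf v) (vf v).
Proof.
case: rhoR => _ _ pos _ v0; apply: pos; first exact: vf_lie.
by apply: contra_neq v0 => /(congr1 (@co R n G)); rewrite co_vf -vf0 co_vf.
Qed.

Lemma speed_cont01 gam (v : R -> E) : smooth_curve gam ->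
  (forall i, continuous (fun t => v t 0 i)) ->
  cont01 (fun t => Num.sqrt (rho (gam t) (vf (v t)) (vf (v t)))).
Proof.
move=> [gc _] vc t t01; apply: (@continuous_comp _ _ _ _ Num.sqrt); last exact: sqrt_continuous.
suff : cont01 (fun t => \sum_i \sum_j v t 0 i * v t 0 j * rho (gam t) (e i) (e j)).
  move=> /(_ t t01).
  have -> : (fun t => \sum_i \sum_j v t 0 i * v t 0 j * rho (gam t) (e i) (e j)) =
      (fun t => rho (gam t) (vf (v t)) (vf (v t))) by apply/funext => s; rewrite rho_form.
  by [].
apply: cont01_sum => i; apply: cont01_sum => j; apply: cont01M.
  by apply: cont01M => s _; exact: vc.
move=> s _; apply: (@continuous_comp _ _ _ gam (fun x => rho x (e i) (e j))).
  exact: gc.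
by have [_ _ _ sm] := rhoR; apply/smooth_fun_continuous/sm; exact: vf_lie.
Qed.

Lemma curve_lengthE gam (v : R -> E) : (forall t, velocity gam t (vf (v t))) ->
  curve_length rho gam =
  int01 (fun t => Num.sqrt (rho (gam t) (vf (v t)) (vf (v t)))).
Proof.
move=> vv; rewrite /curve_length /int01; apply: eq_Rintegral => t _ /=.
suff -> : xget 0 [set X | has_velocity gam t X] = vf (v t) by [].
apply: xget_unique; first by split; [exact: vf_lie|exact: vv].
by move=> Y [YL vY]; apply: (velocity_uniq YL (vf_lie _) vY (vv t)).
Qed.

Lemma curve_length_ge0 gam : 0 <= curve_length rho gam.
Proof. by apply: Rintegral_ge0 => t _ /=; exact: sqrtr_ge0. Qed.

Lemma pw_ge0 x y L : pw_smooth_length rho x y L -> 0 <= L.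
Proof.
elim=> // gam z l _ _ l0; apply: addr_ge0 => //; exact: curve_length_ge0.
Qed.

Lemma pw_trans x y z L M : pw_smooth_length rho x y L -> pw_smooth_length rho y z M ->
  pw_smooth_length rho x z (L + M).
Proof.
elim=> [u|gam u l sg _ IH]; first by rewrite add0r.
by move=> /IH H; rewrite -addrA; exact: pw_cons.
Qed.

(** The hypothesis bounds the gradient of f by C; integrating along each smooth piece makes f
    Lipschitz for path length. Lower bounds on the distance follow without tracking paths in a
    chart. *)
Lemma pw_fun f (C x y L : R) (a b : G) : smooth_fun f ->
  (forall v z, `|vf v f z| <= C * Num.sqrt (rho z (vf v) (vf v))) ->
  pw_smooth_length rho a b L -> `|f b - f a| <= C * L.
Proof.
move=> sf H; elim=> [z|gam z l sg _ IH]; first by rewrite subrr normr0 mulr0.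
have -> : f z - f (gam 0) = (f z - f (gam 1)) + (f (gam 1) - f (gam 0)) by ring.
rewrite mulrDr addrC; apply: le_trans (ler_normD _ _) _; rewrite lerD//.
have [v [vc vv]] := curve_velocity sg.
rewrite (curve_lengthE vv).
have sc := speed_cont01 sg vc.
have gC : Cinfty (f \o gam) setT by exact: (smooth_fun_into openT sf sg).
have dc : cont01 (fun t => vf (v t) f (gam t)).
  have -> : (fun t => vf (v t) f (gam t)) = 'D_(1 : R) (f \o gam).
    by apply/funext => t; have [_ ->] := vv t f sf.
  by move=> t _; exact: (Cinfty_continuous (Cinfty_derive _ gC)).
have vd (t : R) : 0 <= t <= 1 -> is_derive t 1 (fun s => f (gam s)) (vf (v t) f (gam t)).
  by move=> _; exact: vv.
have <- : _ = f (gam 1) - f (gam 0) := int01_derive vd dc.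
rewrite -int01Z//; apply: le_trans (le_normr_Rintegral _ (integrable_itv dc)) _ => //.
apply: le_Rintegral => //.
- apply: integrable_itv => t t01.
  apply: (@continuous_comp _ _ _ (fun t => vf (v t) f (gam t)) (fun y => `|y|)); first exact: dc.
  exact: norm_continuous.
- by apply: integrable_itv => t t01; apply: continuousM; [exact: cst_continuous|exact: sc].
Qed.

Lemma sqrt_between (lo q hi t : R) : 0 <= lo -> lo <= q <= hi -> 0 <= t ->
  Num.sqrt lo * t <= Num.sqrt (q * t ^+ 2) <= Num.sqrt hi * t.
Proof.
move=> lo0 /andP[lq qh] t0; have q0 := le_trans lo0 lq.
rewrite sqrtrM// sqrtr_sqr ger0_norm// !ler_wpM2r//= ler_sqrt//.
exact: le_trans qh.
Qed.

Lemma sqrt_between0 (lo q hi t : R) : q = 0 -> t = 0 ->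
  Num.sqrt lo * t <= Num.sqrt q <= Num.sqrt hi * t.
Proof. by move=> -> ->; rewrite !mulr0 sqrtr0 lexx. Qed.

Lemma rho_scale x (r : R) (v : E) :
  rho x (vf (r *: v)) (vf (r *: v)) = rho x (vf v) (vf v) * r ^+ 2.
Proof.
rewrite [in LHS]rho_form rho_form mulr_suml; apply: eq_bigr => i _; rewrite mulr_suml.
apply: eq_bigr => j _; rewrite !mxE; ring.
Qed.

(** The quadratic form is continuous and positive on the compact product of a closed ball and the
    unit sphere; homogeneity extends the bounds to all v. *)
Lemma rho_bounds : exists m M : R, [/\ 0 < m, 0 < M & forall u v : E, `|u| <= rad G ->
  m * `|v| <= Num.sqrt (rho (iota u) (vf v) (vf v)) <= M * `|v|].
Proof.
pose A : set (E * E) := [set u : E | `|u| <= rad G] `*` [set u : E | `|u| = 1].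
have cA : compact A by apply: compact_setX; [exact: compact_rball|exact: compact_sphere].
have A0 : A !=set0.
  exists (0, const_mx 1); split => /=; first by rewrite normr0 ltW// rad_gt0.
  apply/eqP; rewrite eq_le; apply/andP; split.
    by apply: rV_norm_le => // j; rewrite mxE normr1.
  by have := rV_coord_le (const_mx 1 : E) 0; rewrite mxE normr1.
pose h (p : E * E) := rho (iota p.1) (vf p.2) (vf p.2).
have hc p : A p -> {for p, continuous h}.
  move=> [/= p1 _].
  have -> : h = fun p => \sum_i \sum_j p.2 0 i * p.2 0 j * rho (iota p.1) (e i) (e j).
    by apply/funext => q; rewrite /h rho_form.
  have c2 i : {for p, continuous (fun p : E * E => p.2 0 i)}.
    apply: (@continuous_comp _ _ _ snd (fun u : E => u 0 i)); first exact: cvg_snd.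
    exact: coord_continuous.
  apply: sum_continuous => i; apply: sum_continuous => j; apply: cvgM; first by apply: cvgM; exact: c2.
  apply: (@continuous_comp _ _ _ (fun p : E * E => iota p.1) (fun x => rho x (e i) (e j))).
    apply: (@continuous_comp _ _ _ fst iota); first exact: cvg_fst.
    by apply: iota_continuous; exact: rad_Dom.
  by have [_ _ _ sm] := rhoR; apply/smooth_fun_continuous/sm; exact: vf_lie.
have [c [/= c1 c2] cm] := compact_min cA A0 hc.
have [d [/= d1 d2] dM] := compact_min cA A0 (fun p Ap => continuousN (hc p Ap)).
have m0 : 0 < h c by apply: rho_pos; rewrite -normr_gt0 c2.
exists (Num.sqrt (h c)), (Num.sqrt (h d)); split.
- by rewrite sqrtr_gt0.
- by rewrite sqrtr_gt0; apply: rho_pos; rewrite -normr_gt0 d2.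
move=> u v ur; have [->|v0] := eqVneq v 0.
  have q0 : rho (iota u) (vf 0) (vf 0) = 0.
    have H := rho_scale (iota u) 0 0; rewrite scale0r expr0n mulr0 in H; exact: H.
  exact: sqrt_between0 q0 (normr0 _).
have nv : 0 < `|v| by rewrite normr_gt0.
have Auv : A (u, `|v|^-1 *: v).
  by split=> //=; rewrite normrZ normfV normr_id mulVf// gt_eqF.
have -> : rho (iota u) (vf v) (vf v) = h (u, `|v|^-1 *: v) * `|v| ^+ 2.
  rewrite -(rho_scale (iota u)) scalerA mulfV; last by rewrite gt_eqF.
  by rewrite scale1r.
apply: sqrt_between; [exact: ltW| |exact: ltW].
have h1 := cm _ Auv; have h2 := dM _ Auv.
by apply/andP; split; [exact: h1|rewrite -lerN2; exact: h2].
Qed.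

Lemma vf_sum (v : E) f x : smooth_fun f -> vf v f x = \sum_i v 0 i * e i f x.
Proof.
move=> sf; have vE : vf v = \sum_i v 0 i *: e i.
  rewrite {1}(row_sum_delta v); elim/big_rec2: _ => [|i X u _ <-]; first exact: vf0.
  exact: vf_linear.
rewrite vE; elim/big_ind2: _ => //.
by move=> X r Y s <- <-.
Qed.

(** On the compact image of the closed ball the partial derivatives are bounded and [rho_bounds]
    applies; off it the lift vanishes in a neighbourhood of the point, so the derivative is 0. *)
Lemma lift_gradient (phi : E -> R) : Cinfty phi (ball 0 (rad G)) -> exists2 C, 0 < C &
  forall v z, `|vf v (lift (G := G) phi) z| <= C * Num.sqrt (rho z (vf v) (vf v)).
Proof.
move=> phiC; set f := lift phi; have sf : smooth_fun f by exact: lift_smooth.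
have [m [M [m0 M0 mM]]] := rho_bounds.
pose B := [set u : E | `|u| <= rad G].
have cB : compact B by exact: compact_rball.
have B0 : B !=set0 by exists 0; rewrite /B /= normr0 ltW// rad_gt0.
have hc u : B u -> {for u, continuous (fun u : E => - \sum_i `|e i f (iota u)|)}.
  move=> ur; apply: continuousN; apply: sum_continuous => i.
  apply: (@continuous_comp _ _ _ (fun u : E => e i f (iota u))); last exact: norm_continuous.
  apply: (@continuous_comp _ _ _ (@iota R n G) (e i f)).
    by apply: iota_continuous; exact: rad_Dom.
  by apply/smooth_fun_continuous/vf_smooth.
have [c cb cM] := compact_min cB B0 hc.
set D := \sum_i `|e i f (iota c)| in cM.
have D0 : 0 <= D by apply: sumr_ge0.
exists ((D + 1) / m); first by rewrite divr_gt0// ltr_wpDl.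
move=> v z; have [[u [ur zE]]|nz] := pselect (exists u, `|u| <= rad G /\ z = iota u).
  have /andP[lo _] := mM u v ur; rewrite -zE in lo.
  apply: (@le_trans _ _ (D * `|v|)).
    rewrite vf_sum//; apply: le_trans (ler_norm_sum _ _ _) _.
    apply: (@le_trans _ _ (\sum_i `|e i f (iota u)| * `|v|)).
      apply: ler_sum => i _; rewrite normrM mulrC -zE ler_wpM2l//; exact: rV_coord_le.
    rewrite -mulr_suml ler_wpM2r//; have := cM u ur; rewrite lerN2; exact.
  apply: (@le_trans _ _ ((D + 1) * `|v|)); first by rewrite ler_wpM2r// lerDl.
  by rewrite -mulrA ler_wpM2l ?addr_ge0// ler_pdivlMl.
have -> : vf v f z = 0; last first.
  by rewrite normr0 mulr_ge0 ?sqrtr_ge0// divr_ge0 ?ltW// ltr_wpDl.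
have K : closed (@iota R n G @` B).
  apply: compact_closed; first exact: lie_hausdorff.
  apply: continuous_compact => //; apply: continuous_in_subspaceT => u /set_mem ur.
  by apply: iota_continuous; exact: rad_Dom.
have oK : open (~` (@iota R n G @` B)) by rewrite openC.
have nKz : (~` (@iota R n G @` B)) z by move=> [u ur zE]; apply: nz; exists u.
rewrite vfE// -[RHS](derive_cst (0 : R) (0 : E) v); apply: near_eq_derive.
have : \forall u \near (0 : E), (~` (@iota R n G @` B)) (z * iota u)%g.
  have : {for (0 : E), continuous (fun u : E => z * iota u : G)%g}.
    apply: (@continuous_comp _ _ _ (@iota R n G)); first exact: (iota_continuous (Dom0 G)).
    exact: mull_continuous.
  apply; rewrite /= iota0 mulg1; exact: open_near.
apply: filterS => u nu; rewrite /f /lift; case: pselect => //= cz.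
have [b1 b2 b3] := bumpP G.
rewrite b3 ?mul0r//; rewrite leNgt; apply/negP => lt.
apply: nu; exists (kappa (z * iota u)%g); last by rewrite kappaK.
rewrite /B /=; apply: ltW (lt_le_trans lt _).
by rewrite ler_pdivrMr// ler_peMr ?ltW ?rad_gt0// ltr1n.
Qed.

Lemma exp_curve_length (X : vfield G) x : lie_algebra G X ->
  pw_smooth_length rho x (x * lie_exp X)%g
    (int01 (fun t => Num.sqrt (rho (x * lie_exp (t *: X))%g X X))).
Proof.
move=> XL; have [sX _ vX] := lie_exp_curve XL.
have sg : smooth_curve (fun t => x * lie_exp (t *: X))%g by apply: smooth_mull => //; exact: openT.
have vv t : velocity (fun t => x * lie_exp (t *: X))%g t (vf (co X)).
  by rewrite -lie_vf//; exact: velocity_mull.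
have := @pw_cons R n G rho _ (x * lie_exp X)%g 0 sg.
rewrite scale1r scale0r lie_exp0 mulg1 addr0 => /(_ (pw_nil _ _)).
by rewrite (curve_lengthE (v := fun=> co X) vv) -lie_vf.
Qed.

Lemma exp_nbhs : nbhs (1%g : G) [set x | exists2 X, lie_algebra G X & x = lie_exp X].
Proof.
have [r [r0 H]] := @exp_onto R n G.
have := @kappa_continuous R n G 1%g (@chart1_dom R n G).
move=> /(_ [set u | `|u| <= r]) /=; rewrite /nbhs /= kappa1 => /(_ _).
have b : nbhs (0 : E) [set u | `|u| <= r].
  by apply/nbhs_ballP; exists r => //= u; rewrite ball0E => /ltW.
move=> /(_ b) k; apply: filterS2 k (open_near (cdom_open _) (@chart1_dom R n G)) => x kx cx.
have [_ [v [_ vE]]] := H _ kx; exists (vf v); first exact: vf_lie.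
by rewrite vE kappaK.
Qed.

(** The points reachable from 1 form an open set with open complement, as every point has a
    neighbourhood of points joined to it by an exponential curve. The infimum in [riemannian_dist]
    from 1 is thus over a nonempty set. *)
Lemma pw_joined : connected [set: G] -> forall x, exists L, pw_smooth_length rho 1%g x L.
Proof.
move=> cG; pose S := [set x | exists L, pw_smooth_length rho 1%g x L].
have nb x : nbhs x [set y | exists2 X, lie_algebra G X & y = (x * lie_exp X)%g].
  have H : nbhs (x^-1 * x)%g [set y : G | exists2 X, lie_algebra G X & y = lie_exp X].
    by rewrite mulVg; exact: exp_nbhs.
  have H2 : nbhs x [set y : G | exists2 X, lie_algebra G X & (x^-1 * y)%g = lie_exp X].
    exact: (@mull_continuous R n G x^-1%g x _ H).
  apply: filterS H2 => y [X XL yE]; exists X => //.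
  by rewrite -yE mulgA mulgV mul1g.
have oS : open S.
  rewrite openE => x [L xL]; apply: filterS (nb x) => _ [X XL ->].
  by eexists; apply: pw_trans xL (exp_curve_length x XL).
have cS : open (~` S).
  rewrite openE => x nx; apply: filterS (nb x) => _ [X XL ->] [L xL]; apply: nx.
  eexists; apply: (pw_trans xL).
  have := exp_curve_length (x * lie_exp X)%g (lieN XL).
  by rewrite lie_expN// mulgK; exact.
have : S = [set: G].
  apply: cG; first by exists 1%g, 0; exact: pw_nil.
    by exists S => //; rewrite setTI.
  by exists S; [rewrite -openC|rewrite setTI].
by move=> ST x; have : S x by rewrite ST.
Qed.

(** The lift of the constant 1 is Lipschitz and vanishes off the chart: a point closer than 1 / (2
    C1) stays in the chart with [bump] at least 1/2. Dividing the bound on each [coordf] by [bump]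
    costs the factor 2. *)
Lemma dist_lower : connected [set: G] -> exists C eps0 : R, [/\ 0 < C, 0 < eps0 &
  forall x eps, eps < eps0 -> ball_e rho eps x ->
    exists u : E, [/\ Dom G u, `|u| <= C * eps & x = iota u]].
Proof.
move=> cG; have oneC : Cinfty (fun=> 1 : R) (ball (0 : E) (rad G)) by move=> k; exact: Ck_cst.
have [C1 C10 H1] := lift_gradient oneC.
have coC (i : 'I_n.+1) : Cinfty (fun u : E => u 0 i) (ball 0 (rad G)).
  by move=> k; apply: Ck_coord; exact: ball_open.
pose C2 (i : 'I_n.+1) := s2val (cid2 (lift_gradient (coC i))).
have C20 i : 0 < C2 i by exact: (s2valP (cid2 (lift_gradient (coC i)))).
have H2 i := s2valP' (cid2 (lift_gradient (coC i))); rewrite -/(C2 _) in H2.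
exists (2 * \sum_i C2 i), (2 * C1)^-1; split.
- by rewrite mulr_gt0// (lt_le_trans (C20 ord0))// (bigD1 ord0)//= lerDl sumr_ge0// => i _; exact: ltW.
- by rewrite invr_gt0 mulr_gt0.
move=> x eps e0 xe.
have [|L xL Le] := inf_lt _ xe; first by have [L HL] := pw_joined cG x; exists L.
have L0 := pw_ge0 xL.
have s1 : smooth_fun (lift (G := G) (fun=> 1)) by exact: lift_smooth.
have A1 := pw_fun 0 0 s1 H1 xL; rewrite lift1 in A1.
have half : C1 * L <= 2^-1.
  rewrite -ler_pdivlMl// -invfM mulrC; exact/ltW/(lt_trans Le).
have cx : cdom (chart1 G) x.
  move: A1; rewrite /lift; case: pselect => //= _; rewrite sub0r normrN normr1 => h.
  by have : (1 : R) <= 2^-1 := le_trans h half; lra.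
have dx := Dom_kappa cx; exists (kappa x); split=> //; last by rewrite kappaK.
have bx : 2^-1 <= bump G (kappa x).
  move: A1; rewrite /lift; case: pselect => //= _; rewrite mulr1 => h.
  by have := le_trans h half; rewrite ler_norml => /andP[]; lra.
have S0 : 0 <= \sum_i C2 i by apply: sumr_ge0 => i _; exact: ltW.
apply: rV_norm_le => [|i].
  by rewrite mulr_ge0 ?mulr_ge0//; exact: le_trans L0 (ltW Le).
have A2 := pw_fun 0 0 (lift_smooth (coC i)) (H2 i) xL.
rewrite lift1 mxE subr0 /lift in A2; move: A2; case: pselect => //= _ A2.
have b0 : 0 < bump G (kappa x) by apply: lt_le_trans bx.
have : 2^-1 * `|kappa x 0 i| <= C2 i * L.
  apply: le_trans A2; rewrite normrM (gtr0_norm b0) ler_wpM2r//.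
have : C2 i * L <= (\sum_i C2 i) * eps.
  apply: ler_pM => //; [exact: ltW| |exact: ltW].
  by rewrite (bigD1 i)//= lerDl sumr_ge0// => j _; exact: ltW.
by lra.
Qed.

(** The test curve is exp (t v) for t in [0, 1]: its velocity is constantly v, and it stays in the
    ball where the metric is bounded by M. *)
Lemma dist_exp : exists C r : R, [/\ 0 < C, 0 < r & forall v : E, `|v| <= r ->
  riemannian_dist rho 1%g (lie_exp (vf v)) <= C * `|v|].
Proof.
have [m [M [m0 M0 mM]]] := rho_bounds.
have [d d0 Hd] := @expc_cdom R n G.
exists M, (Num.min d (rad G / 2)); split=> //.
  by rewrite lt_min d0 divr_gt0// rad_gt0.
move=> v; rewrite le_min => /andP[vd vr].
have H := exp_curve_length 1%g (vf_lie (G := G) v); rewrite mul1g in H.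
apply: (@le_trans _ _ (int01 (fun t => Num.sqrt (rho (1 * lie_exp (t *: vf v))%g (vf v) (vf v))))).
  by apply: ge_inf => //; exists 0 => L /= /pw_ge0.
have [sX _ _] := lie_exp_curve (vf_lie (G := G) v).
apply: le_trans (ler_norm _) _; apply: int01_bound.
  apply: (@speed_cont01 (fun t => 1 * lie_exp (t *: vf v))%g (fun=> v)) => [|i].
    by apply: smooth_mull => //; exact: openT.
  exact: cst_continuous.
move=> t /andP[t0 t1]; rewrite (ger0_norm (sqrtr_ge0 _)) mul1g.
have -> : t *: vf v = vf (t *: v) :> vfield G.
  by have := vf_linear (G := G) t v 0; rewrite vf0 !addr0 => ->.
have tv : `|t *: v| <= `|v| by rewrite normrZ ger0_norm// ler_piMl.
have [cE Hv] := Hd _ (le_trans tv vd).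
rewrite -(kappaK cE) -/(expc _ _); apply: (proj2 (andP (mM _ v _))).
apply: le_trans Hv _; have := le_trans tv vr; lra.
Qed.

End Distance.

(** * The Killing form *)

Section LieMatrix.
Context {R : realType} {n : nat} {G : lieGroupType R n}.
Notation E := 'rV[R]_n.+1.
Implicit Types (X Y Z : vfield G) (T S : vfield G -> vfield G).

Definition lin_lie T :=
  (forall (r : R) X Y, lie_algebra G X -> lie_algebra G Y ->
    T (r *: X + Y) = r *: T X + T Y) /\
  forall X, lie_algebra G X -> lie_algebra G (T X).

(** Row vectors are acted on from the right, so composition of maps reverses the matrix product. *)
Definition mxl T : 'M[R]_n.+1 := \matrix_i co (T (vf (delta_mx 0 i))).

Lemma vfD (u v : E) : vf (u + v) = vf u + vf v :> vfield G.
Proof. by have := vf_linear (G := G) 1 u v; rewrite !scale1r. Qed.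

Lemma coD X Y : co (X + Y) = co X + co Y.
Proof. by have := co_linear 1 X Y; rewrite !scale1r. Qed.

Lemma co0 : co (0 : vfield G) = 0.
Proof. by have := co_linear (-1) (0 : vfield G) 0; rewrite scaler0 addr0 scaleN1r addNr. Qed.

Lemma coZ (r : R) X : co (r *: X) = r *: co X.
Proof. by have := co_linear r X 0; rewrite co0 !addr0. Qed.

Lemma coB X Y : co (X - Y) = co X - co Y.
Proof. by rewrite coD -scaleN1r coZ scaleN1r. Qed.

Lemma co_sum (I : Type) (s : seq I) (F : I -> vfield G) :
  co (\sum_(i <- s) F i) = \sum_(i <- s) co (F i).
Proof. by elim/big_rec2: _ => [|i u X _ <-]; [exact: co0|exact: coD]. Qed.

Lemma co_inj X Y : lie_algebra G X -> lie_algebra G Y -> co X = co Y -> X = Y.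
Proof. by move=> XL YL e; rewrite (lie_vf XL) (lie_vf YL) e. Qed.

Lemma lin_lieZ T (r : R) X : lin_lie T -> lie_algebra G X -> T (r *: X) = r *: T X.
Proof.
move=> [H _] XL; have T0 : T 0 = 0.
  have := H (-1) 0 0 (lie0 (G := G)) (lie0 (G := G)).
  by rewrite scaler0 addr0 scaleN1r addNr.
by have := H r X 0 XL (lie0 (G := G)); rewrite T0 !addr0.
Qed.

Lemma lin_lieD T X Y : lin_lie T -> lie_algebra G X -> lie_algebra G Y ->
  T (X + Y) = T X + T Y.
Proof. by move=> [H _] XL YL; have := H 1 X Y XL YL; rewrite !scale1r. Qed.

Lemma lin_lie_sum T m (r : 'I_m -> R) (X : 'I_m -> vfield G) : lin_lie T ->
  (forall i, lie_algebra G (X i)) ->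
  T (\sum_i r i *: X i) = \sum_i r i *: T (X i).
Proof.
move=> TL XL; have [H _] := TL.
suff : lie_algebra G (\sum_i r i *: X i) /\
    T (\sum_i r i *: X i) = \sum_i r i *: T (X i) by case.
elim/big_rec2: _ => [|i U V _ [VL <-]].
  by split; [exact: lie0|have := lin_lieZ 0 TL (lie0 (G := G)); rewrite !scale0r].
by split; [apply: lieD => //; exact: lieZ|rewrite H].
Qed.

Lemma vf_delta_sum (u : E) : vf u = \sum_i u 0 i *: vf (delta_mx 0 i) :> vfield G.
Proof.
rewrite {1}(row_sum_delta u); elim/big_rec2: _ => [|i X v _ <-]; first exact: vf0.
exact: vf_linear.
Qed.

Lemma mxlE T u : lin_lie T -> co (T (vf u)) = u *m mxl T.
Proof.
move=> TL; rewrite vf_delta_sum lin_lie_sum//; last by move=> i; exact: vf_lie.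
rewrite co_sum mulmx_sum_row; apply: eq_bigr => i _.
by rewrite coZ rowK.
Qed.

Lemma mxlP T X : lin_lie T -> lie_algebra G X -> co (T X) = co X *m mxl T.
Proof. by move=> TL XL; rewrite -mxlE// -lie_vf. Qed.

Lemma mx_rV_eq m (A B : 'M[R]_(n.+1, m)) : (forall u : E, u *m A = u *m B) -> A = B.
Proof. by move=> H; apply/row_matrixP => i; rewrite !rowE H. Qed.

Lemma mxl_uniq T (A : 'M[R]_n.+1) : lin_lie T ->
  (forall X, lie_algebra G X -> co (T X) = co X *m A) -> mxl T = A.
Proof.
move=> TL H; apply: mx_rV_eq => u; rewrite -mxlE// H ?co_vf//; exact: vf_lie.
Qed.

Lemma lin_lie_comp T S : lin_lie T -> lin_lie S -> lin_lie (fun Z => T (S Z)).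
Proof.
move=> [T1 T2] [S1 S2]; split=> [r X Y XL YL|X XL]; last by apply/T2/S2.
by rewrite S1// T1//; exact: S2.
Qed.

Lemma mxl_comp T S : lin_lie T -> lin_lie S -> mxl (fun Z => T (S Z)) = mxl S *m mxl T.
Proof.
move=> TL SL; apply: mxl_uniq; first exact: lin_lie_comp.
by move=> X XL; rewrite mulmxA -mxlP// -mxlP//; case: SL => _; exact.
Qed.

(** [trace_on] picks an unspecified basis, whose size m is not known in advance to be n+1. The
    change of basis is therefore a pair of rectangular matrices inverse to each other, and cyclicity
    of the trace does the rest. *)
Lemma trace_on_lie T : lin_lie T -> trace_on (lie_algebra G) T = \tr (mxl T).
Proof.
move=> TL; rewrite /trace_on.
have [TL1 TL2] := TL.
have eL i : lie_algebra G (vf (delta_mx 0 i) : vfield G) by exact: vf_lie.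
apply: xget_unique.
  exists n.+1, (fun i => vf (delta_mx 0 i)), (mxl T)^T; split.
  - split=> // X XL; exists (co X); split; first by rewrite -vf_delta_sum -lie_vf.
    by move=> r ->; rewrite -vf_delta_sum co_vf.
  - move=> j; apply: co_inj; [exact: TL2|by apply: lie_sum_mem => i; exact: lieZ|].
    rewrite mxlE// -rowE co_sum; apply/rowP => k; rewrite mxE summxE.
    rewrite (bigD1 k)//= big1 => [|i ik].
      by rewrite coZ co_vf !mxE !eqxx mulr1 addr0.
    by rewrite coZ co_vf !mxE eqxx /= [k == i]eq_sym (negbTE ik) mulr0.
  - by rewrite mxtrace_tr.
move=> _ [m [e [M [[eB1 eB2] eM ->]]]].
pose P : 'M[R]_(m, n.+1) := \matrix_i co (e i).
have eP i : e i = vf (row i P) by rewrite rowK -lie_vf.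
pose Q : 'M[R]_(n.+1, m) := \matrix_j
  xget (0 : 'rV[R]_m) [set r : 'rV[R]_m | vf (delta_mx 0 j) = \sum_(i < m) r 0 i *: e i].
have QP : Q *m P = 1%:M.
  apply/row_matrixP => j; rewrite row_mul rowK row1 mulmx_sum_row.
  have [r [rE _]] := eB2 _ (eL j).
  case: xgetP => [q _ qE|/(_ r)]; last by [].
  rewrite -(co_vf (G := G) (delta_mx 0 j)) qE co_sum; apply: eq_bigr => i _.
  by rewrite coZ rowK.
have PQ : P *m Q = 1%:M.
  apply/row_matrixP => j; rewrite row1.
  have [r [rE rU]] := eB2 _ (eB1 j).
  have -> : delta_mx 0 j = r.
    rewrite -(rU (delta_mx 0 j))// (bigD1 j)//= big1 => [|i ij].
      by rewrite !mxE !eqxx scale1r addr0.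
    by rewrite !mxE eqxx /= (negbTE ij) scale0r.
  symmetry; apply: rU; apply: co_inj => //; first by apply: lie_sum_mem => i; exact: lieZ.
  have : row j P = row j (P *m Q) *m P by rewrite -row_mul -mulmxA QP mulmx1.
  rewrite rowK => ->; rewrite mulmx_sum_row co_sum; apply: eq_bigr => i _.
  by rewrite coZ rowK.
have PA : P *m mxl T = M^T *m P.
  apply/row_matrixP => j; rewrite !row_mul rowK -mxlP// eM co_sum mulmx_sum_row.
  by apply: eq_bigr => i _; rewrite coZ rowK !mxE.
by rewrite -mxtrace_tr -[M^T]mulmx1 -PQ mulmxA -PA mxtrace_mulC mulmxA QP mul1mx.
Qed.

Lemma ad_lin X : lie_algebra G X -> lin_lie (bracket X).
Proof.
by move=> XL; split=> [r Y Z YL ZL|Y YL]; [exact: bracket_linearr|exact: lie_bracket].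
Qed.

Definition adm X := mxl (bracket X).

Lemma killing_mx X Y : lie_algebra G X -> lie_algebra G Y ->
  killing X Y = \tr (adm Y *m adm X).
Proof.
move=> XL YL; rewrite /killing trace_on_lie.
  by rewrite mxl_comp//; exact: ad_lin.
by apply: lin_lie_comp; exact: ad_lin.
Qed.

Lemma adm_linear (r : R) X Y : lie_algebra G X -> lie_algebra G Y ->
  adm (r *: X + Y) = r *: adm X + adm Y.
Proof.
move=> XL YL; apply: mxl_uniq => [|Z ZL]; first by apply: ad_lin; exact: lie_combo.
rewrite bracket_linearl// mulmxDr -scalemxAr -!mxlP//; try exact: ad_lin.
by rewrite coD coZ.
Qed.

Lemma adm_bracket X Y : lie_algebra G X -> lie_algebra G Y ->
  adm (bracket X Y) = adm Y *m adm X - adm X *m adm Y.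
Proof.
move=> XL YL; apply: mxl_uniq => [|Z ZL]; first by apply: ad_lin; exact: lie_bracket.
rewrite mulmxBr !mulmxA -!mxlP//; try exact: ad_lin; try exact: lie_bracket.
by rewrite (jacobi XL YL ZL) coD addrK.
Qed.

Lemma killing_linear (r : R) X Y Z : lie_algebra G X -> lie_algebra G Y ->
  lie_algebra G Z -> killing (r *: X + Y) Z = r * killing X Z + killing Y Z.
Proof.
move=> XL YL ZL; rewrite !killing_mx//; last exact: lie_combo.
by rewrite adm_linear// mulmxDr linearD /= -scalemxAr linearZ.
Qed.

Lemma killing_sym X Y : lie_algebra G X -> lie_algebra G Y -> killing X Y = killing Y X.
Proof. by move=> XL YL; rewrite (killing_mx XL YL) (killing_mx YL XL) mxtrace_mulC. Qed.

Lemma killing_inv X Y Z : lie_algebra G X -> lie_algebra G Y -> lie_algebra G Z ->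
  killing (bracket Z X) Y = - killing X (bracket Z Y).
Proof.
move=> XL YL ZL.
rewrite (killing_mx (lie_bracket ZL XL) YL) (killing_mx XL (lie_bracket ZL YL)).
rewrite (adm_bracket ZL XL) (adm_bracket ZL YL).
move: (adm X) (adm Y) (adm Z) => x y z.
have trB (u v : 'M[R]_n.+1) : \tr (u - v) = \tr u - \tr v by exact: raddfB.
rewrite mulmxBr mulmxBl !trB opprB; congr (_ - _); last by rewrite mulmxA.
by rewrite mulmxA mxtrace_mulC mulmxA.
Qed.

Section PushForm.
Context (phi psi : G -> G) (A : automorphism phi psi).

Lemma push_lin : lin_lie (Defs.pushforward phi psi).
Proof. by split=> // X XL; exact: push_lie. Qed.

End PushForm.

(** The automorphism conjugates the operator ad X ad Y, which leaves its trace unchanged. *)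
Lemma killing_push phi psi X Y : automorphism phi psi -> lie_algebra G X ->
  lie_algebra G Y ->
  killing (Defs.pushforward phi psi X) (Defs.pushforward phi psi Y) = killing X Y.
Proof.
move=> A XL YL; have A' := automorphism_inv A.
set p := Defs.pushforward phi psi; set q := Defs.pushforward psi phi.
have pL := push_lin A; have qL := push_lin A'; rewrite -/p -/q in pL qL.
have aXY : lin_lie (fun Z => bracket X (bracket Y Z)) by apply: lin_lie_comp; exact: ad_lin.
rewrite /killing trace_on_lie; last first.
  by apply: lin_lie_comp; apply: ad_lin; exact: push_lie.
rewrite (trace_on_lie aXY).
have -> : (fun Z => bracket (p X) (bracket (p Y) Z)) =
    (fun Z => p (bracket X (bracket Y (q Z)))).
  apply/funext => Z.
  by rewrite /p !(push_bracket A) /q (pushK A').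
rewrite (mxl_comp (T := p) (S := fun Z => bracket X (bracket Y (q Z))))//; last first.
  exact: (lin_lie_comp (T := fun Z => bracket X (bracket Y Z)) aXY qL).
rewrite (mxl_comp (T := fun Z => bracket X (bracket Y Z)) (S := q))//.
rewrite mxtrace_mulC mulmxA -mxl_comp//.
have -> : mxl (fun Z => q (p Z)) = 1%:M.
  apply: mxl_uniq => [|Z ZL]; first exact: lin_lie_comp.
  by rewrite mulmx1 /q /p (pushK A).
by rewrite mul1mx.
Qed.

End LieMatrix.

(** * Commuting symmetric operators *)

Section Spectral.
Context {R : realType} {N : nat}.
Notation V := 'rV[R]_N.
Context (B : 'M[R]_N) (Bsym : B^T = B)
  (Bpos : forall v : V, v != 0 -> 0 < (v *m B *m v^T) 0 0).

Definition bip (u v : V) : R := (u *m B *m v^T) 0 0.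

Lemma bip_sym u v : bip u v = bip v u.
Proof.
by rewrite /bip -[in RHS](trmxK (v *m B *m u^T)) [in RHS]mxE !trmx_mul trmxK Bsym mulmxA.
Qed.

Lemma bipDl u v w : bip (u + v) w = bip u w + bip v w.
Proof. by rewrite /bip !mulmxDl mxE. Qed.

Lemma bipZl (r : R) u w : bip (r *: u) w = r * bip u w.
Proof. by rewrite /bip -!scalemxAl mxE. Qed.

Lemma bipDr u v w : bip w (u + v) = bip w u + bip w v.
Proof. by rewrite bip_sym bipDl !(bip_sym w). Qed.

Lemma bipZr (r : R) u w : bip w (r *: u) = r * bip w u.
Proof. by rewrite bip_sym bipZl (bip_sym w). Qed.

Lemma bip0 u : bip u u = 0 -> u = 0.
Proof.
move=> u0; apply/eqP/negP => /negP/Bpos; rewrite -/(bip u u) u0 ltxx.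
by [].
Qed.

Lemma bip_ge0 u : 0 <= bip u u.
Proof.
have [->|/Bpos/ltW] := eqVneq u 0; last exact.
by rewrite /bip !mul0mx mxE.
Qed.

Lemma B_unit : B \in unitmx.
Proof.
rewrite -row_free_unit -kermx_eq0; apply/eqP/row_matrixP => i; rewrite row0.
apply: bip0; rewrite /bip; have -> : row i (kermx B) *m B = 0.
  by rewrite -row_mul mulmx_ker row0.
by rewrite mul0mx mxE.
Qed.

(** The orthogonal of U is the kernel of B U^T. Its rank is complementary since B is invertible, and
    it meets U trivially by positivity. *)
Lemma orth_split (U : 'M[R]_N) (x : V) : exists y z : V,
  [/\ x = y + z, (y <= U)%MS & forall u : V, (u <= U)%MS -> bip z u = 0].
Proof.
pose K := kermx (B *m U^T).
have KP (z u : V) : (z <= K)%MS -> (u <= U)%MS -> bip z u = 0.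
  move=> /sub_kermxP zK /submxP[w ->]; rewrite /bip trmx_mul mulmxA -(mulmxA z) zK.
  by rewrite mul0mx mxE.
have rK : \rank K = (N - \rank U)%N.
  rewrite mxrank_ker; congr (_ - _)%N.
  by rewrite -[LHS]mxrank_tr trmx_mul trmxK mxrankMfree// Bsym row_free_unit B_unit.
have UK : (U :&: K)%MS = 0.
  apply/eqP; rewrite -submx0; apply/rV_subP => v; rewrite sub_capmx => /andP[vU vK].
  by rewrite (bip0 (KP _ _ vK vU)) sub0mx.
have full : (x <= U + K)%MS.
  apply: submx_full; rewrite /row_full.
  have := mxrank_sum_cap U K; rewrite UK mxrank0 addn0 rK => ->.
  by rewrite subnKC// rank_leq_col.
have /sub_addsmxP[[p q] /= ->] := full.
exists (p *m U), (q *m K); split=> //; first exact: submxMl.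
by move=> u; apply: KP; exact: submxMl.
Qed.

(** A matrix of maximal rank with row space in P exhausts P, since a further vector of P would raise
    the rank. This moves subspaces given as predicates to matrix algebra. *)
Lemma subspace_mx (P : set V) : Defs.subspace P -> exists U : 'M[R]_N, forall x, P x <-> (x <= U)%MS.
Proof.
move=> [P0 PD].
pose good (U : 'M[R]_N) := forall x : V, (x <= U)%MS -> P x.
have g0 : good 0 by move=> x; rewrite submx0 => /eqP ->.
pose Q m := `[< exists U, good U /\ \rank U = m >].
have exQ : exists m, Q m by exists 0%N; apply/asboolP; exists 0; rewrite mxrank0.
have bQ m : Q m -> (m <= N)%N by move=> /asboolP[U [_ <-]]; exact: rank_leq_col.
case: (ex_maxnP exQ bQ) => m /asboolP[U [gU rU]] mmax.
exists U => x; split=> [Px|]; last exact: gU.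
apply/negPn/negP => nx.
have gUx : good (U + x)%MS.
  move=> y /sub_addsmxP[[p q] /= ->].
  have -> : p *m U + q *m x = (q 0 0) *: x + p *m U.
    by rewrite addrC; congr (_ + _); rewrite {1}[q]mx11_scalar mul_scalar_mx.
  by apply: PD => //; apply: gU; exact: submxMl.
have : (\rank (U + x)%MS <= \rank U)%N by rewrite rU; apply: mmax; apply/asboolP; exists (U + x)%MS.
have sub : (U <= U + x)%MS by exact: addsmxSl.
move=> rk; apply: (negP nx).
have := mxrank_leqif_sup sub; move=> /geq_leqif; rewrite rk => H.
by apply: submx_trans (addsmxSr U x) _; rewrite -H.
Qed.

Definition symop (T : 'M[R]_N) := forall u v, bip (u *m T) v = bip u (v *m T).

(** An explicit t proportional to b makes the left side a positive multiple of b^2. *)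
Lemma quadratic0 (b c : R) : (forall t, 2 * t * b + t ^+ 2 * c <= 0) -> b = 0.
Proof.
move=> H; apply/eqP/negP => /negP b0.
have [c0|c0] := leP c 0.
  have := H (b / (1 - c)); have d : 0 < 1 - c by rewrite subr_gt0 (le_lt_trans c0).
  have -> : 2 * (b / (1 - c)) * b + (b / (1 - c)) ^+ 2 * c = b ^+ 2 * (2 - c) / (1 - c) ^+ 2.
    by field; rewrite gt_eqF.
  rewrite leNgt divr_gt0 ?exprn_gt0// mulr_gt0//; last by lra.
  by rewrite lt_neqAle eq_sym sqrf_eq0 b0 sqr_ge0.
have := H (b / c); have -> : 2 * (b / c) * b + (b / c) ^+ 2 * c = 3 * b ^+ 2 / c.
  by field; rewrite gt_eqF.
rewrite leNgt divr_gt0// mulr_gt0// lt_neqAle eq_sym sqrf_eq0 b0 sqr_ge0.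
by [].
Qed.

Lemma coord_sum_continuous (c : 'I_N -> R) (x : V) :
  {for x, continuous (fun u : V => \sum_i u 0 i * c i)}.
Proof.
apply: sum_continuous => i.
apply: (@continuousM _ _ (fun u : V => u 0 i) (fun=> c i)).
  exact: coord_continuous.
exact: cst_continuous.
Qed.

Lemma form_continuous (M : 'M[R]_N) : continuous (fun u : V => (u *m M *m u^T) 0 0).
Proof.
move=> x.
have -> : (fun u : V => (u *m M *m u^T) 0 0) =
    (fun u => \sum_i (\sum_j u 0 j * M j i) * u 0 i).
  by apply/funext => u; rewrite mxE; apply: eq_bigr => i _; rewrite !mxE.
apply: sum_continuous => i.
apply: (@continuousM _ _ (fun u : V => \sum_j u 0 j * M j i) (fun u : V => u 0 i)).
  exact: coord_sum_continuous.
exact: coord_continuous.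
Qed.

Lemma closed_row_space (U : 'M[R]_N) : closed [set u : V | (u <= U)%MS].
Proof.
pose h (u : V) := \sum_j `|\sum_i u 0 i * cokermx U i j|.
have -> : [set u : V | (u <= U)%MS] = h @^-1` [set t : R | t = 0].
  apply/seteqP; split=> u /=; rewrite /h submxE.
    move=> /eqP u0; apply: big1 => j _.
    by have := congr1 (fun w : 'rV_N => w 0 j) u0; rewrite !mxE => ->; rewrite normr0.
  move=> h0; apply/eqP/rowP => j; rewrite !mxE; apply/eqP; rewrite -normr_eq0.
  by have /psumr_eq0P := h0; move=> ->.
apply: preimage_closed => [u _|]; last exact: closed_eq.
apply: sum_continuous => j.
apply: (@continuous_comp _ _ _ (fun u : V => \sum_i u 0 i * cokermx U i j)).
  exact: coord_sum_continuous.
exact: norm_continuous.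
Qed.

(* Compactness of the unit sphere of U gives a minimum of the Rayleigh quotient,
   and a minimizer is an eigenvector. *)
Lemma symop_eigen (U T : 'M[R]_N) : U != 0 -> (U *m T <= U)%MS -> symop T ->
  exists (r : R) (v : V), [/\ v != 0, (v <= U)%MS & v *m T = r *: v].
Proof.
move=> U0 UT sT.
pose S := [set u : V | `|u| = 1] `&` [set u : V | (u <= U)%MS].
have cS : compact S.
  apply: (subclosed_compact _ (@compact_sphere R N)); last by move=> u [].
  apply: closedI; last exact: closed_row_space.
  exact: compact_closed (@norm_hausdorff _ _) (@compact_sphere R N).
have S0 : S !=set0.
  have /rowV0Pn[v vU v0] := U0; exists (`|v|^-1 *: v); split.
    by rewrite /= normrZ normfV normr_id mulVf// normr_eq0.
  exact: scalemx_sub.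
have nz u : S u -> u != 0 by move=> [/= u1 _]; rewrite -normr_eq0 u1 oner_neq0.
pose f (u : V) := bip (u *m T) u / bip u u.
have fc u : S u -> {for u, continuous f}.
  move=> Su; have bu : bip u u != 0 by rewrite gt_eqF// Bpos// nz.
  apply: (@continuousM _ _ (fun u : V => bip (u *m T) u) (fun u : V => (bip u u)^-1)).
    have -> : (fun u : V => bip (u *m T) u) = (fun u : V => (u *m (T *m B) *m u^T) 0 0).
      by apply/funext => w; rewrite /bip mulmxA.
    exact: form_continuous.
  by apply: continuousV => //; exact: form_continuous.
have [v [v1 vU] vmin] := compact_min cS S0 fc.
have v0 : v != 0 by apply: nz.
pose r := f v; exists r, v; split=> //.
(* The form q is nonnegative on U by minimality of r and vanishes at v, so its first variation at v
   vanishes; this is the eigenvector equation tested against U. *)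
pose q u w := bip (u *m T) w - r * bip u w.
have q0 u : (u <= U)%MS -> 0 <= q u u.
  move=> uU; have [->|u0] := eqVneq u 0.
    by rewrite /q /bip !mul0mx mxE mulr0 subr0.
  have nu : 0 < `|u| by rewrite normr_gt0.
  have Su : S (`|u|^-1 *: u).
    by split; [rewrite /= normrZ normfV normr_id mulVf// gt_eqF|exact: scalemx_sub].
  have := vmin _ Su; rewrite -/r /f -scalemxAl !bipZl !bipZr.
  have bu := Bpos u0; rewrite -/(bip u u) in bu.
  rewrite ler_pdivlMr ?mulr_gt0 ?invr_gt0// /q subr_ge0.
  have -> : r * (`|u|^-1 * (`|u|^-1 * bip u u)) = (`|u|^-1 ^+ 2) * (r * bip u u) by ring.
  have -> : `|u|^-1 * (`|u|^-1 * bip (u *m T) u) = (`|u|^-1 ^+ 2) * bip (u *m T) u by ring.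
  by rewrite ler_pM2l// exprn_gt0// invr_gt0.
have qv : q v v = 0.
  by rewrite /q /r /f divfK ?subrr// gt_eqF// Bpos.
have key w : (w <= U)%MS -> bip (v *m T - r *: v) w = 0.
  move=> wU; apply/oppr_inj; rewrite oppr0.
  apply: (@quadratic0 _ (- q w w)) => t.
  have := q0 (v + t *: w) (addmx_sub vU (scalemx_sub _ wU)).
  rewrite /q mulmxDl -scalemxAl !bipDl !bipDr !bipZl !bipZr.
  rewrite -[- (r *: v)]scaleNr [bip (- r *: v) w]bipZl.
  move: qv; rewrite /q (sT w v) (bip_sym w v) (bip_sym w (v *m T)) => qv.
  by move=> h; move: h qv; set aa := bip (v *m T) v; set bb := bip (v *m T) w;
    set cc := bip (w *m T) w; set dd := bip v v; set ee := bip v w; set ff := bip w w => h qv; lra.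
apply/eqP; rewrite -subr_eq0; apply/eqP/bip0; apply: key.
by apply: addmx_sub; [exact: submx_trans (submxMr _ vU) UT|rewrite eqmx_opp scalemx_sub].
Qed.

Section Joint.
Context (I : Type) (T : I -> 'M[R]_N) (Tsym : forall i, symop (T i))
  (Tcomm : forall i j, T i *m T j = T j *m T i).

Definition joint_eigen (v : V) := forall i, exists r : R, v *m T i = r *: v.

Definition stable (U : 'M[R]_N) := forall i, (U *m T i <= U)%MS.

(** If every operator is scalar on U, any nonzero vector will do. Otherwise some [T i] has an
    eigenspace that is nonzero and proper in U; commutation makes it stable, and the rank drops. *)
Lemma joint_eigen_exists U : U != 0 -> stable U ->
  exists v, [/\ v != 0, (v <= U)%MS & joint_eigen v].
Proof.
have [m] := ubnP (\rank U); elim: m U => // m IH U rU U0 sU.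
have [all|/existsNP[i ni]] :=
    pselect (forall i, exists r : R, forall v : V, (v <= U)%MS -> v *m T i = r *: v).
  have /rowV0Pn[v vU v0] := U0; exists v; split=> // i.
  by have [r Hr] := all i; exists r; exact: Hr.
have [r [v [v0 vU vE]]] := symop_eigen U0 (sU i) (Tsym i).
pose K := kermx (T i - r%:M).
have KP (u : V) : (u <= K)%MS = (u *m T i == r *: u).
  by rewrite sub_kermx mulmxBr mul_mx_scalar subr_eq0.
have [|||w [w0 wUK wJ]] := IH (U :&: K)%MS.
- have sub : (U :&: K <= U)%MS by exact: capmxSl.
  have := mxrank_leqif_sup sub; move=> /ltn_leqif => H.
  rewrite -ltnS; apply: leq_trans rU; rewrite ltnS H; apply/negP => UUK; apply: ni.
  exists r => u uU; apply/eqP; rewrite -KP.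
  by have := submx_trans uU UUK; rewrite sub_capmx => /andP[].
- apply/negP => /eqP c0; have : (v <= U :&: K)%MS by rewrite sub_capmx vU KP vE eqxx.
  by rewrite c0 submx0 (negbTE v0).
- move=> j; apply/rV_subP => u /submxP[w ->].
  set x := w *m (U :&: K)%MS; rewrite mulmxA -/x.
  have : (x <= U :&: K)%MS by exact: submxMl.
  rewrite !sub_capmx => /andP[xU xK]; apply/andP; split.
    exact: submx_trans (submxMr _ xU) (sU j).
  move: xK; rewrite !KP => /eqP xr.
  have e : x *m T j *m T i = x *m T i *m T j by rewrite -!mulmxA Tcomm.
  by rewrite e xr -scalemxAl.
by exists w; split=> //; move: wUK; rewrite sub_capmx => /andP[].
Qed.

(** A joint eigenvector is split off and the induction goes on with its orthogonal in U, which is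
    stable because the operators are symmetric. *)
Lemma joint_eigen_sum x : exists s : seq V, (forall v, v \in s -> joint_eigen v) /\
  x = \sum_(v <- s) v.
Proof.
suff H U : stable U -> (x <= U)%MS -> exists s : seq V,
    (forall v, v \in s -> joint_eigen v) /\ x = \sum_(v <- s) v.
  by apply: (H 1%:M) => [i|]; exact: submx1.
have [m] := ubnP (\rank U); elim: m U x => // m IH U x rU sU xU.
have [U0|U0] := eqVneq U 0.
  exists [::]; split=> //; rewrite big_nil.
  by move: xU; rewrite U0 submx0 => /eqP.
have [v [v0 vU vJ]] := joint_eigen_exists U0 sU.
pose K := kermx (B *m v^T).
have KP (u : V) : (u <= K)%MS = (bip u v == 0).
  rewrite sub_kermx mulmxA /bip; apply/eqP/eqP => [->|u0]; first by rewrite mxE.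
  by apply/matrixP => i j; rewrite !ord1 u0 mxE.
have bv := Bpos v0; rewrite -/(bip v v) in bv.
have stUK : stable (U :&: K)%MS.
  move=> j; apply/rV_subP => u /submxP[w ->].
  set y := w *m (U :&: K)%MS; rewrite mulmxA -/y.
  have : (y <= U :&: K)%MS by exact: submxMl.
  rewrite !sub_capmx => /andP[yU yK]; apply/andP; split.
    exact: submx_trans (submxMr _ yU) (sU j).
  move: yK; rewrite !KP => /eqP yv; have [r vE] := vJ j.
  by rewrite Tsym vE bipZr yv mulr0.
pose t := bip x v / bip v v.
have xt : (x - t *: v <= U :&: K)%MS.
  rewrite sub_capmx; apply/andP; split.
    by apply: addmx_sub => //; rewrite eqmx_opp scalemx_sub.
  by rewrite KP -scaleN1r scalerA bipDl bipZl /t mulN1r mulNr divfK ?subrr// gt_eqF.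
have [|s [sJ sE]] := IH (U :&: K)%MS (x - t *: v) _ stUK xt.
  have sub : (U :&: K <= U)%MS by exact: capmxSl.
  have := mxrank_leqif_sup sub; move=> /ltn_leqif => H.
  rewrite -ltnS; apply: leq_trans rU; rewrite ltnS H; apply/negP => UUK.
  have := submx_trans vU UUK; rewrite sub_capmx => /andP[_].
  by rewrite KP gt_eqF.
exists (t *: v :: s); split=> [u|].
  rewrite in_cons => /orP[/eqP ->|/sJ//] i; have [r vE] := vJ i.
  by exists r; rewrite -scalemxAl vE !scalerA mulrC.
by rewrite big_cons -sE addrC subrK.
Qed.

End Joint.

End Spectral.

(** * The inner product of a Cartan involution *)

Section InnerProduct.
Context {R : realType} {n : nat} {G : lieGroupType R n}.
Notation E := 'rV[R]_n.+1.
Implicit Types (X Y Z : vfield G).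
Context (theta : G -> G) (thC : cartan_involution theta).

Notation th := (d_invol theta).

Let thI : lie_involution theta.
Proof. by case: thC. Qed.

Let thA := invol_auto thI.

Lemma d_invol_lin phi : lie_involution phi -> lin_lie (@d_invol R n G phi).
Proof. by move=> /invol_auto A; exact: push_lin A. Qed.

Lemma d_invol_lie phi X : lie_involution phi -> lie_algebra G X -> lie_algebra G (d_invol phi X).
Proof. by move=> pI; have [_] := d_invol_lin pI; exact. Qed.

Lemma d_invol_bracket phi X Y : lie_involution phi ->
  d_invol phi (bracket X Y) = bracket (d_invol phi X) (d_invol phi Y).
Proof. by move=> /invol_auto A; exact: push_bracket A X Y. Qed.

Definition cartan_form X Y := - killing X (th Y).

Notation ip := cartan_form.

Lemma ip_linear (r : R) X Y Z : lie_algebra G X -> lie_algebra G Y -> lie_algebra G Z ->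
  ip (r *: X + Y) Z = r * ip X Z + ip Y Z.
Proof.
move=> XL YL ZL; rewrite /cartan_form (killing_linear r XL YL (d_invol_lie thI ZL)).
by rewrite opprD mulrN.
Qed.

Lemma ip_sym X Y : lie_algebra G X -> lie_algebra G Y -> ip X Y = ip Y X.
Proof.
move=> XL YL; have TL := d_invol_lie thI.
rewrite /cartan_form -(killing_push thA XL (TL _ YL)) -!/(d_invol theta _) (d_involK _ thI).
by rewrite (killing_sym (TL _ XL) YL).
Qed.

Lemma ip_pos X : lie_algebra G X -> X != 0 -> 0 < ip X X.
Proof. by case: thC => _; exact. Qed.

Lemma ip_push phi psi X Y : automorphism phi psi ->
  (forall Z, th (Defs.pushforward phi psi Z) = Defs.pushforward phi psi (th Z)) ->
  lie_algebra G X -> lie_algebra G Y ->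
  ip (Defs.pushforward phi psi X) (Defs.pushforward phi psi Y) = ip X Y.
Proof.
by move=> A c XL YL; rewrite /cartan_form c (killing_push A XL (d_invol_lie thI YL)).
Qed.

Lemma ip_th X Y : lie_algebra G X -> lie_algebra G Y -> ip (th X) (th Y) = ip X Y.
Proof. exact: ip_push. Qed.

(** Invariance of the Killing form gives one sign and theta X = - X another, so ad X is
    symmetric. *)
Lemma ip_ad X Y Z : lie_algebra G X -> lie_algebra G Y -> lie_algebra G Z -> th X = - X ->
  ip (bracket X Y) Z = ip Y (bracket X Z).
Proof.
move=> XL YL ZL Xp; rewrite /cartan_form (killing_inv YL (d_invol_lie thI ZL) XL) opprK.
rewrite (d_invol_bracket _ _ thI) Xp.
have -> : bracket (- X) (th Z) = - bracket X (th Z).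
  have := bracket_linearl (-1) (d_invol_lie thI ZL) XL (lie0 (G := G)).
  rewrite !scaleN1r !addr0 => ->; have -> : bracket 0 (th Z) = 0 :> vfield G.
    have := bracket_linearl (-1) (d_invol_lie thI ZL) (lie0 (G := G)) (lie0 (G := G)).
    by rewrite scaler0 addr0 scaleN1r addNr.
  by rewrite addr0.
have BL := lie_bracket XL (d_invol_lie thI ZL).
rewrite (killing_sym YL BL) (killing_sym YL (lieN BL)).
have := killing_linear (-1) BL (lie0 (G := G)) YL; rewrite scaleN1r addr0 => ->.
have := killing_linear (-1) (lie0 (G := G)) (lie0 (G := G)) YL.
rewrite scaler0 addr0 mulN1r addNr => ->.
by rewrite addr0 mulN1r opprK.
Qed.

Definition gram : 'M[R]_n.+1 := \matrix_(i, j) ip (vf (delta_mx 0 i)) (vf (delta_mx 0 j)).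

Lemma ip0l Z : lie_algebra G Z -> ip 0 Z = 0.
Proof.
move=> ZL; have := ip_linear (-1) (lie0 (G := G)) (lie0 (G := G)) ZL.
by rewrite scaler0 addr0 mulN1r addNr.
Qed.

Lemma ip_suml m (r : 'I_m -> R) (X : 'I_m -> vfield G) Z :
  (forall i, lie_algebra G (X i)) -> lie_algebra G Z ->
  ip (\sum_i r i *: X i) Z = \sum_i r i * ip (X i) Z.
Proof.
move=> XL ZL; suff : lie_algebra G (\sum_i r i *: X i) /\
    ip (\sum_i r i *: X i) Z = \sum_i r i * ip (X i) Z by case.
elim/big_rec2: _ => [|i U V _ [VL <-]]; first by split; [exact: lie0|exact: ip0l].
by split; [apply: lieD => //; exact: lieZ|exact: ip_linear].
Qed.

Lemma ip_vf (u v : E) : ip (vf u) (vf v) = bip gram u v.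
Proof.
have eL i : lie_algebra G (vf (delta_mx 0 i) : vfield G) by exact: vf_lie.
rewrite (vf_delta_sum u) (ip_suml (fun i => u 0 i) eL (vf_lie v)).
rewrite /bip -mulmxA mxE; apply: eq_bigr => i _; congr (_ * _).
rewrite (ip_sym (eL i) (vf_lie v)) (vf_delta_sum v) (ip_suml (fun i => v 0 i) eL (eL i)).
rewrite mxE; apply: eq_bigr => j _.
by rewrite !mxE mulrC (ip_sym (eL j) (eL i)).
Qed.

Lemma ip_co X Y : lie_algebra G X -> lie_algebra G Y -> ip X Y = bip gram (co X) (co Y).
Proof. by move=> XL YL; rewrite -ip_vf -!lie_vf. Qed.

Lemma gram_sym : gram^T = gram.
Proof. by apply/matrixP => i j; rewrite !mxE ip_sym//; exact: vf_lie. Qed.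

Lemma gram_pos (v : E) : v != 0 -> 0 < (v *m gram *m v^T) 0 0.
Proof.
move=> v0; rewrite -[ltRHS]/(bip gram v v) -ip_vf; apply: ip_pos; first exact: vf_lie.
by apply: contra_neq v0 => /(congr1 (@co R n G)); rewrite co_vf co0.
Qed.

(** Equivalence of norms in the form used later: an isometry of the inner product, such as theta or
    Ad k with k fixed by theta, changes the coordinate norm by a factor of at most L. *)
Lemma norm_ip_le : exists2 L : R, 1 <= L & forall X Y, lie_algebra G X -> lie_algebra G Y ->
  ip X X <= ip Y Y -> `|co X| <= L * `|co Y|.
Proof.
pose S : set E := [set u : E | `|u| = 1].
have S0 : S !=set0.
  have d0 : (delta_mx 0 0 : E) != 0.
    by apply/negP => /eqP/matrixP/(_ 0 0)/eqP; rewrite !mxE !eqxx oner_eq0.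
  exists (`|delta_mx 0 0 : E|^-1 *: delta_mx 0 0).
  by rewrite /S /= normrZ normfV normr_id mulVf// normr_eq0.
have fc u : S u -> {for u, continuous (fun u : E => (u *m gram *m u^T) 0 0)}.
  by move=> _; exact: form_continuous.
have fcN u : S u -> {for u, continuous (fun u : E => - (u *m gram *m u^T) 0 0)}.
  by move=> Su; apply: continuousN; exact: fc.
have [c c1 cm] := compact_min (compact_sphere (m := n.+1)) S0 fc.
have [d d1 dM] := compact_min (compact_sphere (m := n.+1)) S0 fcN.
have nz (u : E) : `|u| = 1 -> u != 0 by move=> u1; rewrite -normr_eq0 u1 oner_neq0.
move: cm dM (gram_pos (nz _ c1)) (gram_pos (nz _ d1)).
set m := (c *m gram *m c^T) 0 0; set M := (d *m gram *m d^T) 0 0 => cm dM m0 M0.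
have H (u : E) : m * `|u| ^+ 2 <= bip gram u u <= M * `|u| ^+ 2.
  have [->|u0] := eqVneq u 0; first by rewrite /bip !mul0mx mxE normr0 expr0n !mulr0 lexx.
  have nu : 0 < `|u| by rewrite normr_gt0.
  have Su : S (`|u|^-1 *: u) by rewrite /S /= normrZ normfV normr_id mulVf// gt_eqF.
  have := cm _ Su; have := dM _ Su; rewrite lerN2.
  rewrite -!/(bip gram _ _) (bipZl gram) (bipZr gram_sym) => h1 h2.
  have -> : bip gram u u = (`|u|^-1 * (`|u|^-1 * bip gram u u)) * `|u| ^+ 2.
    by field; rewrite gt_eqF.
  by rewrite !ler_pM2r ?exprn_gt0// h2 h1.
have q0 : 0 <= M / m by rewrite divr_ge0// ltW.
(* M / m + 1 serves as an upper bound for the square root of M / m. *)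
exists (M / m + 1); first by rewrite lerDr.
move=> X Y XL YL; rewrite (ip_co XL XL) (ip_co YL YL) => XY.
have /andP[h1 _] := H (co X); have /andP[_ h2] := H (co Y).
rewrite -(@ler_pXn2r _ 2)// ?nnegrE ?mulr_ge0 ?addr_ge0// exprMn.
have h3 : `|co X| ^+ 2 <= (M / m) * `|co Y| ^+ 2.
  rewrite mulrAC ler_pdivlMr// mulrC; exact: le_trans h1 (le_trans XY h2).
apply: le_trans h3 _; rewrite ler_wpM2r ?sqr_ge0//.
by rewrite sqrrD1; have := sqr_ge0 (M / m); lra.
Qed.

End InnerProduct.

(** * Restricted roots *)

Section Weights.
Context {R : realType} {n : nat} {G : lieGroupType R n}.
Notation E := 'rV[R]_n.+1.
Implicit Types (X Y Z e : vfield G).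
Context (theta : G -> G) (thC : cartan_involution theta).
Context (a : set (vfield G)) (aA : abelian_subspace a) (ap : a `<=` minus_eigenspace theta).

Notation th := (d_invol theta).
Notation ip := (cartan_form theta).

Let thI : lie_involution theta.
Proof. by case: thC. Qed.

Lemma a_lie X : a X -> lie_algebra G X.
Proof. by move=> /ap[]. Qed.

Lemma bracketNl X Y : lie_algebra G X -> lie_algebra G Y -> bracket (- X) Y = - bracket X Y.
Proof.
move=> XL YL; have := bracket_linearl (-1) YL (lieB XL XL) XL.
have b0 : bracket 0 Y = 0.
  have := bracket_linearl (-1) YL (lie0 (G := G)) (lie0 (G := G)).
  by rewrite scaler0 addr0 scaleN1r addNr.
have := bracket_linearl (-1) YL XL (lie0 (G := G)).
by rewrite !scaleN1r addr0 b0 addr0.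
Qed.

Lemma bracketZr (r : R) X Y : lie_algebra G X -> lie_algebra G Y ->
  bracket X (r *: Y) = r *: bracket X Y.
Proof. by move=> XL YL; exact: lin_lieZ (ad_lin XL) YL. Qed.

Lemma bracketDr X Y Z : lie_algebra G X -> lie_algebra G Y -> lie_algebra G Z ->
  bracket X (Y + Z) = bracket X Y + bracket X Z.
Proof. by move=> XL YL ZL; exact: lin_lieD (ad_lin XL) YL ZL. Qed.

Lemma root_space_lie alpha e : root_space a alpha e -> lie_algebra G e.
Proof. by case. Qed.

Lemma root_space_linear alpha (r : R) e f : root_space a alpha e -> root_space a alpha f ->
  root_space a alpha (r *: e + f).
Proof.
move=> [eL He] [fL Hf]; split; first exact: lie_combo.
move=> Y aY; rewrite bracket_linearr ?He ?Hf//; last exact: a_lie.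
by rewrite scalerDr !scalerA mulrC.
Qed.

(** Applied to theta and to the conjugates of sigma, which are automorphisms acting as -1 on a. *)
Lemma root_space_neg (s : vfield G -> vfield G) alpha e :
  (forall X, lie_algebra G X -> lie_algebra G (s X)) ->
  (forall (r : R) X, s (r *: X) = r *: s X) ->
  (forall X Y, s (bracket X Y) = bracket (s X) (s Y)) ->
  (forall X, a X -> s X = - X) ->
  root_space a alpha e -> root_space a (- alpha) (s e).
Proof.
move=> sL sZ sb sa [eL He]; split; first exact: sL.
move=> Y aY; have YL := a_lie aY.
have sN X : s (- X) = - s X by rewrite -scaleN1r sZ scaleN1r.
have {1}-> : Y = s (- Y) by rewrite sN sa// opprK.
rewrite -sb bracketNl// He// sN sZ -scaleNr.
by [].
Qed.

Lemma weight_spanning (u : E) : exists s : seq E,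
  (forall v, v \in s -> forall X, a X -> exists r : R, bracket X (vf v) = r *: vf v) /\
  u = \sum_(v <- s) v.
Proof.
pose T (X : {X | a X}) := adm (sval X).
have sT i : symop (gram theta) (T i).
  move=> u1 u2; have aX := svalP i; have XL := a_lie aX.
  have vL (v : E) : lie_algebra G (vf v) by exact: vf_lie.
  have E1 (v : E) : v *m T i = co (bracket (sval i) (vf v)).
    by rewrite /T /adm mxlE//; exact: ad_lin.
  have := ip_ad thC XL (vL u1) (vL u2) (proj2 (ap aX)).
  rewrite !(ip_co thC) ?co_vf ?E1//; exact: lie_bracket.
have cT i j : T i *m T j = T j *m T i.
  have [ai aj] := (svalP i, svalP j).
  apply/eqP; rewrite -subr_eq0 /T -adm_bracket; [|exact: a_lie..].
  case: aA => _ ->//; apply/eqP.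
  have := adm_linear (-1) (lie0 (G := G)) (lie0 (G := G)).
  by rewrite scaler0 addr0 scaleN1r addNr.
have [s [sJ ->]] := joint_eigen_sum (gram_sym thC) (gram_pos thC) sT cT u.
exists s; split=> // v vs X aX; have [r rE] := sJ v vs (exist _ X aX).
exists r; have XL := a_lie aX.
apply: co_inj; [by apply: lie_bracket => //; exact: vf_lie|by apply: lieZ; exact: vf_lie|].
rewrite coZ co_vf mxlE; [exact: rE|exact: ad_lin].
Qed.

(** The eigenvalue is written as the Rayleigh quotient of Y, so that one formula defines a
    functional on a; the value 0 outside a is the normalization of [dual]. *)
Lemma weight_exists Y : lie_algebra G Y -> Y != 0 ->
  (forall X, a X -> exists r : R, bracket X Y = r *: Y) ->
  exists2 alpha, dual a alpha & root_space a alpha Y.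
Proof.
move=> YL Y0 H; have Yp := ip_pos thC YL Y0.
pose alpha X := if pselect (a X) then ip (bracket X Y) Y / ip Y Y else 0.
have alphaE X r : a X -> bracket X Y = r *: Y -> alpha X = r.
  move=> aX XY; rewrite /alpha; case: pselect => // _ /=; rewrite XY.
  have := ip_linear thC r YL (lie0 (G := G)) YL; rewrite addr0 (ip0l thC YL) addr0 => ->.
  by rewrite mulfK// gt_eqF.
exists alpha; last first.
  by split=> // X aX; have [r h] := H _ aX; rewrite (alphaE _ _ aX h).
split=> [X naX|r X1 X2 a1 a2].
- by rewrite /alpha; case: pselect.
- have [r1 h1] := H _ a1; have [r2 h2] := H _ a2.
  have a12 : a (r *: X1 + X2) by case: aA => -[_ h] _; exact: h.
  rewrite (alphaE _ _ a1 h1) (alphaE _ _ a2 h2).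
  apply: alphaE => //; rewrite bracket_linearl//; [|exact: a_lie..].
  by rewrite h1 h2 scalerA -scalerDl.
Qed.

Context (Sp : set (vfield G -> R)) (SpP : positive_system a Sp).

Lemma pos_roots alpha : Sp alpha -> Defs.roots a alpha.
Proof. by case: SpP => X0 [_ _ ->] []. Qed.

Lemma roots_neg alpha : Defs.roots a alpha -> Defs.roots a (- alpha).
Proof.
move=> [[d1 d2] a0 [X aX X0]]; split.
- split=> [Y nY|r Y Z aY aZ].
    by rewrite -[LHS]/(- alpha Y) d1// oppr0.
  by rewrite -[LHS]/(- alpha _) d2// opprD -mulrN.
- by rewrite oppr_eq0.
exists (th X); first apply: root_space_neg aX => //.
- by move=> Y YL; exact: d_invol_lie.
- by move=> Y Z; exact: d_invol_bracket.
- by move=> Y /ap[].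
by apply: contra_neq X0 => h; rewrite -(d_involK X thI) h.
Qed.

Lemma roots_sign alpha : Defs.roots a alpha -> Sp alpha \/ Sp (- alpha).
Proof.
case: SpP => X0 [aX0 nz ->] ra; have := nz _ ra.
rewrite neq_lt => /orP[lt|gt]; [right|left] => //; split; first exact: roots_neg.
by rewrite -[X in 0 < X]/(- alpha X0) oppr_gt0.
Qed.

(* Descent: a positive root that is outside span I and violates the bound is a sum
   of two positive roots, one of which has the same properties and a smaller value
   at the regular element Xr; these values are eigenvalues of ad Xr. *)
Lemma pos_root_bound (I : set (vfield G -> R)) X0 c : a X0 ->
  (forall alpha, Sp alpha -> 0 <= alpha X0) ->
  (forall alpha, (simple_roots Sp `\` I) alpha -> c <= alpha X0) ->
  forall alpha, Sp alpha -> ~ Defs.span (I : set (vfield G -> R^o)) alpha -> c <= alpha X0.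
Proof.
move=> aX0 pos simp alpha Sa nIa; rewrite leNgt; apply/negP => lt.
have [Xr [aXr nz SpE]] := SpP.
pose p := char_poly (adm Xr).
pose S beta := [/\ Sp beta, ~ Defs.span (I : set (vfield G -> R^o)) beta & beta X0 < c].
have step beta : S beta -> exists2 gamma, S gamma & gamma Xr < beta Xr.
  move=> [Sb nIb ltb].
  have nsimp : exists b g, [/\ Sp b, Sp g & beta = b + g].
    apply: contrapT => h; have : (simple_roots Sp `\` I) beta.
      split=> // Ib; apply: nIb => M [_]; exact.
    by move=> /simp; rewrite leNgt ltb.
  have [b [g [Spb Spg bE]]] := nsimp.
  have bp : 0 < b Xr by move: Spb; rewrite SpE => -[].
  have gp : 0 < g Xr by move: Spg; rewrite SpE => -[].
  have eXr : beta Xr = b Xr + g Xr by rewrite bE.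
  have eX0 : beta X0 = b X0 + g X0 by rewrite bE.
  have b0 := pos _ Spb; have g0 := pos _ Spg.
  have [nb|] := pselect (~ Defs.span (I : set (vfield G -> R^o)) b).
    exists b; last by rewrite eXr ltrDl.
    by split=> //; apply: le_lt_trans ltb; rewrite eX0 lerDl.
  move=> /contrapT sb; exists g; last by rewrite eXr ltrDr.
  split=> //; last by apply: le_lt_trans ltb; rewrite eX0 lerDr.
  move=> sg; apply: nIb => M [[M0 MD] MI].
  have := MD 1 _ _ (sb M (Logic.conj (Logic.conj M0 MD) MI)) (sg M (Logic.conj (Logic.conj M0 MD) MI)).
  by rewrite scale1r bE.
have rt beta : S beta -> root p (beta Xr).
  move=> [/pos_roots[_ _ [Y [YL HY] Y0]] _ _].
  rewrite -eigenvalue_root_char; apply/eigenvalueP; exists (co Y).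
    by rewrite -mxlP ?HY ?coZ//; apply: ad_lin; exact: a_lie.
  by apply: contra_neq Y0 => h; rewrite (lie_vf YL) h vf0.
(* Iterating the descent produces arbitrarily many distinct roots of the characteristic polynomial,
   more than its degree allows. *)
have seqs k : forall beta, S beta -> exists s : seq R,
    [/\ size s = k, uniq s, all (root p) s & all (fun r => r < beta Xr) s].
  elim: k => [|k IH] beta Sb; first by exists [::].
  have [g Sg gb] := step _ Sb; have [s [s1 s2 s3 s4]] := IH _ Sg.
  exists (g Xr :: s); split=> /=.
  - by rewrite s1.
  - rewrite s2 andbT; apply/negP => /(allP s4); rewrite ltxx.
    by [].
  - by rewrite s3 andbT; exact: rt.
  - by rewrite gb /=; apply/allP => r /(allP s4) /lt_trans; exact.
have [|s [s1 s2 s3 _]] := seqs (size p) alpha; first by split.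
have := max_poly_roots (monic_neq0 (char_poly_monic _)) s3 s2.
by rewrite s1 ltnn.
Qed.

End Weights.

(** * Bounded decompositions of the Lie algebra *)

Section Decomposition.
Context {R : realType} {n : nat} {G : lieGroupType R n}.
Notation E := 'rV[R]_n.+1.
Implicit Types (X Y Z e : vfield G).
Context (theta : G -> G) (thC : cartan_involution theta).
Context (a : set (vfield G)) (aA : abelian_subspace a) (ap : a `<=` minus_eigenspace theta).
Context (Sp : set (vfield G -> R)) (SpP : positive_system a Sp).

Notation th := (d_invol theta).
Notation ip := (cartan_form theta).

Let thI : lie_involution theta.
Proof. by case: thC. Qed.

(* The properties used of the conjugates Ad w sigma Ad w^-1 of the involution. *)
Record cosymmetry (s : vfield G -> vfield G) : Prop := {
  cosym_linear : forall (r : R) X Y, s (r *: X + Y) = r *: s X + s Y;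
  cosym_lie : forall X, lie_algebra G X -> lie_algebra G (s X);
  cosymK : forall X, s (s X) = X;
  cosym_th : forall X, s (th X) = th (s X);
  cosym_bracket : forall X Y, s (bracket X Y) = bracket (s X) (s Y);
  cosym_ip : forall X Y, lie_algebra G X -> lie_algebra G Y -> ip (s X) (s Y) = ip X Y;
  cosym_neg : forall X, a X -> s X = - X;
  cosym_max : forall X, lie_algebra G X -> th X = - X -> s X = - X ->
    (forall Y, a Y -> bracket Y X = 0) -> a X }.

Definition m_alg (I : set (vfield G -> R)) : set (vfield G) := generated_alg
  (\bigcup_(beta in Sp `&` Defs.span (I : set (vfield G -> R^o)))
     (root_space a beta `|` root_space a (- beta))).

Context (I : set (vfield G -> R)) (s : vfield G -> vfield G) (sC : cosymmetry s)
  (D : vfield G -> vfield G) (X0 : vfield G) (aX0 : a X0).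
Context (D_linear : forall (r : R) X Y, D (r *: X + Y) = r *: D X + D Y).
Context (D_eigen : forall (r : R) X, lie_algebra G X -> bracket X0 X = r *: X ->
  D X = expR (- r) *: X).

Let sD X Y : s (X + Y) = s X + s Y.
Proof. by have := cosym_linear sC 1 X Y; rewrite !scale1r. Qed.

Let sZ (r : R) X : s (r *: X) = r *: s X.
Proof.
have s0 : s 0 = 0.
  by have := cosym_linear sC (-1) 0 0; rewrite scaler0 addr0 scaleN1r addNr.
by have := cosym_linear sC r X 0; rewrite s0 !addr0.
Qed.

Let sN X : s (- X) = - s X.
Proof. by rewrite -scaleN1r sZ scaleN1r. Qed.

Let D0 : D 0 = 0.
Proof. by have := D_linear (-1) 0 0; rewrite scaler0 addr0 scaleN1r addNr. Qed.

Let DZ (r : R) X : D (r *: X) = r *: D X.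
Proof. by have := D_linear r X 0; rewrite D0 !addr0. Qed.

Let DD X Y : D (X + Y) = D X + D Y.
Proof. by have := D_linear 1 X Y; rewrite !scale1r. Qed.

Let thZ (r : R) X : th (r *: X) = r *: th X.
Proof. by []. Qed.

Let thD X Y : th (X + Y) = th X + th Y.
Proof. by []. Qed.

Let aL X : a X -> lie_algebra G X := a_lie ap (X := X).

(* Below s is Ad w sigma Ad w^-1 and D is Ad a0^-1: the last two components are
   those of a_I and of Ad (a0 w) h, and B also bounds D Z4. *)
Definition splittable (B : R) e := exists Z1 Z2 Z3 Z4 : vfield G,
  [/\ lie_algebra G Z1 /\ th Z1 = Z1, m_alg I Z2,
      a Z3 /\ (forall alpha, I alpha -> alpha Z3 = 0),
      lie_algebra G Z4 /\ s (D Z4) = D Z4 & e = Z1 + Z2 + (Z3 + Z4)] /\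
  [/\ `|co Z1| <= B, `|co Z2| <= B, `|co Z3| <= B, `|co Z4| <= B & `|co (D Z4)| <= B].

Lemma m_alg0 : m_alg I 0.
Proof. by move=> M [[[M0 _] _ _] _]. Qed.

Lemma m_alg_linear (r : R) X Y : m_alg I X -> m_alg I Y -> m_alg I (r *: X + Y).
Proof. by move=> mX mY M HM; case: (HM) => -[[_ h] _ _] _; apply: h; [exact: mX|exact: mY]. Qed.

Lemma m_alg_bracket X Y : m_alg I X -> m_alg I Y -> m_alg I (bracket X Y).
Proof. by move=> mX mY M HM; case: (HM) => -[_ _ h] _; apply: h; [exact: mX|exact: mY]. Qed.

Lemma m_alg_root alpha e : Sp alpha -> Defs.span (I : set (vfield G -> R^o)) alpha ->
  root_space a alpha e \/ root_space a (- alpha) e -> m_alg I e.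
Proof. by move=> Sa Ia H M [_ h]; apply: h; exists alpha. Qed.

Lemma m_alg_lie X : m_alg I X -> lie_algebra G X.
Proof.
apply; split.
  split=> //; last by move=> Y Z; exact: lie_bracket.
  by split=> [|r Y Z]; [exact: lie0|exact: lie_combo].
by move=> Y [alpha _ [[]|[]]].
Qed.

Context (I_dual : forall alpha, I alpha -> Sp alpha).

Lemma dual_linear alpha (r : R) X Y : I alpha -> a X -> a Y ->
  alpha (r *: X + Y) = r * alpha X + alpha Y.
Proof. by move=> /I_dual/(pos_roots SpP)[[_ h] _ _]; exact: h. Qed.

Lemma splittable_le B B' e : B <= B' -> splittable B e -> splittable B' e.
Proof.
move=> BB [Z1 [Z2 [Z3 [Z4 [H [h1 h2 h3 h4 h5]]]]]]; exists Z1, Z2, Z3, Z4; split=> //.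
by split; exact: le_trans BB.
Qed.

Let a0 : a 0.
Proof. by case: aA => -[]. Qed.

Let s0 : s 0 = 0.
Proof. by have := sZ 0 0; rewrite !scale0r. Qed.

Let dual0 alpha : I alpha -> alpha 0 = 0.
Proof.
move=> Ia; have := dual_linear (-1) Ia a0 a0.
by rewrite scaler0 addr0 mulN1r addNr.
Qed.

Lemma splittable_k Z : lie_algebra G Z -> th Z = Z -> splittable `|co Z| Z.
Proof.
move=> ZL Zk; exists Z, 0, 0, 0; split; last by rewrite D0 co0 normr0 lexx normr_ge0.
split; [by []|exact: m_alg0|by []|by split; [exact: lie0|rewrite D0 s0]|].
by rewrite !addr0.
Qed.

Lemma splittable_m Z : m_alg I Z -> splittable `|co Z| Z.
Proof.
move=> Zm; exists 0, Z, 0, 0; split; last by rewrite D0 co0 normr0 lexx normr_ge0.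
split; [by split; [exact: lie0|]|by []|by []|by split; [exact: lie0|rewrite D0 s0]|].
by rewrite !addr0 add0r.
Qed.

Lemma splittable_a Z : a Z -> (forall alpha, I alpha -> alpha Z = 0) -> splittable `|co Z| Z.
Proof.
move=> aZ ZI; exists 0, 0, Z, 0; split; last by rewrite D0 co0 normr0 lexx normr_ge0.
split; [by split; [exact: lie0|]|exact: m_alg0|by []|by split; [exact: lie0|rewrite D0 s0]|].
by rewrite !addr0 add0r.
Qed.

Lemma splittable_h B Z : lie_algebra G Z -> s (D Z) = D Z -> `|co Z| <= B -> `|co (D Z)| <= B ->
  splittable B Z.
Proof.
move=> ZL Zh B1 B2; have B0 : 0 <= B by exact: le_trans B1.
exists 0, 0, 0, Z; split; last by rewrite co0 normr0.
split; [by split; [exact: lie0|]|exact: m_alg0|by []|by []|].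
by rewrite !add0r.
Qed.

Lemma splittable_add B B' e e' : splittable B e -> splittable B' e' -> splittable (B + B') (e + e').
Proof.
move=> [Z1 [Z2 [Z3 [Z4 [[[L1 k1] m2 [a3 I3] [L4 h4] ->] [b1 b2 b3 b4 b5]]]]]].
move=> [Y1 [Y2 [Y3 [Y4 [[[L1' k1'] m2' [a3' I3'] [L4' h4'] ->] [b1' b2' b3' b4' b5']]]]]].
exists (Z1 + Y1), (Z2 + Y2), (Z3 + Y3), (Z4 + Y4); split; last first.
  rewrite DD !coD; split; (apply: le_trans (ler_normD _ _) _; exact: lerD).
split.
- by split; [exact: lieD|rewrite thD k1 k1'].
- by have := m_alg_linear 1 m2 m2'; rewrite scale1r.
- split; first by have [[_ h] _] := aA; have := h 1 _ _ a3 a3'; rewrite scale1r.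
  move=> al Ial; have := dual_linear 1 Ial a3 a3'.
  by rewrite scale1r mul1r I3// I3'// addr0.
- by split; [exact: lieD|rewrite DD sD h4 h4'].
rewrite [Z1 + Y1 + _]addrACA [Z3 + Y3 + _]addrACA [LHS]addrACA.
by [].
Qed.

Context (L : R) (L1 : 1 <= L) (HL : forall X Y, lie_algebra G X -> lie_algebra G Y ->
  ip X X <= ip Y Y -> `|co X| <= L * `|co Y|).

Let thL X : lie_algebra G X -> lie_algebra G (th X) := d_invol_lie thI (X := X).
Let sL X : lie_algebra G X -> lie_algebra G (s X) := cosym_lie sC (X := X).

Let nth X : lie_algebra G X -> `|co (th X)| <= L * `|co X|.
Proof. by move=> XL; apply: HL => //; [exact: thL|rewrite ip_th]. Qed.

Let ns X : lie_algebra G X -> `|co (s X)| <= L * `|co X|.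
Proof. by move=> XL; apply: HL => //; [exact: sL|rewrite cosym_ip]. Qed.

Let nths X : lie_algebra G X -> `|co (th (s X))| <= L * `|co X|.
Proof.
move=> XL; apply: HL => //; first by apply/thL/sL.
by rewrite ip_th ?cosym_ip//; exact: sL.
Qed.

(** For p = exp t these are the factors p / (p -+ 1/p): the first is 1 / (1 - p^-2), which decreases
    in p, and the second is at most 1. Here c > 1 plays the exponential of the lower bound on the
    root. *)
Lemma scalar_bounds (c p : R) : 1 < c -> c <= p -> let k := (1 - c^-1 ^+ 2)^-1 in
  [/\ 1 <= k, 0 < p - p^-1, p / (p - p^-1) <= k & p / (p + p^-1) <= k].
Proof.
move=> c1 cp k; have c0 : 0 < c by lra.
have p0 : 0 < p by lra.
have ci : c^-1 < 1 by rewrite invf_lt1.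
have ci0 : 0 < c^-1 by rewrite invr_gt0.
have pi0 : 0 < p^-1 by rewrite invr_gt0.
have pc : p^-1 <= c^-1 by rewrite lef_pV2.
have d0 : 0 < 1 - c^-1 ^+ 2 by rewrite subr_gt0 expr_lt1// ltW.
have pp : p * p^-1 = 1 by rewrite mulfV// gt_eqF.
have k1 : 1 <= k by rewrite /k invf_ge1// gerBl sqr_ge0.
have pm : 0 < p - p^-1 by rewrite subr_gt0; apply: le_lt_trans pc _; lra.
split=> //.
  rewrite ler_pdivrMr// /k mulrC ler_pdivlMr// mulrBr mulr1 lerD2l lerN2.
  rewrite -[leLHS]mul1r -pp -mulrA; apply: ler_wpM2l; first exact: ltW.
  by rewrite expr2 ler_pM// ltW.
by apply: le_trans k1; rewrite ler_pdivrMr ?addr_gt0// mul1r lerDl ltW.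
Qed.

Let L0 : 0 < L.
Proof. exact: lt_le_trans ltr01 L1. Qed.

Let tau X := th (s X).

Let tauK X : tau (tau X) = X.
Proof. by rewrite /tau (cosym_th sC) (d_involK _ thI) (cosymK sC). Qed.

Let tau_root alpha e : root_space a alpha e -> root_space a alpha (tau e).
Proof.
move=> ae; rewrite -[alpha]opprK /tau.
apply: (root_space_neg ap (s := th)) => //.
- by move=> X Y; exact: d_invol_bracket.
- by move=> X /ap[].
apply: (root_space_neg ap) ae => //; [exact: cosym_bracket sC|exact: cosym_neg sC].
Qed.

Let tauD X Y : tau (X + Y) = tau X + tau Y.
Proof. by rewrite /tau sD thD. Qed.

Let tauZ (r : R) X : tau (r *: X) = r *: tau X.
Proof. by rewrite /tau sZ thZ. Qed.

(* With tau = theta s, e is solved as e^-t Y - e^t tau Y on the eigenspaces of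
   tau, and this is Z1 + Z4 for Z1 = - e^t (s Y + theta s Y), fixed by theta, and
   Z4 = e^-t Y + e^t s Y = Ad a0 (Y + s Y). *)
Lemma splittable_neg_root alpha e (c : R) : root_space a (- alpha) e -> 1 < c ->
  c <= expR (alpha X0) ->
  splittable (8 * (1 - c^-1 ^+ 2)^-1 * L ^+ 2 * `|co e|) e.
Proof.
move=> ae c1 cp; have eL := root_space_lie ae.
set p := expR (alpha X0) in cp; have p0 : 0 < p by exact: expR_gt0.
have := scalar_bounds c1 cp; set k := (1 - _)^-1 => -[k1 pm b1 b2].
have p1 : 1 < p by exact: lt_le_trans cp.
have pi1 : p^-1 < 1 by rewrite invf_lt1.
have pi0 : 0 < p^-1 by rewrite invr_gt0.
have te := tau_root ae; have teL := root_space_lie te.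
(* The map Y -> Y / p - p tau Y acts on the eigenspaces of [tau] for 1 and -1 by 1/p - p and 1/p +
   p; r1 and r2 invert these factors. *)
pose r1 := (p^-1 - p)^-1; pose r2 := (p^-1 + p)^-1.
pose Y := (r1 / 2) *: (e + tau e) + (r2 / 2) *: (e - tau e).
have aY : root_space a (- alpha) Y.
  have YE : Y = (r1 / 2 + r2 / 2) *: e + ((r1 / 2 - r2 / 2) *: tau e + 0).
    by rewrite /Y addr0 scalerDr scalerBr !scalerDl scaleNr addrACA.
  have z0 : root_space a (- alpha) 0.
    by have := root_space_linear ap (-1) ae ae; rewrite scaleN1r addNr.
  by rewrite YE; apply: (root_space_linear ap) => //; exact: (root_space_linear ap).
have YL := root_space_lie aY.
have asY : root_space a alpha (s Y).
  rewrite -[alpha]opprK; apply: (root_space_neg ap) aY => //.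
    exact: cosym_bracket sC.
  exact: cosym_neg sC.
have sYL := root_space_lie asY.
have ne : `|co (tau e)| <= L * `|co e| by exact: nths.
have x0 : 0 <= `|co e| by exact: normr_ge0.
set x := `|co e| in ne x0 *.
have [l0 l1] := (L0, L1).
(* The bound is on p Y rather than on Y, since the large factor p multiplies [s Y] in both [Z1] and
   [Z4]. *)
have npY : `|co (p *: Y)| <= 2 * k * L * x.
  rewrite coZ /Y coD !coZ coD coB scalerDr !scalerA.
  have np : `|co e + co (tau e)| <= 2 * L * x.
    by apply: le_trans (ler_normD _ _) _; rewrite -/x; nra.
  have nm : `|co e - co (tau e)| <= 2 * L * x.
    by apply: le_trans (ler_normB _ _) _; rewrite -/x; nra.
  apply: le_trans (ler_normD _ _) _; rewrite (normrZ (p * (r1 / 2))) (normrZ (p * (r2 / 2))).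
  have e1 : `|p * (r1 / 2)| = p / (p - p^-1) / 2.
    rewrite /r1 -(opprB p) invrN mulNr mulrN normrN mulrA ger0_norm//.
    by rewrite divr_ge0// divr_ge0// ltW.
  have e2 : `|p * (r2 / 2)| = p / (p + p^-1) / 2.
    rewrite /r2 addrC mulrA ger0_norm// divr_ge0// divr_ge0// ltW// addr_gt0//.
  rewrite e1 e2.
  have -> : 2 * k * L * x = k / 2 * (2 * L * x) + k / 2 * (2 * L * x) by field.
  apply: lerD; apply: ler_pM => //.
  - by rewrite divr_ge0// divr_ge0// ltW.
  - by rewrite ler_wpM2r// invr_ge0.
  - by rewrite divr_ge0// divr_ge0// ltW// addr_gt0.
  - by rewrite ler_wpM2r// invr_ge0.
set b := 2 * k * L * x in npY.
have nY : `|co Y| <= b.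
  by apply: le_trans npY; rewrite coZ normrZ ger0_norm ?(ltW p0)// ler_peMl// ltW.
have npiY : `|co (p^-1 *: Y)| <= b.
  by apply: le_trans nY; rewrite coZ normrZ ger0_norm ?(ltW pi0)// ler_piMl// ltW.
have npsY : `|co (p *: s Y)| <= L * b.
  by rewrite -sZ; apply: le_trans (ns (lieZ _ YL)) _; rewrite ler_wpM2l// ltW.
have nptY : `|co (p *: th (s Y))| <= L * b.
  by rewrite -thZ -sZ; apply: le_trans (nths (lieZ _ YL)) _; rewrite ler_wpM2l// ltW.
have b0 : 0 <= b by exact: le_trans nY.
pose Z1 := - p *: (s Y + th (s Y)); pose Z4 := p^-1 *: Y + p *: s Y.
have Z1L : lie_algebra G Z1 by apply/lieZ/lieD => //; exact: thL.
have Z4L : lie_algebra G Z4 by apply: lieD; exact: lieZ.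
have eE : e = Z1 + Z4.
  apply: co_inj => //; first exact: lieD.
  have tE : th (s Y) = (r1 / 2) *: (e + tau e) - (r2 / 2) *: (e - tau e).
    rewrite -/(tau Y) /Y tauD !tauZ !tauD -scaleN1r tauZ !tauK scaleN1r.
    by rewrite (addrC (tau e) e) scaleN1r -scalerN opprB.
  have q1 : p^-1 - p != 0 by rewrite -(opprB p) oppr_eq0 gt_eqF.
  have q2 : p^-1 + p != 0 by rewrite gt_eqF// addr_gt0.
  have key (u v w : E) : u = - p *: (w + ((r1 / 2) *: (u + v) - (r2 / 2) *: (u - v))) +
      (p^-1 *: ((r1 / 2) *: (u + v) + (r2 / 2) *: (u - v)) + p *: w).
    apply/rowP => j; rewrite !mxE /r1 /r2.
    by move: (p^-1) q1 q2 => q q1 q2; field; rewrite q1 q2.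
  have cY : co Y = (r1 / 2) *: (co e + co (tau e)) + (r2 / 2) *: (co e - co (tau e)).
    by rewrite /Y !(coB, coZ, coD).
  have cT : co (th (s Y)) =
      (r1 / 2) *: (co e + co (tau e)) - (r2 / 2) *: (co e - co (tau e)).
    by rewrite tE !(coB, coZ, coD).
  rewrite /Z1 /Z4 coD (coZ (- p)) (coD (s Y)) cT (coD (p^-1 *: Y)) (coZ p^-1) cY (coZ p).
  exact: key.
have DY : D Y = p *: Y.
  have [_ H] := aY; have := D_eigen YL (H _ aX0).
  by rewrite -[(- alpha) X0]/(- alpha X0) opprK.
have DsY : D (s Y) = p^-1 *: s Y.
  by have [_ H] := asY; have := D_eigen sYL (H _ aX0); rewrite expRN.
(* D cancels both factors: Y + s Y is fixed by s and bounded in terms of Y alone, however large p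
   is. *)
have DZ4 : D Z4 = Y + s Y.
  by rewrite /Z4 DD !DZ DY DsY !scalerA mulVf ?mulfV ?gt_eqF// !scale1r.
rewrite eE; have -> : 8 * k * L ^+ 2 * x = 2 * L * b + 2 * L * b by rewrite /b; ring.
apply: splittable_add.
  apply: splittable_le (splittable_k Z1L _); last first.
    by rewrite /Z1 thZ thD (d_involK _ thI) addrC.
  rewrite /Z1 coZ scaleNr normrN -coZ scalerDr coD.
  apply: le_trans (ler_normD _ _) _.
  by rewrite -mulrA mulr_natl mulr2n lerD.
apply: splittable_h => //.
- by rewrite DZ4 sD (cosymK sC) addrC.
- rewrite coD; apply: le_trans (ler_normD _ _) _.
  by apply: le_trans (lerD npiY npsY) _; nra.
rewrite DZ4 coD; apply: le_trans (ler_normD _ _) _.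
have := le_trans (ns YL) (ler_wpM2l (ltW l0) nY).
by move: nY => h1 h2; apply: le_trans (lerD h1 h2) _; nra.
Qed.

Lemma splittable_pos_root alpha e (c : R) : root_space a alpha e -> 1 < c ->
  c <= expR (alpha X0) ->
  splittable ((2 * L + 8 * (1 - c^-1 ^+ 2)^-1 * L ^+ 3) * `|co e|) e.
Proof.
move=> ae c1 cp; have eL := root_space_lie ae.
have [k1 _ _ _] := scalar_bounds c1 (lexx c).
set k := (1 - _)^-1 in k1 *.
have [l0 l1] := (L0, L1).
have tae : root_space a (- alpha) (th e).
  apply: (root_space_neg ap (s := th)) ae => //.
    by move=> X Y; exact: d_invol_bracket.
  by move=> X /ap[].
have ntae : root_space a (- alpha) (- th e).
  have z0 : root_space a (- alpha) 0.
    by have := root_space_linear ap (-1) tae tae; rewrite scaleN1r addNr.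
  by have := root_space_linear ap (-1) tae z0; rewrite scaleN1r addr0.
have H := splittable_neg_root ntae c1 cp.
suff : splittable ((2 * L + 8 * k * L ^+ 3) * `|co e|) (e + th e + (- th e)) by rewrite addrK.
rewrite mulrDl; apply: splittable_add.
  apply: splittable_le (splittable_k (lieD eL (thL eL)) _); last by rewrite thD (d_involK _ thI) addrC.
  rewrite coD; apply: le_trans (ler_normD _ _) _.
  by have := nth eL; have := normr_ge0 (co e); nra.
apply: splittable_le H; rewrite -/k.
have -> : co (- th e) = - co (th e) by rewrite -scaleN1r coZ scaleN1r.
rewrite normrN; have -> : 8 * k * L ^+ 3 * `|co e| = 8 * k * L ^+ 2 * (L * `|co e|) by ring.
apply: ler_wpM2l; last exact: nth.
by rewrite mulr_ge0 ?sqr_ge0// mulr_ge0//; exact: le_trans ler01 k1.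
Qed.

(* For a root vector F of alpha in I that is an eigenvector of tau, [F, theta F]
   lies in a and in m_I and represents a multiple of alpha, so that the orthogonal
   complement of m_I in a is killed by I. *)
Lemma splittable_in_a X : a X -> splittable (2 * L * `|co X|) X.
Proof.
move=> aX; have XL := aL aX.
pose P (u : E) := m_alg I (vf u) /\ a (vf u).
have aD (r : R) Y Z : a Y -> a Z -> a (r *: Y + Z).
  by have [[_ h] _] := aA; exact: h.
have subP : Defs.subspace P.
  split; first by split; rewrite vf0; [exact: m_alg0|exact: a0].
  move=> r u v [m1 a1] [m2 a2]; rewrite /P vf_linear.
  by split; [exact: m_alg_linear|exact: aD].
(* U is the intersection of a with m_I in coordinates; X is projected onto it orthogonally. *)
have [U HU] := subspace_mx subP.
have [y [z [xE yU zU]]] := orth_split (gram_sym thC) (gram_pos thC) U (co X).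
have [my ay] := proj2 (HU y) yU.
have XE : X = vf y + vf z by rewrite -vfD -xE -lie_vf.
have az : a (vf z).
  have -> : vf z = (-1) *: vf y + X by rewrite XE scaleN1r addKr.
  exact: aD.
have zL : lie_algebra G (vf z) by exact: vf_lie.
have zI alpha : I alpha -> alpha (vf z) = 0.
  move=> Ia; have Sa := I_dual Ia; have [_ _ [F aF F0]] := pos_roots SpP Sa.
  (* [tau] is an involution of the root space: F + tau F is fixed by it, and if this vector vanishes
     then F itself has eigenvalue -1. *)
  have [F' [r [r2 aF' F'0 tF']]] : exists F' (r : R), [/\ r * r = 1,
      root_space a alpha F', F' != 0 & tau F' = r *: F'].
    have at_ := tau_root aF.
    have [p0|np0] := eqVneq (F + tau F) 0.
      exists F, (-1); split=> //; first by rewrite mulrNN mulr1.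
      by rewrite scaleN1r; apply/eqP; rewrite -addr_eq0 addrC p0.
    exists (F + tau F), 1; split=> //; first by rewrite mulr1.
      by have := root_space_linear ap 1 aF at_; rewrite scale1r.
    by rewrite scale1r tauD tauK addrC.
  have F'L := root_space_lie aF'; have tF'L := thL F'L.
  have taF' : root_space a (- alpha) (th F').
    apply: (root_space_neg ap (s := th)) aF' => //.
      by move=> Y Z; exact: d_invol_bracket.
    by move=> Y /ap[].
  pose H := bracket F' (th F').
  have LH : lie_algebra G H by exact: lie_bracket.
  have spI : Defs.span (I : set (vfield G -> R^o)) alpha by move=> M [_]; exact.
  have mH : m_alg I H.
    by apply: m_alg_bracket; apply: (m_alg_root Sa spI); [left|right].
  have sF' : s F' = r *: th F' by rewrite -thZ -tF' /tau (d_involK _ thI).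
  (* Both theta and s exchange the two entries of the bracket up to scalars, theta by 1 and s by r
     with r r = 1, so both negate H; the opposite weights of the entries make H commute with a. *)
  have aH : a H.
    apply: (cosym_max sC) => //.
    - by rewrite /H (d_invol_bracket _ _ thI) (d_involK _ thI) bracket_anti.
    - rewrite /H (cosym_bracket sC) (cosym_th sC) sF' thZ (d_involK _ thI).
      rewrite (bracketZr r (lieZ r tF'L) F'L) (bracket_anti (r *: th F')).
      rewrite (bracketZr r F'L tF'L) scalerN scalerA r2 scale1r.
      by [].
    move=> Y aY; have YL := aL aY; have [_ h1] := aF'; have [_ h2] := taF'.
    have q1 : bracket Y F' = alpha Y *: F' := h1 Y aY.
    have q2 : bracket Y (th F') = (- alpha Y) *: th F' := h2 Y aY.
    rewrite /H (jacobi YL F'L tF'L) q1 q2 (bracketZr (- alpha Y) F'L tF'L).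
    rewrite (bracket_anti (_ *: F')) (bracketZr (alpha Y) tF'L F'L) -scalerN -bracket_anti.
    by rewrite scaleNr subrr.
  have PH : P (co H) by rewrite /P -!lie_vf.
  (* Invariance of the Killing form turns the orthogonality of z and H into the vanishing of alpha
     (z) times the squared norm of F', which is positive. *)
  have := zU _ (proj1 (HU _) PH); rewrite -{1}(co_vf (G := G) z) -(ip_co thC zL LH).
  rewrite (ip_sym thC zL LH) /cartan_form.
  have -> : th (vf z) = - vf z by have [] := ap az.
  have -> : killing H (- vf z) = - killing H (vf z).
    rewrite (killing_sym LH (lieN zL)) (killing_sym LH zL).
    have := killing_linear (-2) zL zL LH.
    have -> : (-2) *: vf z + vf z = - vf z :> vfield G.
      by rewrite -[X in _ + X]scale1r -scalerDl -[RHS]scaleN1r; congr (_ *: _); ring.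
    by move=> ->; ring.
  rewrite opprK /H (killing_inv tF'L zL F'L) (bracket_anti F') => h.
  have [_ h1] := aF'; rewrite h1// in h.
  have K1 : killing (th F') (- (alpha (vf z) *: F')) = alpha (vf z) * ip F' F'.
    rewrite -scaleNr (killing_sym tF'L (lieZ _ F'L)).
    have := killing_linear (- alpha (vf z)) F'L (lie0 (G := G)) tF'L; rewrite addr0 => ->.
    have := killing_linear (-1) (lie0 (G := G)) (lie0 (G := G)) tF'L.
    rewrite scaler0 addr0 mulN1r addNr => ->.
    by rewrite addr0 /cartan_form mulrN mulNr.
  move: h; rewrite K1 => /eqP; rewrite oppr_eq0 mulf_eq0 => /orP[/eqP//|].
  by rewrite gt_eqF// (ip_pos thC).
have yL : lie_algebra G (vf y) by exact: vf_lie.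
have zy := zU _ yU.
have ipE : ip X X = ip (vf y) (vf y) + ip (vf z) (vf z).
  rewrite !(ip_co thC)// xE !co_vf !bipDl !(bipDr (gram_sym thC)).
  by rewrite zy (bip_sym (gram_sym thC) y z) zy addr0 add0r.
have yy : 0 <= ip (vf y) (vf y) by rewrite (ip_co thC)//; exact: bip_ge0 (gram_pos thC) _.
have zz : 0 <= ip (vf z) (vf z) by rewrite (ip_co thC)//; exact: bip_ge0 (gram_pos thC) _.
have ny : `|co (vf y : vfield G)| <= L * `|co X|.
  by apply: (HL yL XL); rewrite ipE lerDl; exact: zz.
have nz : `|co (vf z : vfield G)| <= L * `|co X|.
  by apply: (HL zL XL); rewrite ipE lerDr; exact: yy.
rewrite {2}XE -mulrA mulr_natl mulr2n; apply: splittable_add.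
  exact: splittable_le ny (splittable_m my).
exact: splittable_le nz (splittable_a az zI).
Qed.

(** e is split along k and p, and its part in p along the eigenspaces of s. The component fixed by s
    is unchanged by D because its weight is 0; the component negated by s commutes with a and so
    lies in a by maximality. *)
Lemma splittable_zero e : lie_algebra G e -> (forall Y, a Y -> bracket Y e = 0) ->
  splittable ((L + L ^+ 2 + 2 * L ^+ 3) * `|co e|) e.
Proof.
move=> eL e0; set x := `|co e|.
have [l0 l1] := (L0, L1).
have half X Y : `|co Y| <= L * `|co X| -> `|co (2^-1 *: (X + Y))| <= L * `|co X| /\
    `|co (2^-1 *: (X - Y))| <= L * `|co X|.
  move=> h; rewrite !coZ coD coB !normrZ ger0_norm ?invr_ge0//.
  have := ler_normD (co X) (co Y); have := ler_normB (co X) (co Y).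
  by have := normr_ge0 (co X); split; nra.
have teL := thL eL.
pose ek := 2^-1 *: (e + th e); pose ep := 2^-1 *: (e - th e).
have [nk np] := half e (th e) (nth eL); rewrite -/ek -/ep -/x in nk np.
have epL : lie_algebra G ep by apply/lieZ/lieB.
have sepL := sL epL.
pose e1 := 2^-1 *: (ep + s ep); pose e2 := 2^-1 *: (ep - s ep).
have [n1 n2] := half ep (s ep) (ns epL); rewrite -/e1 -/e2 in n1 n2.
have h2 X Y : X = 2^-1 *: (X + Y) + 2^-1 *: (X - Y).
  have -> : 2^-1 *: (X + Y) + 2^-1 *: (X - Y) = 2^-1 *: ((2 : R) *: X).
    by rewrite -scalerDr scaler_nat mulr2n addrACA subrr addr0.
  by rewrite scalerA mulVf ?scale1r// pnatr_eq0.
have eE : e = ek + (e1 + e2) by rewrite /e1 /e2 -h2 /ek /ep -h2.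
have e1L : lie_algebra G e1 by apply/lieZ/lieD.
have e2L : lie_algebra G e2 by apply/lieZ/lieB.
have zth Z : lie_algebra G Z -> (forall Y, a Y -> bracket Y Z = 0) ->
    forall Y, a Y -> bracket Y (th Z) = 0.
  move=> ZL Z0 Y aY; have [_ tY] := ap aY.
  have -> : Y = th (- Y) by rewrite -scaleN1r thZ tY scaleN1r opprK.
  rewrite -(d_invol_bracket _ _ thI) bracketNl ?Z0//; last exact: aL.
  by rewrite oppr0.
have zs Z : lie_algebra G Z -> (forall Y, a Y -> bracket Y Z = 0) ->
    forall Y, a Y -> bracket Y (s Z) = 0.
  move=> ZL Z0 Y aY; have sY := cosym_neg sC aY.
  have -> : Y = s (- Y) by rewrite -scaleN1r sZ sY scaleN1r opprK.
  rewrite -(cosym_bracket sC) bracketNl ?Z0//; last exact: aL.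
  by rewrite oppr0.
have zD (r : R) Z1 Z2 : lie_algebra G Z1 -> lie_algebra G Z2 ->
    (forall Y, a Y -> bracket Y Z1 = 0) -> (forall Y, a Y -> bracket Y Z2 = 0) ->
    forall Y, a Y -> bracket Y (2^-1 *: (Z1 + r *: Z2)) = 0.
  move=> L1' L2 H1 H2 Y aY; have YL := aL aY.
  by rewrite bracketZr ?bracketDr ?bracketZr ?H1 ?H2 ?scaler0 ?addr0 ?scaler0//;
     do ?[apply: lieD|apply: lieZ].
have zep Y : a Y -> bracket Y ep = 0.
  by rewrite /ep -scaleN1r; apply: zD => //; exact: zth.
have ze1 Y : a Y -> bracket Y e1 = 0.
  by rewrite /e1 -[s ep]scale1r; apply: zD => //; exact: zs.
have ze2 Y : a Y -> bracket Y e2 = 0.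
  by rewrite /e2 -scaleN1r; apply: zD => //; exact: zs.
have thep : th ep = - ep.
  have -> : th ep = 2^-1 *: (th e - th (th e)) by [].
  by rewrite (d_involK _ thI) -scalerN opprB.
have ae2 : a e2.
  apply: (cosym_max sC) => //.
    have -> : th e2 = 2^-1 *: (th ep - th (s ep)) by [].
    by rewrite -(cosym_th sC) thep sN -opprD scalerN.
  have -> : s e2 = 2^-1 *: (s ep - ep).
    by rewrite -{2}[ep](cosymK sC) -(sN (s ep)) -sD -sZ.
  by rewrite -[RHS]scalerN opprB.
have De1 : D e1 = e1.
  have := D_eigen (r := 0) e1L; rewrite oppr0 expR0 scale1r; apply.
  by rewrite ze1// scale0r.
have -> : (L + L ^+ 2 + 2 * L ^+ 3) * x = L * x + (L ^+ 2 * x + 2 * L ^+ 3 * x) by ring.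
rewrite eE; apply: splittable_add.
  apply: splittable_le nk (splittable_k _ _); first by apply/lieZ/lieD.
  by rewrite /ek thZ thD (d_involK _ thI) addrC.
have ll : L * `|co ep| <= L ^+ 2 * x by rewrite expr2 -mulrA ler_wpM2l// ltW.
apply: splittable_add.
  have n1' := le_trans n1 ll.
  by apply: splittable_h; rewrite ?De1// /e1 sZ sD (cosymK sC) addrC.
apply: splittable_le (splittable_in_a ae2).
have := le_trans n2 ll; have -> : 2 * L ^+ 3 * x = 2 * L * (L ^+ 2 * x) by ring.
by move=> h; rewrite ler_wpM2l// mulr_ge0// ltW.
Qed.

(** The constant is the sum of the bounds for all kinds of weights, so that it does not depend on
    the weight of e. *)
Lemma splittable_weight e (c : R) : lie_algebra G e ->
  (forall X, a X -> exists r : R, bracket X e = r *: e) -> 1 < c ->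
  (forall alpha, Sp alpha -> ~ Defs.span (I : set (vfield G -> R^o)) alpha ->
    c <= expR (alpha X0)) ->
  let k := (1 - c^-1 ^+ 2)^-1 in
  splittable ((1 + (2 * L + 8 * k * L ^+ 3) + 8 * k * L ^+ 2 + (L + L ^+ 2 + 2 * L ^+ 3)) * `|co e|) e.
Proof.
move=> eL ew c1 H k.
have [k1 _ _ _] := scalar_bounds c1 (lexx c); rewrite -/k in k1.
have [l0 l1] := (ltW L0, L1).
have k0 : 0 <= k by lra.
have l2 : 0 <= L ^+ 2 by exact: exprn_ge0.
have l3 : 0 <= L ^+ 3 by exact: exprn_ge0.
have kl2 : 0 <= k * L ^+ 2 by exact: mulr_ge0.
have kl3 : 0 <= k * L ^+ 3 by exact: mulr_ge0.
have [e0|en0] := eqVneq e 0.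
  apply: splittable_le (splittable_k eL _); last by rewrite e0.
  by rewrite e0 co0 normr0 mulr0.
have [alpha da ae] := weight_exists thC aA ap eL en0 ew.
have [a_0|an0] := eqVneq alpha 0.
  apply: splittable_le (splittable_zero eL _); first by rewrite ler_wpM2r//; lra.
  by move=> Y aY; have [_ ->//] := ae; rewrite a_0 scale0r.
have ra : Defs.roots a alpha by split=> //; exists e.
have gm : m_alg I e -> splittable (1 * `|co e|) e by move=> m; rewrite mul1r; exact: splittable_m.
have [Sa|Sa] := roots_sign thC ap SpP ra.
  have [sI|nI] := pselect (Defs.span (I : set (vfield G -> R^o)) alpha).
    apply: splittable_le (gm (m_alg_root Sa sI _)); last by left.
    by rewrite ler_wpM2r//; lra.
  apply: splittable_le (splittable_pos_root ae c1 (H _ Sa nI)).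
  by rewrite -/k ler_wpM2r//; lra.
rewrite -[alpha]opprK in ae.
have [sI|nI] := pselect (Defs.span (I : set (vfield G -> R^o)) (- alpha)).
  apply: splittable_le (gm (m_alg_root Sa sI _)); last by right.
  by rewrite ler_wpM2r//; lra.
apply: splittable_le (splittable_neg_root ae c1 (H _ Sa nI)).
by rewrite -/k ler_wpM2r//; lra.
Qed.

End Decomposition.

(** * The factorization *)

Section LinearExtension.
Context {R : realType} {n : nat} {G : lieGroupType R n}.
Notation E := 'rV[R]_n.+1.

(** Splittings are chosen on basis vectors only and extended linearly, since an arbitrary choice for
    each vector need not be linear. *)
Definition lin_ext (Z : 'I_n.+1 -> vfield G) (u : E) : E := \sum_j u 0 j *: co (Z j).

Lemma lin_extB Z (u v : E) : lin_ext Z (u - v) = lin_ext Z u - lin_ext Z v.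
Proof.
rewrite /lin_ext -sumrB; apply: eq_bigr => j _.
by rewrite -scalerBl !mxE.
Qed.

Lemma lin_ext_vf Z (u : E) : (forall j, lie_algebra G (Z j)) ->
  vf (lin_ext Z u) = \sum_j u 0 j *: Z j.
Proof.
move=> ZL; rewrite /lin_ext; elim/big_rec2: _ => [|i X v _ <-]; first exact: vf0.
by rewrite vf_linear -lie_vf.
Qed.

Lemma lin_ext_mem (P : set (vfield G)) Z (u : E) : (forall j, lie_algebra G (Z j)) ->
  P 0 -> (forall (r : R) X Y, P X -> P Y -> P (r *: X + Y)) -> (forall j, P (Z j)) ->
  P (vf (lin_ext Z u)).
Proof.
move=> ZL P0 PD PZ; rewrite lin_ext_vf//; elim/big_rec: _ => // i X _.
exact: PD.
Qed.

Lemma lin_ext_bound (Z : 'I_n.+1 -> vfield G) (B : R) (u : E) :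
  (forall j, `|co (Z j)| <= B) -> `|lin_ext Z u| <= n.+1%:R * B * `|u|.
Proof.
move=> ZB; apply: le_trans (ler_norm_sum _ _ _) _.
apply: (@le_trans _ _ (\sum_(j < n.+1) B * `|u|)).
  apply: ler_sum => j _; rewrite normrZ mulrC ler_pM//; exact: rV_coord_le.
by rewrite sumr_const card_ord -mulrA mulr_natl.
Qed.

End LinearExtension.

Section Factorization.
Context {R : realType} {n : nat} {G : lieGroupType R n}.
Notation E := 'rV[R]_n.+1.
Implicit Types (X Y Z e : vfield G).
Context (sigma theta : G -> G) (thC : cartan_involution theta)
  (sgI : lie_involution sigma) (st : forall x, sigma (theta x) = theta (sigma x)).
Context (a : set (vfield G))
  (aM : maximal_abelian_in (minus_eigenspace theta `&` minus_eigenspace sigma) a).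
Context (Sp : set (vfield G -> R)) (SpP : positive_system a Sp).

Notation th := (d_invol theta).
Notation sg := (d_invol sigma).
Notation ip := (cartan_form theta).

Let thI : lie_involution theta.
Proof. by case: thC. Qed.

Let aA : abelian_subspace a.
Proof. by case: aM. Qed.

Let ap : a `<=` minus_eigenspace theta.
Proof. by move=> X; case: aM => _ h _ /h[]. Qed.

(** The span of X and a is again abelian and inside the intersection of p and q, so it equals a by
    maximality. *)
Lemma maximal_abelian_mem X : lie_algebra G X -> th X = - X -> sg X = - X ->
  (forall Y, a Y -> bracket Y X = 0) -> a X.
Proof.
move=> XL Xp Xq X0; have [[[a0 aD] ab] apq aU] := aM.
pose a' : set (vfield G) := [set r *: X + Z | r in setT & Z in a].
have a'E Y : a' Y -> exists (r : R) Z, a Z /\ Y = r *: X + Z.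
  by move=> [r _ [Z aZ <-]]; exists r, Z.
have a'I (r : R) Z : a Z -> a' (r *: X + Z) by move=> aZ; exists r => //; exists Z.
have aL Z : a Z -> lie_algebra G Z by exact: (a_lie ap).
have aa' : a `<=` a' by move=> Z aZ; have := a'I 0 Z aZ; rewrite scale0r add0r.
have -> : a = a'.
  symmetry; apply: aU => //.
    split; first split; first exact: aa'.
      move=> r Y Y' /a'E[t [Z [aZ ->]]] /a'E[t' [Z' [aZ' ->]]].
      have -> : r *: (t *: X + Z) + (t' *: X + Z') = (r * t + t') *: X + (r *: Z + Z').
        by rewrite scalerDr scalerA addrACA -scalerDl.
      by apply: a'I; exact: aD.
    move=> Y Y' /a'E[t [Z [aZ ->]]] /a'E[t' [Z' [aZ' ->]]].
    have ZL := aL _ aZ; have ZL' := aL _ aZ'.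
    have YL' : lie_algebra G (t' *: X + Z') by exact: lie_combo.
    rewrite bracket_linearl//.
    rewrite (bracket_linearr t' XL XL ZL') (bracket_linearr t' ZL XL ZL').
    rewrite (X0 _ aZ) (ab _ _ aZ aZ').
    have -> : bracket X X = 0.
      have /eqP := bracket_anti X X; rewrite -subr_eq0 opprK -mulr2n -scaler_nat.
      by rewrite scaler_eq0 pnatr_eq0 => /orP[//|/eqP].
    have -> : bracket X Z' = 0 by rewrite bracket_anti X0// oppr0.
    by rewrite !scaler0 !addr0 scaler0.
  move=> Y /a'E[t [Z [aZ ->]]]; have [[ZL tZ] [_ sZ]] := apq _ aZ.
  have YL : lie_algebra G (t *: X + Z) by exact: lie_combo.
  have d (phi : G -> G) : d_invol phi (t *: X + Z) = t *: d_invol phi X + d_invol phi Z by [].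
  by split; split=> //; rewrite d ?Xp ?Xq ?tZ ?sZ scalerN opprD.
by have := a'I 1 0 a0; rewrite scale1r addr0.
Qed.

Lemma fixed_inv phi x : lie_involution phi -> fixed_points phi x ->
  fixed_points phi (x^-1%g : G).
Proof.
move=> [_ m _] fx; have m1 : phi 1%g = 1%g.
  have := m 1%g 1%g; rewrite mulg1 => /(congr1 (fun z => (phi 1%g)^-1 * z)%g).
  by rewrite mulVg mulKg.
have : (phi x * phi x^-1)%g = 1%g by rewrite -m mulgV.
rewrite /fixed_points /= fx => /(congr1 (fun z => x^-1 * z)%g).
by rewrite mulKg mulg1.
Qed.

Lemma ip_Ad k X Y : fixed_points theta k -> lie_algebra G X -> lie_algebra G Y ->
  ip (Ad k X) (Ad k Y) = ip X Y.
Proof.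
move=> fk; apply: (ip_push thC (conj_auto k)) => Z.
by have := d_invol_Ad k Z thI; rewrite fk.
Qed.

(** w is fixed by theta, so Ad w commutes with theta and preserves the inner product; w normalizes
    a, so the sign on a and the maximality of a are transported from sigma. *)
Lemma conjugate_cosymmetry w : normalizer (fixed_points theta) a w ->
  cosymmetry theta a (fun Z => Ad w (sg (Ad w^-1%g Z))).
Proof.
move=> [fw wa]; have fwV := fixed_inv thI fw.
have aV X : a X -> a (Ad w^-1%g X).
  by move=> aX; move: (aX); rewrite -{1}wa => -[X' aX' <-]; rewrite AdK.
have aw X : a X -> a (Ad w X) by move=> aX; rewrite -wa; exists X.
have apq : a `<=` minus_eigenspace theta `&` minus_eigenspace sigma by case: aM.
have sgL X : lie_algebra G X -> lie_algebra G (sg X) by exact: d_invol_lie.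
have AN g X : Ad g (- X) = - Ad g X by [].
split.
- by [].
- by move=> X XL; apply/Ad_lie/sgL/Ad_lie.
- by move=> X; rewrite AdK (d_involK _ sgI) AdVK.
- move=> X; rewrite (d_invol_Ad _ _ thI) fw -(d_invol_comm _ st) (d_invol_Ad _ _ thI).
  by rewrite fwV.
- by move=> X Y; rewrite Ad_bracket (d_invol_bracket _ _ sgI) Ad_bracket.
- move=> X Y XL YL; rewrite ip_Ad//; try exact/sgL/Ad_lie.
  rewrite (ip_push thC (invol_auto sgI)) ?ip_Ad//; try exact: Ad_lie.
  by move=> Z; rewrite -/(d_invol sigma _) -(d_invol_comm _ st).
- move=> X aX; have [_ [_ ->]] := apq _ (aV _ aX).
  by rewrite AN AdVK.
move=> X XL Xp Xs X0.
have -> : X = Ad w (Ad w^-1%g X) by rewrite AdVK.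
apply: (aw); apply: maximal_abelian_mem.
- exact: Ad_lie.
- by rewrite (d_invol_Ad _ _ thI) fwV Xp AN.
- by rewrite -[LHS](AdK w) Xs AN.
move=> Y aY; rewrite -[Y](AdK w) -Ad_bracket X0//; exact: aw.
Qed.

(* exp (t Y) is a path from 1 inside the fixed points. *)
Lemma exp_in_fixed H Y : lie_algebra G Y -> sg Y = Y ->
  connected_component H 1%g = connected_component (fixed_points sigma) 1%g ->
  H 1%g -> H (lie_exp Y).
Proof.
move=> YL Yh HE H1; have [[gc _] _ _] := lie_exp_curve YL.
have fx t : fixed_points sigma (lie_exp (t *: Y)).
  rewrite /fixed_points /=; have := push_exp (invol_auto sgI) (lieZ t YL).
  rewrite -/(d_invol sigma _) => <-; congr lie_exp.
  have -> : sg (t *: Y) = t *: sg Y by [].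
  by rewrite Yh.
have : connected_component (fixed_points sigma) 1%g (lie_exp Y).
  exists (range (fun t : R => lie_exp (t *: Y))); last by exists 1 => //; rewrite scale1r.
  split; first by exists 0 => //; rewrite scale0r lie_exp0.
    by move=> _ [t _ <-].
  apply: connected_continuous_connected.
    apply/connected_intervalP; by [].
  by apply: continuous_in_subspaceT => t _; exact: gc.
by rewrite -HE => /connected_component_sub.
Qed.

(** [lie_log] returns some logarithm in a. Roots do not see the choice: exp (alpha X) is the
    eigenvalue of Ad (exp X) on a root vector, and the real exponential is injective. *)
Lemma lie_logE X0 alpha : a X0 -> Sp alpha -> alpha (lie_log a (lie_exp X0)) = alpha X0.
Proof.
move=> aX0 /(pos_roots SpP)[_ _ [F [FL HF] F0]].
rewrite /lie_log; case: xgetP => [X _ [aX XE]|/(_ X0)]; last by case.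
have H1 := Ad_exp_eigen (a_lie ap aX) FL (HF _ aX).
have H2 := Ad_exp_eigen (a_lie ap aX0) FL (HF _ aX0).
rewrite XE H2 in H1; apply: expR_inj; apply/eqP; rewrite -subr_eq0; apply/eqP.
have : (expR (alpha X) - expR (alpha X0)) *: F = 0 by rewrite scalerBl H1 subrr.
by move/eqP; rewrite scaler_eq0 (negbTE F0) orbF => /eqP.
Qed.

(** C precedes I, X0 and w. This is possible because the expansion [sp] of the basis into weight
    vectors does not involve them, and the bound for one weight vector is governed by c and L. *)
Lemma uniform_splitting c : 0 < c -> exists2 C : R, 0 < C & forall I X0 w,
  I `<=` simple_roots Sp -> a X0 -> (forall alpha, Sp alpha -> 0 <= alpha X0) ->
  normalizer (fixed_points theta) a w ->
  (forall alpha, (simple_roots Sp `\` I) alpha -> c <= alpha (lie_log a (lie_exp X0))) ->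
  exists S1 S2 S3 S4 : E -> E,
  [/\ forall i : 'I_4, let S := tnth [tuple S1; S2; S3; S4] i in
      (forall x y, S (x - y) = S x - S y) /\ bounded_by S C,
    forall x, S1 x + S2 x + (S3 x + S4 x) = x &
    forall x, [/\ th (vf (S1 x)) = vf (S1 x), m_alg a Sp I (vf (S2 x)),
      a (vf (S3 x)) /\ (forall alpha, I alpha -> alpha (vf (S3 x)) = 0) &
      let Y := Ad w^-1%g (Ad (lie_exp X0)^-1%g (vf (S4 x))) in
      sg Y = Y /\ `|co Y| <= C * `|x|]].
Proof.
move=> c0; have [L L1 HL] := norm_ip_le thC.
pose sp j := sval (cid (weight_spanning thC aA ap (delta_mx 0 j))).
have spP j := svalP (cid (weight_spanning thC aA ap (delta_mx 0 j))).
(* The constant of [splittable_weight], with [expR c] as the lower bound for the exponentials of the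
   roots. *)
pose Cw := let k := (1 - (expR c)^-1 ^+ 2)^-1 in
  1 + (2 * L + 8 * k * L ^+ 3) + 8 * k * L ^+ 2 + (L + L ^+ 2 + 2 * L ^+ 3).
pose Bj j := \sum_(v <- sp j) `|Cw * `|v| |.
pose B := \sum_j Bj j.
have B0 : 0 <= B by apply: sumr_ge0 => j _; exact: sumr_ge0.
have c1 : 1 < expR c by rewrite -expR0 ltr_expR.
(* (n+1) B bounds the linear extensions, L pays for Ad w^-1, and the summand 1 ensures
   positivity. *)
pose C := L * (n.+1%:R * B) + 1.
have nB0 : 0 <= n.+1%:R * B by exact: mulr_ge0.
have C0 : 0 < C by rewrite ltr_wpDl// mulr_ge0//; exact: le_trans L1.
have nBC : n.+1%:R * B <= C.
  by apply: (@le_trans _ _ (L * (n.+1%:R * B))); [exact: ler_peMl|rewrite lerDl].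
exists C => // I X0 w IS aX0 X0p wN bnd.
have ID alpha : I alpha -> Sp alpha by move=> /IS[].
have X0L := a_lie ap aX0.
pose D Z := Ad (lie_exp X0)^-1%g Z.
have D_eigen (r : R) X : lie_algebra G X -> bracket X0 X = r *: X -> D X = expR (- r) *: X.
  move=> XL Xr; rewrite /D -lie_expN//; apply: Ad_exp_eigen => //; first exact: lieN.
  by rewrite bracketNl// Xr scaleNr.
have D_lin (r : R) X Y : D (r *: X + Y) = r *: D X + D Y by [].
have sC := conjugate_cosymmetry wN.
set s := (fun Z : vfield G => _) in sC.
(* The hypothesis bounds simple roots outside I through [lie_log]; [lie_logE] and the descent extend
   it to all positive roots outside the span of I. *)
have bd alpha : Sp alpha -> ~ Defs.span (I : set (vfield G -> R^o)) alpha ->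
    expR c <= expR (alpha X0).
  move=> Sa nIa; rewrite ler_expR; apply: (pos_root_bound ap SpP aX0 X0p _ Sa nIa) => b bJ.
  by have := bnd _ bJ; rewrite lie_logE//; case: bJ => -[].
have gw v : (forall X, a X -> exists r : R, bracket X (vf v) = r *: vf v) ->
    splittable theta a Sp I s D (Cw * `|v|) (vf v).
  move=> vw; have := splittable_weight thC aA ap SpP sC aX0 D_lin D_eigen ID L1 HL
    (vf_lie v) vw c1 bd.
  by rewrite co_vf.
have gj j : splittable theta a Sp I s D B (vf (delta_mx 0 j)).
  have [sw sE] := spP j; rewrite -/(sp j) in sw sE.
  apply: (splittable_le (B := Bj j)).
    by rewrite /B (bigD1 j)//= lerDl; apply: sumr_ge0 => i _; exact: sumr_ge0.
  rewrite sE /Bj; elim: (sp j) sw => [|v t IH] sw.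
    rewrite !big_nil vf0.
    have := splittable_k aA SpP sC D_lin ID (lie0 (G := G)) (erefl _).
    by rewrite co0 normr0.
  rewrite !big_cons vfD; apply: (splittable_add aA SpP sC D_lin ID).
    by apply: splittable_le (ler_norm _) _; apply: gw; apply: sw; rewrite mem_head.
  by apply: IH => u ut; apply: sw; rewrite in_cons ut orbT.
have [Z1 /choice[Z2 /choice[Z3 /choice[Z4 HZ]]]] : exists Z1 : 'I_n.+1 -> vfield G,
    forall j, exists Z2 Z3 Z4 : vfield G,
  [/\ lie_algebra G (Z1 j) /\ th (Z1 j) = Z1 j, m_alg a Sp I Z2,
      a Z3 /\ (forall alpha, I alpha -> alpha Z3 = 0),
      lie_algebra G Z4 /\ s (D Z4) = D Z4 & vf (delta_mx 0 j) = Z1 j + Z2 + (Z3 + Z4)] /\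
  [/\ `|co (Z1 j)| <= B, `|co Z2| <= B, `|co Z3| <= B, `|co Z4| <= B & `|co (D Z4)| <= B].
  by rewrite /splittable in gj; have [Z1 HZ1] := choice gj; exists Z1.
have Z1L j : lie_algebra G (Z1 j) by have [[[h _] _ _ _ _] _] := HZ j.
have Z2L j : lie_algebra G (Z2 j) by have [[_ h _ _ _] _] := HZ j; exact: m_alg_lie h.
have Z3L j : lie_algebra G (Z3 j) by have [[_ _ [h _] _ _] _] := HZ j; exact: (a_lie ap h).
have Z4L j : lie_algebra G (Z4 j) by have [[_ _ _ [h _] _] _] := HZ j.
have bde (Z : 'I_n.+1 -> vfield G) : (forall j, `|co (Z j)| <= B) -> bounded_by (lin_ext Z) C.
  move=> ZB u; apply: le_trans (lin_ext_bound u ZB) _.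
  by rewrite ler_wpM2r.
exists (lin_ext Z1), (lin_ext Z2), (lin_ext Z3), (lin_ext Z4); split.
- move=> i /=; have ok (Z : 'I_n.+1 -> vfield G) : (forall j, `|co (Z j)| <= B) ->
      (forall x y : E, lin_ext Z (x - y) = lin_ext Z x - lin_ext Z y) /\
      bounded_by (lin_ext Z) C.
    by move=> ZB; split; [exact: lin_extB|exact: bde].
  case: i => -[|[|[|[|//]]]] ?; apply: ok => j; by have [_ []] := HZ j.
- move=> x; rewrite /lin_ext -!big_split /=.
  rewrite [RHS](row_sum_delta x); apply: eq_bigr => j _.
  rewrite -!scalerDr; congr (_ *: _).
  by have [[_ _ _ _ h] _] := HZ j; rewrite -!coD -h co_vf.
move=> x.
have dualI alpha (r : R) X Y : I alpha -> a X -> a Y ->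
    alpha (r *: X + Y) = r * alpha X + alpha Y by exact: (dual_linear SpP ID).
split.
- apply: (lin_ext_mem (P := [set X | th X = X])) => //.
    by move=> r X Y /= h1 h2; have -> : th (r *: X + Y) = r *: th X + th Y by []; rewrite h1 h2.
  by move=> j; have [[[_ h] _ _ _ _] _] := HZ j.
- apply: (lin_ext_mem (P := m_alg a Sp I)) => //; [exact: m_alg0|exact: m_alg_linear|].
  by move=> j; have [[_ h _ _ _] _] := HZ j.
- apply: (lin_ext_mem (P := [set X | a X /\ forall alpha, I alpha -> alpha X = 0])) => //.
  + split; first by case: aA => -[].
    move=> alpha Ia; have [[a0 _] _] := aA.
    by have := dualI alpha (-1) 0 0 Ia a0 a0; rewrite scaler0 addr0 mulN1r addNr.
  + move=> r X Y [aX IX] [aY IY]; split; first by case: aA => -[_ h] _; exact: h.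
    by move=> alpha Ia; rewrite dualI// IX// IY// mulr0 addr0.
  + by move=> j; have [[_ _ h _ _] _] := HZ j.
move=> Y.
have DE : D (vf (lin_ext Z4 x)) = \sum_j x 0 j *: D (Z4 j).
  rewrite lin_ext_vf//; elim/big_rec2: _ => [|i X V _ <-]; first by [].
  exact: D_lin.
have sDY : s (D (vf (lin_ext Z4 x))) = D (vf (lin_ext Z4 x)).
  apply: (lin_ext_mem (P := [set X | s (D X) = D X])) => //.
    move=> r U V /= h1 h2.
    have -> : s (D (r *: U + V)) = r *: s (D U) + s (D V) by [].
    by rewrite h1 h2.
  by move=> j; have [[_ _ _ [_ h] _] _] := HZ j.
have DL : lie_algebra G (D (vf (lin_ext Z4 x))) by apply: Ad_lie; exact: vf_lie.
split.
  by rewrite /Y -[LHS](AdK w); congr (Ad _ _); exact: sDY.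
have [fw _] := wN; have fwV := fixed_inv thI fw.
apply: (@le_trans _ _ (L * `|co (D (vf (lin_ext Z4 x)))|)).
  by apply: HL => //; [exact: Ad_lie|rewrite ip_Ad].
have -> : co (D (vf (lin_ext Z4 x))) = lin_ext (fun j => D (Z4 j)) x.
  by rewrite DE co_sum; apply: eq_bigr => j _; rewrite coZ.
apply: (@le_trans _ _ (L * (n.+1%:R * B * `|x|))).
  rewrite ler_wpM2l//; first exact: le_trans L1.
  by apply: lin_ext_bound => j; have [_ []] := HZ j.
by rewrite mulrA ler_wpM2r// lerDl.
Qed.

End Factorization.

Lemma mulset_mem (G : groupType) (A B : set G) x y : A x -> B y -> (A *s B) (x * y)%g.
Proof. by move=> Ax By; exists x => //; exists y. Qed.

Theorem theorem1p3 (R : realType) (n : nat) (G : lieGroupType R n)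
    (sigma theta : G -> G) (H : set G) (a b : set (vfield G))
    (Sp : set (vfield G -> R)) (W : set G)
    (rho : G -> vfield G -> vfield G -> R) :
  let K := fixed_points theta in
  let O := ball_e rho in
  let Delta := simple_roots Sp in
  connected [set: G] -> ~ compact [set: G] -> semisimple G ->
  finite_set (@group_center G) ->
  lie_involution sigma ->
  closed H -> subgroup H ->
  connected_component H 1%g = connected_component (fixed_points sigma) 1%g ->
  cartan_involution theta ->
  (forall x, sigma (theta x) = theta (sigma x)) ->
  maximal_abelian_in (minus_eigenspace theta `&` minus_eigenspace sigma) a ->
  maximal_abelian_in (minus_eigenspace theta) b ->
  a `<=` b ->
  positive_system a Sp ->
  W `<=` normalizer K a `&` normalizer K b ->
  coset_representatives (normalizer K a)
    (normalizer (K `&` H) a *s centralizer K a) W ->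
  riemannian_metric rho ->
  forall c : R, 0 < c ->
  exists l eps0 : R, [/\ 1 < l, 0 < eps0 &
    forall I : set (vfield G -> R), I `<=` Delta ->
    let J := Delta `\` I in
    forall k a0 w h : G,
      K k -> closed_chamber a Sp a0 -> W w -> H h ->
      (forall alpha, J alpha -> c <= alpha (lie_log a a0)) ->
    let g := (k * a0 * w * h)%g in
    forall eps : R, 0 < eps -> eps < eps0 ->
      O eps *s [set g] `<=`
        ((K `&` O (l * eps)) *s [set k]) *s
        (M_sub a Sp I `&` O (l * eps)) *s
        ((A_sub a I `&` O (l * eps)) *s [set a0]) *s
        ([set w] *s ((H `&` O (l * eps)) *s [set h]))].
Proof.
move=> K O Delta cG _ _ _ sgI _ [H1 _ _] HE thC st aM _ _ SpP WN _ rhoR c c0.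
have thI : lie_involution theta by case: thC.
have ap : a `<=` minus_eigenspace theta by move=> X; case: aM => _ h _ /h[].
have [C1 [e1 [C10 e10 low]]] := dist_lower rhoR cG.
have [C2 [r2 [C20 r20 up]]] := dist_exp rhoR.
have [r1 [r10 onto]] := @exp_onto R n G.
have [L L1 HL] := norm_ip_le thC.
have [C3 C30 split4] := uniform_splitting thC sgI st aM SpP c0.
have [r3 r30 four] := @four_factor R n G C3 C30.
have L0 : 0 < L by exact: lt_le_trans ltr01 L1.
(* Bounds in units of eps: C1 for the chart coordinate u, 2 L C1 for z, 8 L C1 for the solution y,
   and C3 times that for its components. The first term of M has one more L, for Ad k applied to the
   first component; the second covers the other factors. *)
pose M := L * C3 * (8 * L * C1) + 8 * L * C1 * C3.
have M1 : 0 < 8 * L * C1 * C3 by rewrite !mulr_gt0.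
have M0 : 0 < M by rewrite addr_gt0// !mulr_gt0.
have LM : L * C3 * (8 * L * C1) <= M by rewrite lerDl ltW.
have CM : C3 * (8 * L * C1) <= M.
  by rewrite /M [X in _ <= _ + X]mulrC lerDr ltW// !mulr_gt0.
(* e1 and r1 / C1 bring x into the range of the exponential, r3 / (2 L C1) brings z within the
   radius of [four_factor], and r2 / M keeps the factors where [dist_exp] holds. The summand 2 gives
   l > 1 and makes the final distance estimate strict. *)
exists (C2 * M + 2), (Num.min (Num.min e1 (r1 / C1)) (Num.min (r2 / M) (r3 / (2 * L * C1)))).
have CM0 : 0 < C2 * M by rewrite mulr_gt0.
have l1 : 1 < C2 * M + 2 by lra.
split=> //.
  by rewrite !lt_min e10 !divr_gt0// !mulr_gt0.
move=> I ID J k a0 w h Kk [X0 [aX0 X0p] <-] Ww Hh bnd g eps eps_gt0.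
rewrite !lt_min => /andP[/andP[ee1 er1] /andP[er2 er3]].
move=> _ [x Ox [_ -> <-]].
have [u [uD un xE]] := low x eps ee1 Ox.
have ur1 : `|u| <= r1.
  by apply: le_trans un _; rewrite mulrC -ler_pdivlMr// ltW.
have [_ [v [vn vE]]] := onto u ur1.
have vL (y : 'rV[R]_n.+1) : lie_algebra G (vf y) by exact: vf_lie.
have fk : theta k = k by [].
have fkV := fixed_inv thI Kk.
pose z := co (Ad k^-1%g (vf v)).
have zE : vf z = Ad k^-1%g (vf v) by rewrite /z -lie_vf//; exact: Ad_lie.
have zn : `|z| <= 2 * L * C1 * eps.
  have h1 : `|z| <= L * `|v|.
    rewrite -{1}(co_vf (G := G) v); apply: HL; [exact: Ad_lie|exact: vL|].
    by rewrite (ip_Ad thC _ (vL v) (vL v)).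
  apply: le_trans h1 _; have -> : 2 * L * C1 * eps = L * (2 * (C1 * eps)) by ring.
  rewrite ler_wpM2l ?(ltW L0)//; apply: le_trans vn _.
  by rewrite ler_wpM2l.
have zr3 : `|z| <= r3.
  apply: le_trans zn _; rewrite mulrC -ler_pdivlMr; last by rewrite !mulr_gt0.
  exact: ltW er3.
have [_ wN] := (I, proj1 (WN w Ww)).
have [S1 [S2 [S3 [S4 [Sb Ssum SP]]]]] := split4 I X0 w ID aX0 X0p wN bnd.
have [y [yn yE]] := four S1 S2 S3 S4 Sb Ssum z zr3.
have [S1k S2m [S3a S3I]] := SP y; set Y := Ad w^-1%g _ => -[Yh Yn].
have yM : `|y| <= 8 * L * C1 * eps.
  apply: le_trans yn _; have -> : 8 * L * C1 * eps = 4 * (2 * L * C1 * eps) by ring.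
  by rewrite ler_wpM2l.
have nb (T : 'rV[R]_n.+1) : `|T| <= C3 * `|y| -> `|T| <= M * eps.
  move=> h1; apply: le_trans h1 _; apply: (@le_trans _ _ (C3 * (8 * L * C1 * eps))).
    by rewrite ler_wpM2l// ltW.
  by rewrite mulrA ler_wpM2r// ltW.
have small (X : vfield G) : lie_algebra G X -> `|co X| <= M * eps ->
    O ((C2 * M + 2) * eps) (lie_exp X).
  move=> XL Xn; rewrite (lie_vf XL) /O /ball_e /=.
  have Xr : `|co X| <= r2 by apply: le_trans Xn _; rewrite mulrC -ler_pdivlMr// ltW.
  apply: le_lt_trans (up _ Xr) _.
  apply: (@le_lt_trans _ _ (C2 * (M * eps))); first by rewrite ler_wpM2l// ltW.
  by rewrite mulrA ltr_pM2r// ltrDl.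
have b_ (i : 'I_4) : `|tnth [tuple S1; S2; S3; S4] i y| <= C3 * `|y|.
  by have [_] := Sb i; exact.
have b1 : `|S1 y| <= C3 * `|y| := b_ (@Ordinal 4 0 isT).
have b2 : `|S2 y| <= C3 * `|y| := b_ (@Ordinal 4 1 isT).
have b3 : `|S3 y| <= C3 * `|y| := b_ (@Ordinal 4 2 isT).
have S4L := vL (S4 y).
have YL : lie_algebra G Y by do 2 apply: Ad_lie.
pose Z1 := Ad k (vf (S1 y)).
have Z1L : lie_algebra G Z1 by exact: Ad_lie.
have Z1n : `|co Z1| <= M * eps.
  have h1 : `|co Z1| <= L * `|S1 y|.
    rewrite -{1}(co_vf (G := G) (S1 y)); apply: HL => //.
    by rewrite (ip_Ad thC _ (vL (S1 y)) (vL (S1 y))).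
  apply: le_trans h1 _; apply: (@le_trans _ _ (L * (C3 * (8 * L * C1 * eps)))).
    rewrite ler_wpM2l ?(ltW L0)//; apply: le_trans b1 _.
    by rewrite ler_wpM2l// ltW.
  have -> : L * (C3 * (8 * L * C1 * eps)) = L * C3 * (8 * L * C1) * eps by ring.
  by rewrite ler_wpM2r// ltW.
have KZ1 : K (lie_exp Z1).
  rewrite /K /fixed_points /= -(push_exp (invol_auto thI) Z1L) -/(d_invol theta _).
  by rewrite /Z1 (d_invol_Ad _ _ thI) fk S1k.
have e2m : M_sub a Sp I (lie_exp (vf (S2 y))).
  by move=> T [_]; apply; exists (vf (S2 y)).
have e3a : A_sub a I (lie_exp (vf (S3 y))) by exists (vf (S3 y)).
have e4h : H (lie_exp Y) by exact: exp_in_fixed HE H1.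
have xk : x = (k * (lie_exp (vf (S1 y)) * lie_exp (vf (S2 y)) *
    lie_exp (vf (S3 y)) * lie_exp (vf (S4 y))) * k^-1)%g.
  by rewrite -yE zE Ad_exp// invgK !mulgA mulgV mul1g -mulgA mulgV mulg1 vE.
have e1E : lie_exp Z1 = (k * lie_exp (vf (S1 y)) * k^-1)%g by exact: Ad_exp.
have e4E : lie_exp Y = (w^-1 * ((lie_exp X0)^-1 * lie_exp (vf (S4 y)) * lie_exp X0) * w)%g.
  by rewrite /Y Ad_exp ?invgK; [rewrite Ad_exp// invgK|exact: Ad_lie].
have q1 := Logic.conj KZ1 (small _ Z1L Z1n).
have S2n : `|co (vf (S2 y) : vfield G)| <= M * eps by rewrite co_vf; exact: nb.
have S3n : `|co (vf (S3 y) : vfield G)| <= M * eps by rewrite co_vf; exact: nb.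
have q2 := Logic.conj e2m (small _ (vL _) S2n).
have q3 := Logic.conj e3a (small _ (vL _) S3n).
have q4 := Logic.conj e4h (small _ YL (nb _ Yn)).
have -> : (x * g = lie_exp Z1 * k * lie_exp (vf (S2 y)) * (lie_exp (vf (S3 y)) * lie_exp X0) *
    (w * (lie_exp Y * h)))%g.
  rewrite e1E e4E xk /g.
  move: (lie_exp (vf (S1 y))) (lie_exp (vf (S2 y))) (lie_exp (vf (S3 y)))
    (lie_exp (vf (S4 y))) (lie_exp X0) => g1 g2 g3 g4 g0.
  by rewrite -!mulgA !(mulKg, mulVKg).
exact: (mulset_mem (mulset_mem (mulset_mem (mulset_mem q1 erefl) q2) (mulset_mem q3 erefl))
  (mulset_mem erefl (mulset_mem q4 erefl))).
Qed.
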